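(* Let $2\leq k\leq 9$ and let $p_k(n)$ denote the number of $k$-regular partitions of $n$. Set $N_2=150$, $N_3=220$, $N_4=75$, $N_5=164$, $N_6=60$, $N_7=148$, $N_8=78$, $N_9=138$. Then for all integers $n\geq N_k$, \[ p_k(n+1)p_k(n)^2-2p_k(n-1)p_k(n+1)^2+p_k(n-1)p_k(n)p_k(n+2)>0. \]
   Context: For $k\geq 2$, a $k$-regular partition of $n$ is a partition of $n$ (weakly decreasing sequence of positive integers summing to $n$) with no part divisible by $k$; equivalently $\sum_{n\geq 0}p_k(n)q^n=\prod_{m\geq 1}\frac{1-q^{km}}{1-q^m}$. *)

(* Defs.v *)
From mathcomp Require Import all_boot.
Set Implicit Arguments.
Unset Strict Implicit.
Unset Printing Implicit Defensive.

Definition is_partition (n : nat) (s : seq nat) : bool :=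
  [&& sorted geq s, all (fun m => 0 < m) s & sumn s == n].

Definition is_regular_partition (k n : nat) (s : seq nat) : bool :=
  is_partition n s && all (fun m => ~~ (k %| m)) s.

(* A partition of n has at most n parts, each at most n, so the partitions of n
   all lie in the finite type of sequences of length at most n over 'I_n.+1;
   [regular_partitionsE] checks that none is lost in this encoding. *)
Definition regular_partitions (k n : nat) : {set n.-bseq 'I_n.+1} :=
  [set t : n.-bseq 'I_n.+1 | is_regular_partition k n [seq val i | i <- t]].

Definition num_regular_partitions (k n : nat) : nat :=
  #|regular_partitions k n|.

Lemma is_partition_bound (n : nat) (s : seq nat) :
  is_partition n s -> size s <= n /\ all (fun m => m < n.+1) s.
Proof.
case/and3P=> _ + /eqP <-; elim: s => //= m s IHs /andP[m_gt0 /IHs[le_s lt_s]].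
split; first by rewrite -add1n leq_add.
rewrite ltnS leq_addr /=; apply: sub_all lt_s => i; rewrite !ltnS => le_i.
exact: leq_trans le_i (leq_addl _ _).
Qed.

Lemma regular_partitionsE (k n : nat) (S : seq (seq nat)) :
    uniq S -> (forall s, (s \in S) = is_regular_partition k n s) ->
  num_regular_partitions k n = size S.
Proof.
move=> uS memS; pose f (t : n.-bseq 'I_n.+1) := [seq val i | i <- t].
have f_inj : injective f.
  by move=> t u /(inj_map val_inj) eq_tu; apply: val_inj.
rewrite /num_regular_partitions cardE -(size_map f).
apply/perm_size/uniq_perm => //; first by rewrite map_inj_uniq ?enum_uniq.
move=> s; rewrite memS; apply/mapP/idP => [[t + ->] | reg_s].
  by rewrite mem_enum inE.
have [le_s lt_s] := is_partition_bound (proj1 (andP reg_s)).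
have eq_s : s = [seq val i | i <- [seq (inord m : 'I_n.+1) | m <- s]].
  rewrite -map_comp -[LHS]map_id; apply/eq_in_map => m /(allP lt_s) lt_m.
  by rewrite /= inordK.
have le_t : size [seq (inord m : 'I_n.+1) | m <- s] <= n by rewrite size_map.
by exists (Bseq le_t); rewrite ?mem_enum ?inE /f /= -?eq_s.
Qed.

(* Only the values for 2 <= k <= 9 matter. *)
Definition threshold (k : nat) : nat :=
  match k with
  | 2 => 150 | 3 => 220 | 4 => 75 | 5 => 164
  | 6 => 60  | 7 => 148 | 8 => 78 | 9 => 138
  | _ => 0
  end.

(* Main.v *)
(** Circle method. With [z = - log q], the logarithm of the generating function is
    [Lam k z = sum_j (bose (j z) - bose (k j z)) / j], [bose w = 1 / (e^w - 1)].
    Expanding [bose] into partial fractions and interchanging the two summations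
    gives the modular transformation [Lam k z = A / z + kappa + b z + Rem k z] with
    a remainder that is exponentially small near [0].  The main term of Cauchy's
    integral is then a residue at the essential singularity of [e^(A/z + N z)], a
    Bessel series, so that up to the constant factor [e^kappa],
    [p_k(n) = A Bes (A N) (1 + tiny)] with [N = n + b] and
    [Bes x = sum_j x^j / (j! (j+1)!)].

    Divided by [p_k(n-1) p_k(n) p_k(n+1)], the quantity to be bounded below is the
    second difference of the ratios of consecutive values, and it is positive in the
    limit because [x -> Bes (x + A) / Bes x] is convex: the logarithmic derivative of
    [Bes] solves a Riccati equation, which traps it between two truncations of its
    asymptotic expansion.  The estimates are effective for [n > 2500]; the remaining
    cases are computed with Euler's pentagonal number recurrence. *)

From Stdlib Require Reals Factorial Lra Lia ZArith.
From Coquelicot Require Coquelicot.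
Require Import Defs.

(** The second difference of the ratios has size about [A ^ 3 / Y ^ 5] with [Y = sqrt (A N)], while
    the relative error of the Bessel approximation is about [Y ^ 2 exp (- beta Y)] with [beta < 1].
    The exponent [beta] thus decides where the computation may stop, and it comes from the minor
    arc. No expansion at other roots of unity is made there: the logarithm is a sum over [j] of
    series in [q ^ j] with nonnegative coefficients, each dominated by its value at the real point,
    and two of them, [j = 1] and [j = k], lose a definite amount. The major arc ends where
    [|z| ^ 2 = t], so that [Re (1 / z) >= 1] on it; as [4 pi ^ 2 / k] exceeds [A] for [k <= 9], the
    decay of [Rem] outweighs the growth of [e ^ (A / z)]. Infinite products are never integrated:
    the product is cut at a large [M], which leaves the coefficient of order [n] unchanged and makes
    the error in the logarithm as small as desired. The expression is homogeneous of degree 3, so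
    the factor [e ^ kappa] cancels. *)

Module Analysis.

Import Reals Factorial Lra Lia ZArith Coquelicot.
Local Open Scope R_scope.

(** * Complex exponential and absolutely convergent series *)

Definition cexp (z : C) : C := (exp (Re z) * cos (Im z), exp (Re z) * sin (Im z)).

Lemma C_ext (z w : C) : Re z = Re w -> Im z = Im w -> z = w.
Proof. destruct z, w; simpl; intros -> ->; reflexivity. Qed.

Ltac cx := apply C_ext; unfold cexp, Re, Im; simpl.

Lemma cexp_plus (z w : C) : cexp (z + w) = Cmult (cexp z) (cexp w).
Proof.
unfold cexp; cx; rewrite exp_plus, ?cos_plus, ?sin_plus; ring.
Qed.

Lemma cexp_RtoC (x : R) : cexp (RtoC x) = RtoC (exp x).
Proof. cx; rewrite ?cos_0, ?sin_0; ring. Qed.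

Lemma cexp_0 : cexp 0 = 1.
Proof. now rewrite cexp_RtoC, exp_0. Qed.

Lemma Cmod_sqr (z : C) : Cmod z ^ 2 = Re z ^ 2 + Im z ^ 2.
Proof. apply Cmod2_alt. Qed.

Lemma Cmod_cexp (z : C) : Cmod (cexp z) = exp (Re z).
Proof.
apply Rsqr_inj; [apply Cmod_ge_0 | apply Rlt_le, exp_pos |].
rewrite !Rsqr_pow2, Cmod_sqr; simpl.
generalize (sin2_cos2 (Im z)); unfold Rsqr; nra.
Qed.

Lemma cexp_neq_0 (z : C) : cexp z <> 0.
Proof. apply Cmod_gt_0; rewrite Cmod_cexp; apply exp_pos. Qed.

Lemma cexp_opp (z : C) : cexp (- z) = Cinv (cexp z).
Proof.
assert (H : Cmult (cexp z) (cexp (- z)) = 1).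
  rewrite <- cexp_plus, Cplus_opp_r; apply cexp_0.
rewrite <- (Cmult_1_l (cexp (- z))), <- (Cinv_l (cexp z)) by apply cexp_neq_0.
rewrite <- Cmult_assoc, H; ring.
Qed.

Lemma cexp_natmul (n : nat) (z : C) : cexp (INR n * z) = Cpow (cexp z) n.
Proof.
induction n as [|n IH].
  simpl Cpow; replace (INR 0 * z)%C with (RtoC 0) by (simpl; ring); apply cexp_0.
rewrite S_INR, Cpow_S, <- IH, <- cexp_plus; f_equal; rewrite RtoC_plus; ring.
Qed.

Lemma cexp_conj (z : C) : cexp (Cconj z) = Cconj (cexp z).
Proof. cx; rewrite ?cos_neg, ?sin_neg; ring. Qed.

Lemma Cmod_le_abs (z : C) : Cmod z <= Rabs (Re z) + Rabs (Im z).
Proof.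
apply Rsqr_incr_0_var; [|generalize (Rabs_pos (Re z)) (Rabs_pos (Im z)); lra].
rewrite !Rsqr_pow2, Cmod_sqr, <- (pow2_abs (Re z)), <- (pow2_abs (Im z)).
generalize (Rabs_pos (Re z)) (Rabs_pos (Im z)); nra.
Qed.

Lemma im_le_Cmod (z : C) : Rabs (Im z) <= Cmod z.
Proof.
apply Rsqr_incr_0_var; [|apply Cmod_ge_0].
rewrite !Rsqr_pow2, Cmod_sqr, <- (pow2_abs (Im z)); nra.
Qed.

Lemma Cmod_R_pos (x : R) : 0 <= x -> Cmod x = x.
Proof. intros Hx; rewrite Cmod_R; now apply Rabs_pos_eq. Qed.

Lemma Cmod_triangle_inv (z w : C) : Cmod z - Cmod w <= Cmod (z + w).
Proof.
generalize (Cmod_triangle (z + w) (- w)); rewrite Cmod_opp.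
replace (z + w + - w)%C with z by ring; lra.
Qed.

Lemma Cmod_eq_0_le (z : C) : (forall eps : R, 0 < eps -> Cmod z <= eps) -> z = 0.
Proof.
intros H; apply Cmod_eq_0, Rle_antisym; [|apply Cmod_ge_0].
apply le_epsilon; intros eps Heps; rewrite Rplus_0_l; auto.
Qed.

(** The first [n] terms, the empty sum included; [sum_n] always contains the term of index 0. *)
Fixpoint csn (a : nat -> C) (n : nat) : C :=
  match n with O => 0 | S n => Cplus (csn a n) (a n) end.

Fixpoint rsn (a : nat -> R) (n : nat) : R :=
  match n with O => 0 | S n => rsn a n + a n end.

(** Taken on components, so that it reduces to real series; meaningful for families that satisfy
    [cabs]. *)
Definition csum (a : nat -> C) : C :=
  (Series (fun n => Re (a n)), Series (fun n => Im (a n))).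

Definition cabs (a : nat -> C) : Prop := ex_series (fun n => Cmod (a n)).

Lemma rsn_sum_n (a : nat -> R) (n : nat) : rsn a (S n) = sum_n a n.
Proof.
induction n as [|n IH]; [simpl; rewrite sum_O; ring|].
rewrite sum_Sn, <- IH; reflexivity.
Qed.

Lemma rsn_le (a b : nat -> R) (n : nat) :
  (forall i, (i < n)%nat -> a i <= b i) -> rsn a n <= rsn b n.
Proof.
induction n as [|n IH]; simpl; intros H; [lra|].
apply Rplus_le_compat; [apply IH; intros i Hi|]; apply H; lia.
Qed.

Lemma rsn_ext (a b : nat -> R) (n : nat) :
  (forall i, (i < n)%nat -> a i = b i) -> rsn a n = rsn b n.
Proof.
induction n as [|n IH]; simpl; intros H; [reflexivity|].
rewrite IH, (H n) by (intros; try apply H; lia); reflexivity.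
Qed.

Lemma csn_ext (a b : nat -> C) (n : nat) :
  (forall i, (i < n)%nat -> a i = b i) -> csn a n = csn b n.
Proof.
induction n as [|n IH]; simpl; intros H; [reflexivity|].
rewrite IH, (H n) by (intros; try apply H; lia); reflexivity.
Qed.

Lemma rsn_scal (c : R) (a : nat -> R) (n : nat) : rsn (fun i => c * a i) n = c * rsn a n.
Proof. induction n as [|n IH]; simpl; [|rewrite IH]; ring. Qed.

Lemma csn_scal (c : C) (a : nat -> C) (n : nat) : csn (fun i => c * a i)%C n = (c * csn a n)%C.
Proof. induction n as [|n IH]; simpl; [|rewrite IH]; ring. Qed.

Lemma csn_plus (a b : nat -> C) (n : nat) : csn (fun i => a i + b i)%C n = (csn a n + csn b n)%C.
Proof. induction n as [|n IH]; simpl; [|rewrite IH]; ring. Qed.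

Lemma csn_add (a : nat -> C) (m n : nat) :
  csn a (m + n) = (csn a m + csn (fun i => a (m + i)%nat) n)%C.
Proof.
induction n as [|n IH]; [rewrite Nat.add_0_r; simpl; ring|].
rewrite Nat.add_succ_r; simpl; rewrite IH; ring.
Qed.

Lemma csn_const (c : C) (n : nat) : csn (fun _ => c) n = (INR n * c)%C.
Proof.
induction n as [|n IH]; [simpl; ring|].
rewrite S_INR; simpl csn; rewrite IH, RtoC_plus; ring.
Qed.

Lemma Re_csn (a : nat -> C) (n : nat) : Re (csn a n) = rsn (fun i => Re (a i)) n.
Proof. induction n as [|n IH]; simpl; [|rewrite <- IH]; reflexivity. Qed.

Lemma Im_csn (a : nat -> C) (n : nat) : Im (csn a n) = rsn (fun i => Im (a i)) n.
Proof. induction n as [|n IH]; simpl; [|rewrite <- IH]; reflexivity. Qed.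

Lemma Cmod_csn (a : nat -> C) (n : nat) : Cmod (csn a n) <= rsn (fun i => Cmod (a i)) n.
Proof.
induction n as [|n IH]; simpl; [rewrite Cmod_0; lra|].
eapply Rle_trans; [apply Cmod_triangle|]; lra.
Qed.

Lemma is_series_rsn (a : nat -> R) (l : R) :
  is_series a l -> forall eps, 0 < eps -> exists N, forall n, (N <= n)%nat -> Rabs (rsn a n - l) < eps.
Proof.
intros H0 eps Heps.
assert (H : is_lim_seq (sum_n a) l) by exact H0; apply is_lim_seq_spec in H.
destruct (H (mkposreal eps Heps)) as [N HN]; exists (S N); intros [|n] Hn; [lia|].
rewrite rsn_sum_n; apply (HN n); lia.
Qed.

Lemma ex_series_Rabs_le (a b : nat -> R) :
  (forall n, Rabs (a n) <= b n) -> ex_series b -> ex_series a.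
Proof. apply (ex_series_le (V := R_CompleteNormedModule)). Qed.

Lemma cabs_le (a : nat -> C) (b : nat -> R) :
  (forall n, Cmod (a n) <= b n) -> ex_series b -> cabs a.
Proof.
intros H Hb; apply ex_series_Rabs_le with b; auto.
intros n; rewrite Rabs_pos_eq; [auto | apply Cmod_ge_0].
Qed.

Lemma cabs_Re (a : nat -> C) : cabs a -> ex_series (fun n => Re (a n)).
Proof. apply ex_series_Rabs_le; intros n; apply re_le_Cmod. Qed.

Lemma cabs_Im (a : nat -> C) : cabs a -> ex_series (fun n => Im (a n)).
Proof. apply ex_series_Rabs_le; intros n; apply im_le_Cmod. Qed.

Lemma cabs_ext (a b : nat -> C) : (forall n, a n = b n) -> cabs a -> cabs b.
Proof. intros H; apply ex_series_ext; intros n; now rewrite H. Qed.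

Lemma cabs_plus (a b : nat -> C) : cabs a -> cabs b -> cabs (fun n => a n + b n)%C.
Proof.
intros Ha Hb; apply cabs_le with (fun n => Cmod (a n) + Cmod (b n)).
  intros n; apply Cmod_triangle.
apply (ex_series_plus (V := R_NormedModule)); assumption.
Qed.

Lemma cabs_scal (c : C) (a : nat -> C) : cabs a -> cabs (fun n => c * a n)%C.
Proof.
intros Ha; apply cabs_le with (fun n => Cmod c * Cmod (a n)).
  intros n; rewrite Cmod_mult; lra.
apply (ex_series_scal (V := R_NormedModule) (Cmod c)); assumption.
Qed.

Lemma csum_ext (a b : nat -> C) : (forall n, a n = b n) -> csum a = csum b.
Proof. intros H; unfold csum; f_equal; apply Series_ext; intros n; now rewrite H. Qed.

Lemma csum_plus (a b : nat -> C) :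
  cabs a -> cabs b -> csum (fun n => a n + b n)%C = (csum a + csum b)%C.
Proof.
intros Ha Hb; cx.
  rewrite <- Series_plus by now apply cabs_Re. apply Series_ext; reflexivity.
rewrite <- Series_plus by now apply cabs_Im. apply Series_ext; reflexivity.
Qed.

Lemma csum_scal (c : C) (a : nat -> C) : cabs a -> csum (fun n => c * a n)%C = (c * csum a)%C.
Proof.
intros Ha; assert (Hr := cabs_Re a Ha); assert (Hi := cabs_Im a Ha).
assert (S1 := ex_series_scal (V := R_NormedModule) (Re c) _ Hr).
assert (S2 := ex_series_scal (V := R_NormedModule) (Im c) _ Hi).
assert (S3 := ex_series_scal (V := R_NormedModule) (Re c) _ Hi).
assert (S4 := ex_series_scal (V := R_NormedModule) (Im c) _ Hr).
cx; rewrite <- !Series_scal_l.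
  rewrite <- Series_minus by assumption; apply Series_ext; intros n; unfold Re, Im; simpl; ring.
rewrite <- Series_plus by assumption; apply Series_ext; intros n; unfold Re, Im; simpl; ring.
Qed.

Lemma csn_csum_lim (a : nat -> C) : cabs a -> forall eps, 0 < eps ->
  exists N, forall n, (N <= n)%nat -> Cmod (csn a n - csum a) < eps.
Proof.
intros Ha eps Heps.
destruct (is_series_rsn _ _ (Series_correct _ (cabs_Re a Ha)) (eps / 2)) as [N1 H1]; [lra|].
destruct (is_series_rsn _ _ (Series_correct _ (cabs_Im a Ha)) (eps / 2)) as [N2 H2]; [lra|].
exists (max N1 N2); intros n Hn.
eapply Rle_lt_trans; [apply Cmod_le_abs|].
specialize (H1 n ltac:(lia)); specialize (H2 n ltac:(lia)).
rewrite <- Re_csn in H1; rewrite <- Im_csn in H2.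
change (Re (csn a n - csum a)) with (Re (csn a n) - Series (fun n => Re (a n))).
change (Im (csn a n - csum a)) with (Im (csn a n) - Series (fun n => Im (a n))).
lra.
Qed.

Lemma csum_unique (a : nat -> C) (l : C) : cabs a ->
  (forall eps, 0 < eps -> exists N, forall n, (N <= n)%nat -> Cmod (csn a n - l) <= eps) ->
  csum a = l.
Proof.
intros Ha H; apply Ceq_minus, Cmod_eq_0_le; intros eps Heps.
destruct (csn_csum_lim a Ha (eps / 2)) as [N1 H1]; [lra|].
destruct (H (eps / 2)) as [N2 H2]; [lra|].
specialize (H1 (max N1 N2) ltac:(lia)); specialize (H2 (max N1 N2) ltac:(lia)).
replace (csum a - l)%C
  with (- (csn a (max N1 N2) - csum a) + (csn a (max N1 N2) - l))%C by ring.
eapply Rle_trans; [apply Cmod_triangle|]; rewrite Cmod_opp; lra.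
Qed.

Lemma rsn_le_Series (a : nat -> R) (n : nat) :
  (forall i, 0 <= a i) -> ex_series a -> rsn a n <= Series a.
Proof.
intros Hp Ha; apply Rnot_lt_le; intros Hlt.
destruct (is_series_rsn _ _ (Series_correct _ Ha) (rsn a n - Series a)) as [N HN]; [lra|].
assert (Hm : forall m, rsn a n <= rsn a (n + m)).
  induction m as [|m IH]; [rewrite Nat.add_0_r; lra|].
  rewrite Nat.add_succ_r; simpl; generalize (Hp (n + m)%nat); lra.
specialize (HN (n + N)%nat ltac:(lia)); specialize (Hm N).
rewrite Rabs_pos_eq in HN; lra.
Qed.

Lemma Cmod_csum (a : nat -> C) : cabs a -> Cmod (csum a) <= Series (fun n => Cmod (a n)).
Proof.
intros Ha; apply le_epsilon; intros eps Heps.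
destruct (csn_csum_lim a Ha eps Heps) as [N HN]; specialize (HN N (le_n N)).
replace (csum a) with (csn a N + - (csn a N - csum a))%C by ring.
eapply Rle_trans; [apply Cmod_triangle|]; rewrite Cmod_opp.
generalize (Cmod_csn a N); intros H.
generalize (rsn_le_Series (fun n => Cmod (a n)) N (fun i => Cmod_ge_0 _) Ha); lra.
Qed.

Lemma cabs_shift (a : nat -> C) (N : nat) : cabs a -> cabs (fun n => a (N + n)%nat).
Proof. intros Ha; apply (ex_series_incr_n (V := R_NormedModule) (fun n => Cmod (a n)) N), Ha. Qed.

Lemma csum_split (a : nat -> C) (N : nat) : cabs a ->
  csum a = (csn a N + csum (fun n => a (N + n)%nat))%C.
Proof.
intros Ha; apply csum_unique; [assumption|]; intros eps Heps.
destruct (csn_csum_lim _ (cabs_shift a N Ha) eps Heps) as [M HM].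
exists (N + M)%nat; intros n Hn; replace n with (N + (n - N))%nat by lia.
rewrite csn_add.
replace (csn a N + csn (fun i : nat => a (N + i)%nat) (n - N) -
   (csn a N + csum (fun n0 : nat => a (N + n0)%nat)))%C with
  (csn (fun i : nat => a (N + i)%nat) (n - N) - csum (fun n0 : nat => a (N + n0)%nat))%C by ring.
apply Rlt_le, HM; lia.
Qed.

Lemma Series_tail (a : nat -> R) : ex_series a -> forall eps, 0 < eps ->
  exists N, forall n, (N <= n)%nat -> Rabs (Series (fun i => a (n + i)%nat)) < eps.
Proof.
intros Ha eps Heps.
destruct (is_series_rsn _ _ (Series_correct _ Ha) eps Heps) as [N HN].
exists (S N); intros [|n] Hn; [lia|].
specialize (HN (S n) ltac:(lia)).
rewrite (Series_incr_n a (S n)) in HN by (try lia; assumption).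
rewrite rsn_sum_n, sum_n_Reals in HN; simpl pred in HN.
rewrite <- Rabs_Ropp.
match type of HN with Rabs ?x < _ => replace x with (- Series (fun k : nat => a (S n + k)%nat)) in HN by (simpl; ring) end.
assumption.
Qed.

Lemma cabs_0 : cabs (fun _ => 0).
Proof.
exists 0; apply filterlim_ext with (fun _ => 0); [|apply filterlim_const].
intros n; rewrite Cmod_0, sum_n_const; symmetry; apply Rmult_0_r.
Qed.

Lemma csum_0 : csum (fun _ => 0) = 0.
Proof.
apply csum_unique; [apply cabs_0|]; intros eps Heps; exists O; intros n _.
rewrite csn_const; replace (INR n * 0 - 0)%C with (RtoC 0) by ring.
rewrite Cmod_0; lra.
Qed.

(** Fubini for a double series dominated by a product. Finitely many rows are exchanged by
    linearity, and the product form makes the remaining rows small after summation over [n]. *)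
Lemma csum_swap (Phi : nat -> nat -> C) (u v : nat -> R) :
  (forall i n, Cmod (Phi i n) <= u i * v n) -> ex_series u -> ex_series v ->
  (forall i, 0 <= u i) -> (forall n, 0 <= v n) ->
  csum (fun i => csum (fun n => Phi i n)) = csum (fun n => csum (fun i => Phi i n)).
Proof.
intros H Hu Hv Pu Pv.
assert (Ar : forall i, cabs (fun n => Phi i n)).
  intros i; apply cabs_le with (fun n => u i * v n); [apply H|].
  apply (ex_series_scal (V := R_NormedModule) (u i)), Hv.
assert (Ac : forall n, cabs (fun i => Phi i n)).
  intros n; apply cabs_le with (fun i => u i * v n); [intros i; apply H|].
  apply ex_series_ext with (fun i => scal (v n) (u i)); [intros i; apply Rmult_comm|].
  apply (ex_series_scal (V := R_NormedModule) (v n)), Hu.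
assert (Br : forall i, Cmod (csum (fun n => Phi i n)) <= u i * Series v).
  intros i; eapply Rle_trans; [apply Cmod_csum, Ar|].
  rewrite <- Series_scal_l; apply Series_le.
    intros n; split; [apply Cmod_ge_0 | apply H].
  apply (ex_series_scal (V := R_NormedModule) (u i)), Hv.
apply csum_unique.
  apply cabs_le with (fun i => u i * Series v); [assumption|].
  apply ex_series_ext with (fun i => scal (Series v) (u i)); [intros i; apply Rmult_comm|].
  apply (ex_series_scal (V := R_NormedModule) (Series v)), Hu.
assert (Pv0 : 0 <= Series v).
  generalize (rsn_le_Series v 0 Pv Hv); simpl; lra.
intros eps Heps.
destruct (Series_tail u Hu (eps / (Series v + 1))) as [N HN]; [apply Rdiv_lt_0_compat; lra|].
exists N; intros m Hm; specialize (HN m Hm).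
assert (Fin : forall m, cabs (fun n => csn (fun i => Phi i n) m) /\
   csn (fun i => csum (fun n => Phi i n)) m = csum (fun n => csn (fun i => Phi i n) m)).
  clear - Ar; induction m as [|m [IH1 IH2]].
    simpl; split; [apply cabs_0 | now rewrite csum_0].
  simpl; split; [now apply cabs_plus|]; rewrite csum_plus, IH2 by auto; reflexivity.
destruct (Fin m) as [Fa Fe]; rewrite Fe.
assert (Ut : ex_series (fun i => u (m + i)%nat)).
  apply (ex_series_incr_n (V := R_NormedModule) u m), Hu.
assert (Bt : forall n, Cmod (csum (fun i => Phi (m + i)%nat n)) <= v n * Series (fun i => u (m + i)%nat)).
  intros n; eapply Rle_trans; [apply Cmod_csum; apply (cabs_shift (fun i => Phi i n) m), Ac|].
  rewrite <- Series_scal_l; apply Series_le.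
    intros i; split; [apply Cmod_ge_0 | rewrite Rmult_comm; apply H].
  apply (ex_series_scal (V := R_NormedModule) (v n)), Ut.
assert (Ct : ex_series (fun n => v n * Series (fun i => u (m + i)%nat))).
  apply ex_series_ext with (fun n => scal (Series (fun i => u (m + i)%nat)) (v n)); [intros i; apply Rmult_comm|].
  apply (ex_series_scal (V := R_NormedModule)), Hv.
assert (At : cabs (fun n => csum (fun i => Phi (m + i)%nat n))) by now apply cabs_le with (2 := Ct).
rewrite (csum_ext (fun n => csum (fun i => Phi i n))
   (fun n => csn (fun i => Phi i n) m + csum (fun i => Phi (m + i)%nat n))%C).
2: intros n; apply (csum_split (fun i => Phi i n)), Ac.
rewrite csum_plus by assumption.
match goal with |- Cmod (?a - (?a + ?b)) <= _ => replace (a - (a + b))%C with (- b)%C by ring end.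
rewrite Cmod_opp; eapply Rle_trans; [apply Cmod_csum, At|].
apply Rle_trans with (Series (fun n => v n * Series (fun i => u (m + i)%nat))).
  apply Series_le; [intros n; split; [apply Cmod_ge_0 | apply Bt] | assumption].
rewrite Series_scal_r.
apply Rlt_le, (Rle_lt_trans _ (Series v * Rabs (Series (fun i => u (m + i)%nat)))).
  apply Rmult_le_compat_l; [assumption | apply Rle_abs].
apply Rle_lt_trans with (Series v * (eps / (Series v + 1))).
  apply Rmult_le_compat_l; lra.
apply Rmult_lt_reg_r with (Series v + 1); [lra|].
replace (Series v * (eps / (Series v + 1)) * (Series v + 1)) with (Series v * eps) by (field; lra); nra.
Qed.

(* Coquelicot's extensionality goals live in the carrier of [R_NormedModule]. *)
Ltac toR := match goal with |- @eq _ ?a ?b => change (@eq R a b) end.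

(** * Derivatives of complex functions of a real variable *)

Definition cder (f : R -> C) (s : R) (d : C) : Prop :=
  is_derive (fun x => Re (f x)) s (Re d) /\ is_derive (fun x => Im (f x)) s (Im d).

Lemma cder_eq (f : R -> C) (s : R) (d d' : C) : cder f s d -> d = d' -> cder f s d'.
Proof. now intros H <-. Qed.

Lemma cder_ext (f g : R -> C) (s : R) (d : C) : (forall x, f x = g x) -> cder f s d -> cder g s d.
Proof.
intros H [H1 H2]; split.
  apply is_derive_ext with (fun x => Re (f x)); [intros x; now rewrite H | assumption].
apply is_derive_ext with (fun x => Im (f x)); [intros x; now rewrite H | assumption].
Qed.

Lemma is_derive_eq (f : R -> R) (s d d' : R) : is_derive f s d -> d = d' -> is_derive f s d'.
Proof. now intros H <-. Qed.

Lemma cder_const (c : C) (s : R) : cder (fun _ => c) s 0.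
Proof. split; apply (is_derive_const (V := R_NormedModule)). Qed.

Lemma cder_plus (f g : R -> C) (s : R) (df dg : C) :
  cder f s df -> cder g s dg -> cder (fun x => f x + g x)%C s (df + dg)%C.
Proof.
intros [H1 H2] [H3 H4]; split; apply (is_derive_plus (V := R_NormedModule)); assumption.
Qed.

Lemma is_derive_Rmult (f g : R -> R) (s df dg : R) :
  is_derive f s df -> is_derive g s dg ->
  is_derive (fun x => f x * g x) s (df * g s + f s * dg).
Proof.
intros H1 H2; apply (is_derive_mult f g s df dg); auto.
intros n m; apply Rmult_comm.
Qed.

Lemma cder_mult (f g : R -> C) (s : R) (df dg : C) :
  cder f s df -> cder g s dg -> cder (fun x => f x * g x)%C s (df * g s + f s * dg)%C.
Proof.
intros [H1 H2] [H3 H4]; split.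
  eapply is_derive_eq.
    apply (is_derive_minus (V := R_NormedModule)); apply is_derive_Rmult; eassumption.
  unfold Re, Im, minus, plus, opp; simpl; ring.
eapply is_derive_eq.
  apply (is_derive_plus (V := R_NormedModule)); apply is_derive_Rmult; eassumption.
unfold Re, Im, plus; simpl; ring.
Qed.

Lemma cder_scal (c : C) (f : R -> C) (s : R) (df : C) :
  cder f s df -> cder (fun x => c * f x)%C s (c * df)%C.
Proof.
intros H; eapply cder_eq; [apply cder_mult; [apply cder_const | exact H]|]; cbv beta; ring.
Qed.

Lemma cder_RtoC (f : R -> R) (s d : R) : is_derive f s d -> cder (fun x => RtoC (f x)) s (RtoC d).
Proof.
intros H; split; [exact H |].
apply (is_derive_const (K := R_AbsRing) (V := R_NormedModule) 0 s).
Qed.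

Lemma cder_id (s : R) : cder (fun x => RtoC x) s 1.
Proof. apply cder_RtoC, (is_derive_id (K := R_AbsRing)). Qed.

Lemma cder_cexp (f : R -> C) (s : R) (d : C) :
  cder f s d -> cder (fun x => cexp (f x)) s (d * cexp (f s))%C.
Proof.
intros [H1 H2].
assert (E : is_derive (fun x => exp (Re (f x))) s (Re d * exp (Re (f s)))).
  apply (is_derive_comp exp (fun x => Re (f x))); [apply is_derive_exp | assumption].
assert (Co : is_derive (fun x => cos (Im (f x))) s (Im d * - sin (Im (f s)))).
  apply (is_derive_comp cos (fun x => Im (f x))); [apply is_derive_cos | assumption].
assert (Si : is_derive (fun x => sin (Im (f x))) s (Im d * cos (Im (f s)))).
  apply (is_derive_comp sin (fun x => Im (f x))); [apply is_derive_sin | assumption].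
split.
  eapply is_derive_eq; [apply is_derive_Rmult; eassumption|].
  unfold cexp, Re, Im; simpl; ring.
eapply is_derive_eq; [apply is_derive_Rmult; eassumption|].
unfold cexp, Re, Im; simpl; ring.
Qed.

Lemma nonneg_derive_le (f df : R -> R) (a b : R) : a <= b ->
  (forall x, a <= x <= b -> is_derive f x (df x)) ->
  (forall x, a <= x <= b -> 0 <= df x) -> f a <= f b.
Proof.
intros Hab Hd Hp.
destruct (MVT_gen f a b df) as [c [Hc E]].
- intros x; rewrite Rmin_left, Rmax_right by assumption; intros Hx; apply Hd; lra.
- intros x; rewrite Rmin_left, Rmax_right by assumption; intros Hx.
  apply continuity_pt_filterlim, (ex_derive_continuous (V := R_NormedModule)).
  exists (df x); apply Hd; lra.
- rewrite Rmin_left, Rmax_right in Hc by assumption.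
  specialize (Hp c Hc); nra.
Qed.

(** Both [h + f] and [h - f] are monotone. *)
Lemma abs_le_of_derive (f df h dh : R -> R) (b : R) : 0 <= b ->
  (forall x, 0 <= x <= b -> is_derive f x (df x)) ->
  (forall x, 0 <= x <= b -> is_derive h x (dh x)) ->
  (forall x, 0 <= x <= b -> Rabs (df x) <= dh x) ->
  Rabs (f b - f 0) <= h b - h 0.
Proof.
intros Hb Hf Hh H; apply Rabs_le; split.
  enough (f 0 + h 0 <= f b + h b) by lra.
  apply (nonneg_derive_le (fun x => f x + h x) (fun x => df x + dh x)); auto.
    intros x Hx; apply (is_derive_plus (V := R_NormedModule)); auto.
  intros x Hx; generalize (H x Hx) (Rle_abs (- df x)); rewrite Rabs_Ropp; lra.
enough (h 0 - f 0 <= h b - f b) by lra.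
apply (nonneg_derive_le (fun x => h x - f x) (fun x => dh x - df x)); auto.
  intros x Hx; apply (is_derive_minus (V := R_NormedModule)); auto.
intros x Hx; generalize (H x Hx) (Rle_abs (df x)); lra.
Qed.

(** * Taylor remainders of the complex exponential *)

Lemma exp_mono (x y : R) : x <= y -> exp x <= exp y.
Proof. intros [H| ->]; [left; now apply exp_increasing | lra]. Qed.

Definition cexp_poly (z : C) (n : nat) : C := csn (fun j => / INR (fact j) * z ^ j)%C n.

Lemma INR_fact_S (n : nat) : INR (fact (S n)) = INR (S n) * INR (fact n).
Proof. now rewrite fact_simpl, mult_INR. Qed.

Lemma is_derive_pow_fact (n : nat) (s : R) :
  is_derive (fun x => x ^ S n / INR (fact (S n))) s (s ^ n / INR (fact n)).
Proof.
apply is_derive_ext with (fun x => / INR (fact (S n)) * x ^ S n).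
  intros x; toR; unfold Rdiv; ring.
eapply is_derive_eq.
  apply (is_derive_scal (fun x => x ^ S n)).
  apply (is_derive_pow (fun x => x) (S n) s 1), (is_derive_id (K := R_AbsRing)).
simpl pred; rewrite INR_fact_S; field; split; [apply INR_fact_neq_0 | apply not_0_INR; lia].
Qed.

Lemma cexp_poly_scal (s : R) (z : C) (n : nat) :
  cexp_poly (s * z) n = csn (fun j => RtoC (s ^ j / INR (fact j)) * z ^ j)%C n.
Proof.
unfold cexp_poly; apply csn_ext; intros j _.
rewrite Cpow_mult_l, RtoC_div, RtoC_pow by apply INR_fact_neq_0.
field; intros E; apply RtoC_inj in E; now apply INR_fact_neq_0 in E.
Qed.

Lemma cder_cexp_poly (z : C) (n : nat) (s : R) :
  cder (fun x => cexp_poly (x * z) (S n)) s (z * cexp_poly (s * z) n)%C.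
Proof.
induction n as [|n IH].
  apply cder_ext with (fun _ => RtoC 1).
    intros x; unfold cexp_poly; simpl; field.
  eapply cder_eq; [apply cder_const|]; unfold cexp_poly; simpl; ring.
apply cder_ext with
  (fun x : R => cexp_poly (x * z) (S n) + RtoC (x ^ S n / INR (fact (S n))) * z ^ S n)%C.
  intros x; rewrite !cexp_poly_scal; reflexivity.
eapply cder_eq.
  apply cder_plus; [exact IH|].
  apply cder_mult; [apply cder_RtoC, is_derive_pow_fact | apply cder_const].
rewrite !cexp_poly_scal; simpl csn; rewrite Cpow_S; cbv beta; ring.
Qed.

(** The remainder of order [n + 1] vanishes at [s = 0] and its derivative is [z] times the remainder
    of order [n]. Each integration costs a factor 2, because real and imaginary parts are estimated
    separately. *)
Lemma cexp_taylor_scal (z : C) (n : nat) (s : R) : 0 <= s <= 1 ->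
  Cmod (cexp (s * z) - cexp_poly (s * z) n) <=
    (2 * Cmod z * s) ^ n / INR (fact n) * exp (Cmod z).
Proof.
revert s; induction n as [|n IH]; intros s Hs.
  replace (cexp (s * z) - cexp_poly (s * z) 0)%C with (cexp (s * z))
    by (unfold cexp_poly; simpl; ring).
  rewrite Cmod_cexp, re_scal_l; simpl; unfold Rdiv; rewrite Rinv_1, !Rmult_1_l.
  apply exp_mono.
  generalize (re_le_Cmod z) (Rle_abs (Re z)) (Cmod_ge_0 z); nra.
pose (f (x : R) := (cexp (x * z) - cexp_poly (x * z) (S n))%C).
assert (D : forall x, cder f x (z * (cexp (x * z) - cexp_poly (x * z) n))%C).
  intros x; unfold f.
  apply cder_ext with (fun x : R => cexp (x * z) + (-1) * cexp_poly (x * z) (S n))%C.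
    intros y; ring.
  eapply cder_eq.
    apply cder_plus.
      apply cder_cexp, cder_mult; [apply cder_id | apply cder_const].
    apply cder_scal, cder_cexp_poly.
  cbv beta; ring.
pose (h x := (2 * Cmod z * x) ^ S n / INR (fact (S n)) * exp (Cmod z) / 2).
pose (dh x := Cmod z * ((2 * Cmod z * x) ^ n / INR (fact n) * exp (Cmod z))).
assert (Dh : forall x, is_derive h x (dh x)).
  intros x; unfold h, dh.
  apply is_derive_ext with
    (fun x => (2 * Cmod z) ^ S n * exp (Cmod z) / 2 * (x ^ S n / INR (fact (S n)))).
    intros y; toR; rewrite (Rpow_mult_distr (2 * Cmod z)); unfold Rdiv; ring.
  eapply is_derive_eq.
    apply (is_derive_scal (fun x => x ^ S n / INR (fact (S n)))), is_derive_pow_fact.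
  rewrite (Rpow_mult_distr (2 * Cmod z) x n); simpl; field; apply INR_fact_neq_0.
assert (B : forall x, 0 <= x <= s -> Cmod (z * (cexp (x * z) - cexp_poly (x * z) n)) <= dh x).
  intros x Hx; rewrite Cmod_mult; unfold dh.
  apply Rmult_le_compat_l; [apply Cmod_ge_0 | apply IH; lra].
assert (F0 : f 0 = 0).
  unfold f; rewrite cexp_poly_scal, Cmult_0_l, cexp_0.
  assert (P : forall m, csn (fun j : nat => RtoC (0 ^ j / INR (fact j)) * z ^ j)%C (S m) = 1).
    induction m as [|m IHm]; [simpl; unfold Rdiv; rewrite Rinv_1, Rmult_1_l; ring|].
    match goal with |- csn ?f _ = _ => change (csn f (S m) + f (S m) = 1)%C end.
    rewrite IHm, pow_i by lia; unfold Rdiv; rewrite Rmult_0_l; ring.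
  rewrite P; ring.
assert (H0 : h 0 = 0).
  unfold h; rewrite Rmult_0_r, pow_i by lia; unfold Rdiv; ring.
assert (R1 : Rabs (Re (f s)) <= h s).
  replace (Re (f s)) with (Re (f s) - Re (f 0)) by (rewrite F0; simpl; ring).
  replace (h s) with (h s - h 0) by (rewrite H0; ring).
  apply (abs_le_of_derive (fun x => Re (f x)) (fun x => Re (z * (cexp (x * z) - cexp_poly (x * z) n)))
    h dh); [lra | intros x _; apply D | intros x _; apply Dh |].
  intros x Hx; eapply Rle_trans; [apply re_le_Cmod | now apply B].
assert (R2 : Rabs (Im (f s)) <= h s).
  replace (Im (f s)) with (Im (f s) - Im (f 0)) by (rewrite F0; simpl; ring).
  replace (h s) with (h s - h 0) by (rewrite H0; ring).
  apply (abs_le_of_derive (fun x => Im (f x)) (fun x => Im (z * (cexp (x * z) - cexp_poly (x * z) n)))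
    h dh); [lra | intros x _; apply D | intros x _; apply Dh |].
  intros x Hx; eapply Rle_trans; [apply im_le_Cmod | now apply B].
change (Cmod (f s) <= (2 * Cmod z * s) ^ S n / INR (fact (S n)) * exp (Cmod z)).
eapply Rle_trans; [apply Cmod_le_abs|].
replace ((2 * Cmod z * s) ^ S n / INR (fact (S n)) * exp (Cmod z)) with (h s + h s)
  by (unfold h; field; apply INR_fact_neq_0).
lra.
Qed.

Lemma cexp_taylor (z : C) (n : nat) :
  Cmod (cexp z - cexp_poly z n) <= (2 * Cmod z) ^ n / INR (fact n) * exp (Cmod z).
Proof.
generalize (cexp_taylor_scal z n 1 ltac:(lra)); rewrite Cmult_1_l, Rmult_1_r; auto.
Qed.

Lemma cexp_sub_1 (z : C) : Cmod (cexp z - 1) <= 2 * Cmod z * exp (Cmod z).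
Proof.
generalize (cexp_taylor z 1).
replace (cexp_poly z 1) with (RtoC 1) by (unfold cexp_poly; simpl; field).
simpl; unfold Rdiv; rewrite Rinv_1, !Rmult_1_r; auto.
Qed.

Lemma cexp_sub_1_sub (z : C) : Cmod (cexp z - 1 - z) <= 2 * Cmod z ^ 2 * exp (Cmod z).
Proof.
generalize (cexp_taylor z 2).
replace (cexp_poly z 2) with (1 + z)%C by (unfold cexp_poly; simpl; field).
replace (cexp z - (1 + z))%C with (cexp z - 1 - z)%C by ring.
intros H; eapply Rle_trans; [exact H|]; simpl; lra.
Qed.

(** * Partial fractions of the hyperbolic cotangent *)

Definition bose (w : C) : C := / (cexp w - 1).
(** This is [coth (w / 2) / 2], the odd part of [bose]. *)
Definition hcoth (w : C) : C := bose w + / 2.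
Definition pii : C := (0, PI).

Lemma cexp_pii : cexp pii = Copp (RtoC 1).
Proof. unfold pii; cx; rewrite exp_0, ?cos_PI, ?sin_PI; ring. Qed.

Lemma cexp_2pii (w : C) : cexp (w + 2 * pii) = cexp w.
Proof.
replace (w + 2 * pii)%C with (w + (pii + pii))%C by ring.
rewrite !cexp_plus, cexp_pii; ring.
Qed.

Lemma cexp_neq_1 (w : C) : 0 < Re w -> cexp w <> 1.
Proof.
intros H E; assert (M := Cmod_cexp w); rewrite E, Cmod_1 in M.
assert (1 < exp (Re w)) by (rewrite <- exp_0; now apply exp_increasing); lra.
Qed.

Lemma cexp_sub_neq_0 (w : C) : 0 < Re w -> (cexp w - 1)%C <> 0.
Proof. intros H; apply Cminus_eq_contra, cexp_neq_1, H. Qed.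

Lemma RtoC_neq_0 (x : R) : x <> 0 -> RtoC x <> 0.
Proof. intros H E; apply H, RtoC_inj, E. Qed.

(* Iterating this duplication formula writes [hcoth w] as a mean over [2 ^ m] nodes,
   which tends termwise to the partial fraction series. *)
Lemma hcoth_double (u : C) : 0 < Re u ->
  (hcoth u + hcoth (u + pii))%C = (2 * hcoth (2 * u))%C.
Proof.
intros H; unfold hcoth, bose.
replace (2 * u)%C with (u + u)%C by ring; rewrite !cexp_plus, cexp_pii.
assert (N1 := cexp_sub_neq_0 u H).
assert (N2 : (cexp u * cexp u - 1)%C <> 0).
  rewrite <- cexp_plus; apply cexp_sub_neq_0; simpl; unfold Re in *; simpl; lra.
assert (N3 : (cexp u * Copp (RtoC 1) - 1)%C <> 0).
  intros E; apply N2.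
  replace (cexp u * cexp u - 1)%C with (- (cexp u * Copp (RtoC 1) - 1) * (cexp u - 1))%C by ring.
  rewrite E; ring.
field; repeat split; auto; try (apply RtoC_neq_0; lra).
now replace (RtoC (-1)) with (Copp (RtoC 1)) by (cx; ring).
Qed.

(** The preimages of [w] under multiplication by [2 ^ m] modulo the period [2 pi i]. *)
Definition node (w : C) (m j : nat) : C := ((w + INR j * (2 * pii)) * / INR (2 ^ m))%C.

Lemma INR_pow2_neq (m : nat) : INR (2 ^ m) <> 0.
Proof. rewrite pow_INR; apply pow_nonzero; simpl; lra. Qed.

Lemma INR_pow2_pos (m : nat) : 0 < INR (2 ^ m).
Proof. rewrite pow_INR; apply pow_lt; simpl; lra. Qed.

Lemma INR_pow2_S (m : nat) : INR (2 ^ S m) = 2 * INR (2 ^ m).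
Proof. rewrite Nat.pow_succ_r', mult_INR; reflexivity. Qed.

Lemma Re_node (w : C) (m j : nat) : Re (node w m j) = Re w / INR (2 ^ m).
Proof. unfold node; rewrite <- RtoC_inv by apply INR_pow2_neq; unfold Re; simpl; unfold Rdiv; ring. Qed.

Lemma Im_node (w : C) (m j : nat) : Im (node w m j) = (Im w + 2 * PI * INR j) / INR (2 ^ m).
Proof.
unfold node; rewrite <- RtoC_inv by apply INR_pow2_neq; unfold Im; simpl; unfold Rdiv; ring.
Qed.

Lemma hcoth_sum (w : C) (m : nat) : 0 < Re w ->
  csn (fun j => hcoth (node w m j)) (2 ^ m) = (INR (2 ^ m) * hcoth w)%C.
Proof.
intros Hw; induction m as [|m IH].
  simpl; unfold node; simpl; replace ((w + 0 * (2 * pii)) * / 1)%C with w by field; ring.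
replace (2 ^ S m)%nat with (2 ^ m + 2 ^ m)%nat by (simpl; lia).
rewrite csn_add, <- csn_plus, plus_INR, RtoC_plus.
replace ((INR (2 ^ m) + INR (2 ^ m)) * hcoth w)%C with (2 * (INR (2 ^ m) * hcoth w))%C by ring.
rewrite <- IH, <- csn_scal; apply csn_ext; intros j _.
assert (N := RtoC_neq_0 _ (INR_pow2_neq m)).
replace (node w m j) with (2 * node w (S m) j)%C.
2: unfold node; rewrite INR_pow2_S, RtoC_mult; field; repeat split; auto; apply RtoC_neq_0; lra.
replace (node w (S m) (2 ^ m + j)) with (node w (S m) j + pii)%C.
2: unfold node; rewrite INR_pow2_S, RtoC_mult, plus_INR, RtoC_plus; field; repeat split; auto; apply RtoC_neq_0; lra.
apply hcoth_double; rewrite Re_node; apply Rdiv_lt_0_compat; [assumption | apply INR_pow2_pos].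
Qed.

Lemma csn_rev (h : nat -> C) (n : nat) : csn h n = csn (fun j => h (n - 1 - j)%nat) n.
Proof.
induction n as [|n IH]; [reflexivity|].
change (S n) with (1 + n)%nat at 3; rewrite csn_add; simpl csn at 1 2; rewrite IH.
replace (n - 0 - 0)%nat with n by lia.
rewrite (csn_ext (fun i => h (S n - 1 - (1 + i))%nat) (fun j => h (n - 1 - j)%nat)).
  ring.
intros i Hi; f_equal; lia.
Qed.

(** Apart from 0 and the middle index [n + 1], the indices are matched so that each pair has sum
    [2 (n + 1)]; for the nodes these are [j] and [- j] modulo the period. *)
Lemma csn_pair (h : nat -> C) (n : nat) :
  csn h (2 * S n) = (h O + csn (fun j => h (S j) + h (2 * n + 1 - j)%nat) n + h (S n))%C.
Proof.
replace (2 * S n)%nat with (1 + (n + (1 + n)))%nat by lia.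
rewrite csn_add, csn_add, csn_add, csn_plus.
rewrite (csn_rev (fun i => h (1 + (n + (1 + i)))%nat)).
rewrite (csn_ext (fun j => h (1 + (n + (1 + (n - 1 - j))))%nat) (fun j => h (2 * n + 1 - j)%nat)).
2: intros i Hi; f_equal; lia.
simpl csn; rewrite (Nat.add_0_r n).
change (fun i : nat => h (1 + i)%nat) with (fun i => h (S i)); ring.
Qed.

(** Dominated convergence when the number of terms grows as well. The limits inherit the bound [b],
    so that both tails beyond a fixed [K] are uniformly small. *)
Lemma csn_tannery (a : nat -> nat -> C) (l : nat -> C) (b : nat -> R) (n : nat -> nat) :
  (forall m j, (j < n m)%nat -> Cmod (a m j) <= b j) -> ex_series b ->
  (forall K, exists M, forall m, (M <= m)%nat -> (K <= n m)%nat) ->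
  (forall j eps, 0 < eps -> exists M, forall m, (M <= m)%nat -> Cmod (a m j - l j) <= eps) ->
  forall eps, 0 < eps -> exists M, forall m, (M <= m)%nat ->
    Cmod (csn (a m) (n m) - csum l) <= eps.
Proof.
intros Ha Hb Hn Hlim eps Heps.
assert (Hl : forall j, Cmod (l j) <= b j).
  intros j; apply le_epsilon; intros d Hd.
  destruct (Hn (S j)) as [A HA]; destruct (Hlim j d Hd) as [B HB].
  specialize (HA (max A B) ltac:(lia)); specialize (HB (max A B) ltac:(lia)).
  replace (l j) with (a (max A B) j + - (a (max A B) j - l j))%C by ring.
  eapply Rle_trans; [apply Cmod_triangle|]; rewrite Cmod_opp.
  generalize (Ha (max A B) j ltac:(lia)); lra.
assert (Hc : cabs l) by now apply cabs_le with b.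
assert (Pb : forall j, 0 <= b j).
  intros j; eapply Rle_trans; [apply Cmod_ge_0 | apply Hl].
destruct (Series_tail b Hb (eps / 3)) as [K HK]; [lra|].
specialize (HK K (le_n K)).
assert (Ht : ex_series (fun i => b (K + i)%nat)) by now apply (ex_series_incr_n b K).
destruct (Hn K) as [M1 HM1].
assert (Hfin : forall k d, 0 < d -> exists M, forall m, (M <= m)%nat ->
   Cmod (csn (a m) k - csn l k) <= d).
  induction k as [|k IH]; intros d Hd.
    exists O; intros m _; simpl; replace (0 - 0)%C with (RtoC 0) by ring; rewrite Cmod_0; lra.
  destruct (IH (d / 2)) as [A HA]; [lra|]; destruct (Hlim k (d / 2)) as [B HB]; [lra|].
  exists (max A B); intros m Hm; specialize (HA m ltac:(lia)); specialize (HB m ltac:(lia)).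
  simpl; replace (csn (a m) k + a m k - (csn l k + l k))%C
    with ((csn (a m) k - csn l k) + (a m k - l k))%C by ring.
  eapply Rle_trans; [apply Cmod_triangle|]; lra.
destruct (Hfin K (eps / 3)) as [M2 HM2]; [lra|].
exists (max M1 M2); intros m Hm; specialize (HM1 m ltac:(lia)); specialize (HM2 m ltac:(lia)).
rewrite (csum_split l K Hc).
replace (n m) with (K + (n m - K))%nat at 1 by lia; rewrite csn_add.
match goal with |- Cmod (?x + ?y - (?z + ?t)) <= _ =>
  replace (x + y - (z + t))%C with ((x - z) + (y + - t))%C by ring end.
eapply Rle_trans; [apply Cmod_triangle|].
apply Rle_trans with (eps / 3 + (eps / 3 + eps / 3)); [|lra].
apply Rplus_le_compat; [assumption|].
eapply Rle_trans; [apply Cmod_triangle|]; rewrite Cmod_opp.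
assert (HS := Rle_abs (Series (fun i => b (K + i)%nat))).
apply Rplus_le_compat.
  eapply Rle_trans; [apply Cmod_csn|].
  eapply Rle_trans; [apply (rsn_le _ (fun i => b (K + i)%nat)); intros i Hi; apply Ha; lia|].
  eapply Rle_trans; [apply rsn_le_Series; [intros i; apply Pb | assumption]|]; lra.
eapply Rle_trans; [apply Cmod_csum, (cabs_shift l K), Hc|].
apply Rle_trans with (Series (fun i => b (K + i)%nat)); [|lra].
apply Series_le; [|assumption].
intros i; split; [apply Cmod_ge_0 | apply Hl].
Qed.

Lemma ex_series_telescope (a f : nat -> R) :
  (forall n, 0 <= a n <= f n - f (S n)) -> (forall n, 0 <= f n) -> ex_series a.
Proof.
intros H Hf.
destruct (ex_finite_lim_seq_incr (sum_n a) (f O)) as [l Hl].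
- intros n; rewrite sum_Sn; generalize (proj1 (H (S n))); unfold plus; simpl; lra.
- intros n; rewrite <- rsn_sum_n.
  assert (E : forall k, rsn a k <= f O - f k).
    induction k as [|k IH]; simpl; [lra|]; generalize (H k); lra.
  generalize (E (S n)) (Hf (S n)); lra.
- exists l; exact Hl.
Qed.

Lemma ex_series_inv_sqr : ex_series (fun n => / INR (S n) ^ 2).
Proof.
apply (ex_series_telescope _ (fun n => 2 / INR (S n))).
  intros n; rewrite (S_INR (S n)); assert (0 < INR (S n)) by (apply lt_0_INR; lia).
  assert (1 <= INR (S n)) by (apply (le_INR 1); lia).
  set (x := INR (S n)) in *; split.
    apply Rlt_le, Rinv_0_lt_compat; nra.
  apply Rmult_le_reg_r with (x ^ 2 * (x + 1)); [nra|].
  replace (/ x ^ 2 * (x ^ 2 * (x + 1))) with (x + 1) by (field; lra).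
  replace ((2 / x - 2 / (x + 1)) * (x ^ 2 * (x + 1))) with (2 * x) by (field; lra).
  lra.
intros n; apply Rlt_le, Rdiv_lt_0_compat; [lra | apply lt_0_INR; lia].
Qed.

Lemma sin_ge_third (x : R) : 0 <= x <= PI / 2 -> x / 3 <= sin x.
Proof.
intros [H1 H2]; assert (HP := PI_4).
destruct (sin_bound x 0) as [L _]; [assumption | lra|].
eapply Rle_trans; [|exact L]; unfold sin_approx; simpl; unfold sin_term; simpl.
assert (x * x <= 4) by nra.
nra.
Qed.

Lemma Cmod_cexp_sub_ge_Re (u : C) : Re u <= Cmod (cexp u - 1).
Proof.
generalize (Cmod_triangle_inv (cexp u) (RtoC 1)); rewrite Cmod_cexp, Cmod_1; intros H.
generalize (exp_ineq1_le (Re u)).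
replace (cexp u - 1)%C with (cexp u + - (1))%C by ring.
generalize (Cmod_triangle_inv (cexp u) (- (1))%C); rewrite Cmod_opp, Cmod_1, Cmod_cexp; lra.
Qed.

(** For [u = x + i y], [|e ^ u - 1| ^ 2 = (e ^ x - 1) ^ 2 + 4 e ^ x sin (y / 2) ^ 2]. *)
Lemma Cmod_cexp_sub_ge_sin (u : C) : 0 <= Re u -> 2 * Rabs (sin (Im u / 2)) <= Cmod (cexp u - 1).
Proof.
intros Hu; apply Rsqr_incr_0_var; [|apply Cmod_ge_0].
rewrite !Rsqr_pow2, Cmod_sqr, Rpow_mult_distr, pow2_abs.
replace (Re (cexp u - 1)) with (exp (Re u) * cos (2 * (Im u / 2)) - 1)
  by (unfold cexp, Re, Im; simpl; replace (2 * (snd u / 2)) with (snd u) by field; ring).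
replace (Im (cexp u - 1)) with (exp (Re u) * sin (2 * (Im u / 2)))
  by (unfold cexp, Re, Im; simpl; replace (2 * (snd u / 2)) with (snd u) by field; ring).
rewrite cos_2a_sin, sin_2a.
assert (E : 1 <= exp (Re u)) by (rewrite <- exp_0; now apply exp_mono).
generalize (sin2_cos2 (Im u / 2)); unfold Rsqr.
set (s := sin _); set (c := cos _); set (e := exp _) in *; intros Hsc.
replace ((e * (1 - 2 * s * s) - 1) ^ 2 + (e * (2 * s * c)) ^ 2) with
  (e * e * ((1 - 2 * s * s) * (1 - 2 * s * s) + 4 * s * s * (c * c)) - 2 * e * (1 - 2 * s * s) + 1) by ring.
replace (c * c) with (1 - s * s) by lra.
replace (e * e * ((1 - 2 * s * s) * (1 - 2 * s * s) + 4 * s * s * (1 - s * s)) - 2 * e * (1 - 2 * s * s) + 1)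
  with ((e - 1) ^ 2 + e * (4 * (s * s))) by ring.
assert (0 <= s * s) by nra. simpl; nra.
Qed.

Lemma Rabs_sin_sub (x y : R) : Rabs (sin (x + y)) >= Rabs (sin x) - Rabs y.
Proof.
assert (L : forall y, Rabs (sin y) <= Rabs y).
  assert (P : forall y, 0 <= y -> Rabs (sin y) <= y).
    intros z Hz.
    generalize (abs_le_of_derive sin cos (fun x => x) (fun _ => 1) z Hz
      (fun x _ => is_derive_sin x) (fun x _ => is_derive_id (K := R_AbsRing) x)).
    rewrite sin_0, !Rminus_0_r; intros H; apply H; intros x0 _; apply Rabs_le, COS_bound.
  intros z; destruct (Rle_dec 0 z).
    rewrite (Rabs_pos_eq z) by assumption; auto.
  rewrite <- (Rabs_Ropp z), <- (Rabs_Ropp (sin z)), <- sin_neg, (Rabs_pos_eq (- z)) by lra; apply P; lra.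
assert (E : sin x = sin (x + y) * cos y - cos (x + y) * sin y).
  rewrite <- sin_minus; f_equal; ring.
assert (Rabs (sin x) <= Rabs (sin (x + y)) + Rabs y).
  rewrite E; eapply Rle_trans; [apply Rabs_triang|]; rewrite Rabs_Ropp, !Rabs_mult.
  assert (C1 : Rabs (cos y) <= 1) by apply Rabs_le, COS_bound.
  assert (C2 : Rabs (cos (x + y)) <= 1) by apply Rabs_le, COS_bound.
  generalize (L y) (Rabs_pos (sin y)) (Rabs_pos (sin (x + y))) (Rabs_pos (cos y)) (Rabs_pos (cos (x + y))).
  intros; nra.
lra.
Qed.

Lemma Re_pos_neq_0 (w : C) : 0 < Re w -> w <> 0.
Proof. intros H E; rewrite E in H; simpl in H; lra. Qed.

(** For [u = v / M], [hcoth u - 1 / u = 1 / 2 - (e ^ u - 1 - u) / (u (e ^ u - 1))], which is bounded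
    by [1 / 2 + 8] when [|u| <= 1 / 8]. *)
Lemma hcoth_near_0 (v : C) (M : R) : 0 < M -> 0 < Re v -> Cmod v / M <= / 8 ->
  Cmod (/ M * hcoth (v * / M) - / v) <= 9 / M.
Proof.
intros HM Hv Hs.
assert (Nv := Re_pos_neq_0 v Hv).
assert (NM : RtoC M <> 0) by (apply RtoC_neq_0; lra).
assert (Pv : 0 < Cmod v) by now apply Cmod_gt_0.
set (u := (v * / M)%C).
assert (Hu : 0 < Re u).
  unfold u; rewrite <- RtoC_inv, re_scal_r by lra.
  apply Rmult_lt_0_compat; [assumption | now apply Rinv_0_lt_compat].
assert (Mu : Cmod u = Cmod v / M).
  unfold u; rewrite Cmod_mult, Cmod_inv, Cmod_R_pos by (auto; lra); reflexivity.
assert (Ne := cexp_sub_neq_0 u Hu).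
assert (Pu : 0 < Cmod u) by (rewrite Mu; apply Rdiv_lt_0_compat; lra).
assert (B := cexp_sub_1_sub u).
assert (Ex : exp (Cmod u) <= 2).
  apply Rle_trans with (exp (1 / 8)); [apply exp_mono; lra|].
  apply Rle_trans with (/ (1 - 1 / 8)); [|lra].
  rewrite <- (Ropp_involutive (1 / 8)) at 1; rewrite exp_Ropp.
  apply Rinv_le_contravar; [lra|]; generalize (exp_ineq1_le (- (1 / 8))); lra.
assert (B' : Cmod (cexp u - 1 - u) <= 4 * Cmod u ^ 2) by nra.
assert (L : Cmod u / 2 <= Cmod (cexp u - 1)).
  generalize (Cmod_triangle_inv u (cexp u - 1 - u)).
  replace (u + (cexp u - 1 - u))%C with (cexp u - 1)%C by ring; nra.
replace (/ M * hcoth u - / v)%C with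
  ((u * / 2 + - (cexp u - 1 - u) * / (cexp u - 1)) * / v)%C.
2: replace (/ RtoC M)%C with (u * / v)%C by (unfold u; field; auto);
   unfold hcoth, bose; field; repeat split; auto; apply RtoC_neq_0; lra.
rewrite Cmod_mult, (Cmod_inv v) by assumption.
assert (T : Cmod (u * / 2 + - (cexp u - 1 - u) * / (cexp u - 1)) <= 9 * Cmod u).
  eapply Rle_trans; [apply Cmod_triangle|].
  rewrite !Cmod_mult, Cmod_opp, (Cmod_inv (cexp u - 1)), (Cmod_inv 2), (Cmod_R_pos 2)
    by (try assumption; try lra; apply RtoC_neq_0; lra).
  apply Rle_trans with (Cmod u * / 2 + 4 * Cmod u ^ 2 * / (Cmod u / 2)).
    apply Rplus_le_compat_l, Rmult_le_compat.
    - apply Cmod_ge_0.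
    - apply Rlt_le, Rinv_0_lt_compat; lra.
    - assumption.
    - apply Rinv_le_contravar; lra.
  replace (4 * Cmod u ^ 2 * / (Cmod u / 2)) with (8 * Cmod u) by (field; lra); lra.
apply Rle_trans with (9 * Cmod u * / Cmod v).
  apply Rmult_le_compat_r; [apply Rlt_le, Rinv_0_lt_compat | ]; assumption.
rewrite Mu; apply Req_le; field; lra.
Qed.

(** The real part of the node gives the bound [Re w / 2 ^ m], its imaginary part gives
    [(2 j - |Im w|) / 2 ^ m] through the sine. If the second is too small, then [j <= |Im w|] and
    the first suffices. *)
Lemma node_lower (w : C) (m j : nat) : 0 < Re w -> (1 <= j)%nat -> (2 * j <= 2 ^ m)%nat ->
  Re w / (Re w + Rabs (Im w)) * INR j / INR (2 ^ m) <= Cmod (cexp (node w m j) - 1).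
Proof.
intros Hw Hj Hm.
assert (PM := INR_pow2_pos m); set (M := INR (2 ^ m)) in *.
assert (Hj1 : 1 <= INR j) by (apply (le_INR 1); lia).
assert (HjM : 2 * INR j <= M) by (unfold M; rewrite <- (mult_INR 2); apply le_INR, Hm).
assert (Pb := Rabs_pos (Im w)).
set (c := Re w / (Re w + Rabs (Im w))).
assert (Hc : 0 < c <= 1).
  unfold c; split; [apply Rdiv_lt_0_compat; lra|].
  apply Rmult_le_reg_r with (Re w + Rabs (Im w)); [lra|].
  unfold Rdiv; rewrite Rmult_assoc, Rinv_l; lra.
assert (Ec : c * (Re w + Rabs (Im w)) = Re w) by (unfold c; field; lra).
assert (HR : Re (node w m j) = Re w / M) by apply Re_node.
assert (PR : 0 <= Re (node w m j)) by (rewrite HR; apply Rlt_le, Rdiv_lt_0_compat; lra).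
assert (B1 := Cmod_cexp_sub_ge_Re (node w m j)).
assert (B2 := Cmod_cexp_sub_ge_sin (node w m j) PR).
assert (B3 : (2 * INR j - Rabs (Im w)) / M <= 2 * Rabs (sin (Im (node w m j) / 2))).
  rewrite Im_node; fold M.
  replace ((Im w + 2 * PI * INR j) / M / 2) with (PI * INR j / M + Im w / (2 * M)) by (field; lra).
  generalize (Rabs_sin_sub (PI * INR j / M) (Im w / (2 * M))); intros H.
  assert (HP : 3 < PI) by (generalize PI2_3_2; lra).
  assert (D0 : 0 <= PI * INR j / M) by (apply Rlt_le, Rdiv_lt_0_compat; nra).
  assert (D : 0 <= PI * INR j / M <= PI / 2).
    split; [assumption|].
    apply Rmult_le_reg_r with M; [assumption|].
    replace (PI * INR j / M * M) with (PI * INR j) by (field; lra); nra.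
  generalize (sin_ge_third _ D); intros HS.
  assert (HS2 : INR j / M <= PI * INR j / M / 3).
    apply Rmult_le_reg_r with (3 * M); [lra|].
    replace (INR j / M * (3 * M)) with (3 * INR j) by (field; lra).
    replace (PI * INR j / M / 3 * (3 * M)) with (PI * INR j) by (field; lra); nra.
  generalize (Rle_abs (sin (PI * INR j / M))); intros HA.
  rewrite Rabs_div, (Rabs_pos_eq (2 * M)) in H by lra.
  replace ((2 * INR j - Rabs (Im w)) / M) with (2 * (INR j / M - Rabs (Im w) / (2 * M))) by (field; lra).
  lra.
destruct (Rle_dec (c * INR j) (2 * INR j - Rabs (Im w))) as [Hd|Hd].
  apply Rle_trans with ((2 * INR j - Rabs (Im w)) / M); [|lra].
  apply Rmult_le_compat_r; [apply Rlt_le, Rinv_0_lt_compat|]; assumption.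
apply Rle_trans with (Re w / M); [|lra].
apply Rmult_le_compat_r; [apply Rlt_le, Rinv_0_lt_compat; assumption|].
assert (INR j <= Rabs (Im w)) by nra; nra.
Qed.

Lemma node_conj (w : C) (m j : nat) : (j <= 2 ^ m)%nat ->
  cexp (node w m (2 ^ m - j)) = Cconj (cexp (node (Cconj w) m j)).
Proof.
intros Hj; rewrite <- cexp_conj.
assert (E : node w m (2 ^ m - j) = (Cconj (node (Cconj w) m j) + 2 * pii)%C).
  assert (N := INR_pow2_neq m).
  apply C_ext.
    change (Re (node w m (2 ^ m - j)) = Re (node (Cconj w) m j) + Re (2 * pii)).
    rewrite !Re_node; unfold Re; simpl; ring.
  change (Im (node w m (2 ^ m - j)) = - Im (node (Cconj w) m j) + Im (2 * pii)).
  rewrite !Im_node, minus_INR by assumption; unfold Im; simpl; field; assumption.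
rewrite E; apply cexp_2pii.
Qed.

Lemma hcoth_add (u v : C) : cexp u <> 1 -> cexp v <> 1 ->
  (hcoth u + hcoth v = (cexp (u + v) - 1) * / ((cexp u - 1) * (cexp v - 1)))%C.
Proof.
intros Hu Hv; unfold hcoth, bose; rewrite cexp_plus; field.
repeat split; try (now apply Cminus_eq_contra); apply RtoC_neq_0; lra.
Qed.

(** A single node is only bounded by a multiple of [1 / j], which is not summable. The nodes of a
    pair add up to [2 w / 2 ^ m] modulo the period, so their sum has the small numerator
    [e ^ (2 w / 2 ^ m) - 1], and this gains the second factor [1 / j]. *)
Lemma node_pair_bound (w : C) (m j : nat) : 0 < Re w -> (1 <= j)%nat -> (2 * j <= 2 ^ m)%nat ->
  Cmod (/ INR (2 ^ m) * (hcoth (node w m j) + hcoth (node w m (2 ^ m - j)))) <=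
    4 * Cmod w * exp (2 * Cmod w) * ((Re w + Rabs (Im w)) / Re w) ^ 2 * / INR j ^ 2.
Proof.
intros Hw Hj Hm.
assert (PM := INR_pow2_pos m).
assert (Hn : forall i, 0 < Re (node w m i)).
  intros i; rewrite Re_node; apply Rdiv_lt_0_compat; assumption.
assert (L1 := node_lower w m j Hw Hj Hm).
assert (Hwc : 0 < Re (Cconj w)) by assumption.
assert (L2 := node_lower (Cconj w) m j Hwc Hj Hm).
rewrite re_conj, im_conj, Rabs_Ropp in L2.
assert (E2 : Cmod (cexp (node (Cconj w) m j) - 1) = Cmod (cexp (node w m (2 ^ m - j)) - 1)).
  rewrite node_conj by lia; rewrite <- Cmod_conj; f_equal.
  apply C_ext; simpl; ring.
rewrite E2 in L2.
rewrite hcoth_add by (apply cexp_neq_1; auto).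
assert (Es : cexp (node w m j + node w m (2 ^ m - j)) = cexp (2 * w * / INR (2 ^ m))).
  rewrite <- (cexp_2pii (2 * w * / INR (2 ^ m))); f_equal.
  assert (N := RtoC_neq_0 _ (INR_pow2_neq m)).
  unfold node; rewrite minus_INR, RtoC_minus by lia; field; assumption.
rewrite Es.
set (e1 := (cexp (node w m j) - 1)%C) in *; set (e2 := (cexp (node w m (2 ^ m - j)) - 1)%C) in *.
assert (N1 : e1 <> 0) by (apply cexp_sub_neq_0, Hn).
assert (N2 : e2 <> 0) by (apply cexp_sub_neq_0, Hn).
assert (P1 : 0 < Cmod e1) by now apply Cmod_gt_0.
assert (P2 : 0 < Cmod e2) by now apply Cmod_gt_0.
assert (Nm : RtoC (INR (2 ^ m)) <> 0) by apply RtoC_neq_0, INR_pow2_neq.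
rewrite !Cmod_mult, !Cmod_inv, Cmod_mult, Cmod_R_pos by (try assumption; try lra; now apply Cmult_neq_0).
set (M := INR (2 ^ m)) in *.
assert (M1 : 1 <= M) by (unfold M; apply (le_INR 1); lia).
assert (T : Cmod (cexp (2 * w * / M) - 1) <= 4 * Cmod w / M * exp (2 * Cmod w)).
  eapply Rle_trans; [apply cexp_sub_1|].
  rewrite !Cmod_mult, Cmod_inv, !Cmod_R_pos by (assumption || lra).
  replace (2 * (2 * Cmod w * / M)) with (4 * Cmod w / M) by (field; lra).
  apply Rmult_le_compat_l.
    apply Rmult_le_pos; [generalize (Cmod_ge_0 w); lra | apply Rlt_le, Rinv_0_lt_compat; lra].
  apply exp_mono; rewrite <- (Rmult_1_r (2 * Cmod w)) at 2.
  apply Rmult_le_compat_l; [generalize (Cmod_ge_0 w); lra|].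
  rewrite <- Rinv_1; apply Rinv_le_contravar; lra.
set (c := Re w / (Re w + Rabs (Im w))) in *.
assert (Hc : 0 < c) by (apply Rdiv_lt_0_compat; generalize (Rabs_pos (Im w)); lra).
replace ((Re w + Rabs (Im w)) / Re w) with (/ c)
  by (unfold c; field; generalize (Rabs_pos (Im w)); lra).
assert (Hj1 : 1 <= INR j) by (apply (le_INR 1); lia).
set (J := INR j) in *.
assert (Hq : 0 < c * J / M) by (apply Rdiv_lt_0_compat; nra).
apply Rle_trans with (/ M * (4 * Cmod w / M * exp (2 * Cmod w) * / ((c * J / M) * (c * J / M)))).
  apply Rmult_le_compat_l; [apply Rlt_le, Rinv_0_lt_compat; lra|].
  apply Rmult_le_compat; [apply Cmod_ge_0 | apply Rlt_le, Rinv_0_lt_compat; nra | exact T |].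
  apply Rinv_le_contravar; [nra|]; apply Rmult_le_compat; lra.
apply Req_le; field; lra.
Qed.

(** The joint contribution of the poles [2 pi i (n + 1)] and [- 2 pi i (n + 1)] to the partial
    fractions of [hcoth]. *)
Definition pf (w : C) (n : nat) : C := (2 * w * / (w * w + RtoC ((2 * PI * INR (S n)) ^ 2)))%C.

Lemma pow2_unbounded (K : nat) : (K <= 2 ^ K)%nat.
Proof. apply Nat.lt_le_incl, Nat.pow_gt_lin_r; lia. Qed.

Lemma pow2_large (x : R) : exists M, forall m, (M <= m)%nat -> x < INR (2 ^ m).
Proof.
destruct (INR_unbounded x) as [n Hn]; exists n; intros m Hm.
apply Rlt_le_trans with (1 := Hn), le_INR.
apply Nat.le_trans with (1 := Hm), pow2_unbounded.
Qed.

Lemma inv_pow2_small (A eps : R) : 0 < eps ->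
  exists M, forall m, (M <= m)%nat -> A / INR (2 ^ m) <= eps.
Proof.
intros He; destruct (pow2_large (A / eps)) as [M HM]; exists M; intros m Hm.
specialize (HM m Hm); assert (P := INR_pow2_pos m).
apply Rmult_le_reg_r with (INR (2 ^ m)); [assumption|].
replace (A / INR (2 ^ m) * INR (2 ^ m)) with (A / eps * eps) by (field; lra); nra.
Qed.

Lemma Re_add_imag (w : C) (y : R) : Re (w + y * (2 * pii)) = Re w.
Proof. unfold Re, pii; simpl; ring. Qed.

Lemma Re_sub_imag (w : C) (y : R) : Re (w - y * (2 * pii)) = Re w.
Proof. unfold Re, pii; simpl; ring. Qed.

Lemma pf_split (w : C) (n : nat) : 0 < Re w ->
  pf w n = (/ (w + INR (S n) * (2 * pii)) + / (w - INR (S n) * (2 * pii)))%C.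
Proof.
intros Hw; unfold pf; set (y := INR (S n)).
assert (N1 : (w + y * (2 * pii))%C <> 0).
  apply Re_pos_neq_0; now rewrite Re_add_imag.
assert (N2 : (w - y * (2 * pii))%C <> 0).
  apply Re_pos_neq_0; now rewrite Re_sub_imag.
replace (w * w + RtoC ((2 * PI * y) ^ 2))%C with ((w + y * (2 * pii)) * (w - y * (2 * pii)))%C.
  field; auto.
unfold pii; cx; ring.
Qed.

Lemma hcoth_pf (w : C) : 0 < Re w -> hcoth w = (/ w + csum (pf w))%C.
Proof.
intros Hw.
assert (Hw' : w <> 0) by now apply Re_pos_neq_0.
pose (M m := INR (2 ^ S m)).
assert (PM : forall m, 0 < M m) by (intros m; apply INR_pow2_pos).
pose (a m j := (/ M m * (hcoth (node w (S m) (S j)) + hcoth (node w (S m) (2 ^ S m - S j))))%C).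
pose (K := 4 * Cmod w * exp (2 * Cmod w) * ((Re w + Rabs (Im w)) / Re w) ^ 2).
(* Node 0 yields [1 / w] and the pairs yield [pf w]. At the middle node, whose imaginary part is
   close to [pi], [hcoth] stays bounded, so that its share vanishes after division by [M m]. *)
assert (E : forall m, hcoth w = (/ M m * hcoth (w * / M m) + csn (a m) (2 ^ m - 1)
    + / M m * hcoth (node w (S m) (2 ^ m)))%C).
  intros m.
  assert (Nm : RtoC (M m) <> 0) by (apply RtoC_neq_0; generalize (PM m); lra).
  assert (H := hcoth_sum w (S m) Hw); fold (M m) in H.
  assert (P : (1 <= 2 ^ m)%nat) by (clear; induction m; simpl; lia).
  replace (2 ^ S m)%nat with (2 * S (2 ^ m - 1))%nat in H by (simpl; lia).
  rewrite csn_pair in H.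
  replace (node w (S m) 0) with (w * / M m)%C in H by (unfold node, M; simpl INR; ring).
  replace (S (2 ^ m - 1)) with (2 ^ m)%nat in H by lia.
  unfold a; rewrite csn_scal.
  replace (hcoth w) with (/ M m * (M m * hcoth w))%C by (field; assumption).
  rewrite <- H; rewrite (csn_ext
    (fun j => hcoth (node w (S m) (S j)) + hcoth (node w (S m) (2 ^ S m - S j)))%C
    (fun j => hcoth (node w (S m) (S j)) + hcoth (node w (S m) (2 * (2 ^ m - 1) + 1 - j)))%C).
    ring.
  intros i Hi; replace (2 * (2 ^ m - 1) + 1 - i)%nat with (2 ^ S m - S i)%nat by (simpl; lia); reflexivity.
assert (Lim : forall eps, 0 < eps -> exists A, forall m, (A <= m)%nat ->
    Cmod (csn (a m) (2 ^ m - 1) - csum (pf w)) <= eps).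
  apply (csn_tannery a (pf w) (fun j => K * / INR (S j) ^ 2) (fun m => (2 ^ m - 1)%nat)).
  - intros m j Hj; apply node_pair_bound; [assumption | lia | simpl; lia].
  - apply (ex_series_scal (V := R_NormedModule) K (fun j => / INR (S j) ^ 2)), ex_series_inv_sqr.
  - intros k; exists (S k); intros m Hm.
    generalize (pow2_unbounded m); lia.
  - intros j eps Heps.
    set (v1 := (w + INR (S j) * (2 * pii))%C); set (v2 := (w - INR (S j) * (2 * pii))%C).
    assert (R1 : 0 < Re v1) by (unfold v1; now rewrite Re_add_imag).
    assert (R2 : 0 < Re v2) by (unfold v2; now rewrite Re_sub_imag).
    destruct (inv_pow2_small (Cmod v1) (/ 8)) as [A1 HA1]; [lra|].
    destruct (inv_pow2_small (Cmod v2) (/ 8)) as [A2 HA2]; [lra|].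
    destruct (inv_pow2_small 9 (eps / 2)) as [A3 HA3]; [lra|].
    exists (max (S j) (max A1 (max A2 A3))); intros m Hm.
    specialize (HA1 (S m) ltac:(lia)); specialize (HA2 (S m) ltac:(lia)); specialize (HA3 (S m) ltac:(lia)).
    fold (M m) in HA1, HA2, HA3.
    assert (H1 := hcoth_near_0 v1 (M m) (PM m) R1 HA1).
    assert (H2 := hcoth_near_0 v2 (M m) (PM m) R2 HA2).
    assert (Hc : hcoth (node w (S m) (2 ^ S m - S j)) = hcoth (v2 * / M m)).
      unfold hcoth, bose; do 3 f_equal.
      rewrite <- (cexp_2pii (v2 * / M m)); f_equal.
      assert (Nm : RtoC (M m) <> 0) by (apply RtoC_neq_0; generalize (PM m); lra).
      unfold node, v2; fold (M m); rewrite minus_INR, RtoC_minus.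
        fold (M m); field; assumption.
      apply Nat.le_trans with (2 := pow2_unbounded (S m)); lia.
    unfold a; rewrite Hc, pf_split by assumption; fold v1 v2.
    change (node w (S m) (S j)) with (v1 * / M m)%C.
    replace (/ M m * (hcoth (v1 * / M m) + hcoth (v2 * / M m)) - (/ v1 + / v2))%C with
      ((/ M m * hcoth (v1 * / M m) - / v1) + (/ M m * hcoth (v2 * / M m) - / v2))%C by ring.
    eapply Rle_trans; [apply Cmod_triangle|]; lra.
apply Ceq_minus, Cmod_eq_0_le; intros eps Heps.
destruct (Lim (eps / 4)) as [A1 HA1]; [lra|].
destruct (inv_pow2_small (Cmod w) (/ 8)) as [A2 HA2]; [lra|].
destruct (inv_pow2_small 9 (eps / 4)) as [A3 HA3]; [lra|].
destruct (inv_pow2_small (Rabs (Im w)) 1) as [A4 HA4]; [lra|].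
set (m := max (max A1 A2) (max A3 A4)).
specialize (HA1 m ltac:(lia)); specialize (HA2 (S m) ltac:(lia));
specialize (HA3 (S m) ltac:(lia)); specialize (HA4 (S m) ltac:(lia)).
fold (M m) in HA2, HA3, HA4.
assert (Hp := PM m).
assert (H1 := hcoth_near_0 w (M m) Hp Hw HA2).
assert (H2 : Cmod (/ M m * hcoth (node w (S m) (2 ^ m))) <= 9 / M m).
  set (u := node w (S m) (2 ^ m)).
  assert (Ru : 0 < Re u) by (unfold u; rewrite Re_node; apply Rdiv_lt_0_compat; assumption).
  assert (Nu := cexp_sub_neq_0 u Ru).
  assert (L : 1 <= Cmod (cexp u - 1)).
    apply Rle_trans with (2 := Cmod_cexp_sub_ge_sin u (Rlt_le _ _ Ru)).
    unfold u; rewrite Im_node; fold (M m).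
    replace ((Im w + 2 * PI * INR (2 ^ m)) / M m / 2) with (PI / 2 + Im w / (2 * M m)).
    2: unfold M; rewrite INR_pow2_S; field; apply INR_pow2_neq.
    generalize (Rabs_sin_sub (PI / 2) (Im w / (2 * M m))).
    rewrite sin_PI2, Rabs_R1, Rabs_div, (Rabs_pos_eq (2 * M m)) by lra.
    replace (Rabs (Im w) / (2 * M m)) with (Rabs (Im w) / M m / 2) by (field; lra); lra.
  rewrite Cmod_mult, Cmod_inv, Cmod_R_pos by (try lra; apply RtoC_neq_0; lra).
  rewrite Rmult_comm; apply Rmult_le_compat_r; [apply Rlt_le, Rinv_0_lt_compat; lra|].
  unfold hcoth, bose; eapply Rle_trans; [apply Cmod_triangle|].
  rewrite !Cmod_inv, (Cmod_R_pos 2) by (try lra; auto; apply RtoC_neq_0; lra).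
  assert (/ Cmod (cexp u - 1) <= 1) by (apply Rle_trans with (/ 1); [apply Rinv_le_contravar; lra | lra]); lra.
rewrite (E m).
match goal with |- Cmod (?x + ?y + ?z - (?t + ?s)) <= _ =>
  replace (x + y + z - (t + s))%C with ((x - t) + ((y - s) + z))%C by ring end.
eapply Rle_trans; [apply Cmod_triangle|].
assert (H3 := Cmod_triangle (csn (a m) (2 ^ m - 1) - csum (pf w)) (/ M m * hcoth (node w (S m) (2 ^ m)))).
lra.
Qed.

(** * The modular transformation *)

(* The weights [1], [1], ..., [1 - k] of a block of [k] consecutive terms add up to
   [0]; grouping by blocks makes the double series of partial fractions absolutely
   convergent. *)
Definition blk (k : nat) (h : nat -> C) (i : nat) : C :=
  (csn (fun r => h (k * i + S r)%nat) k - INR k * h (k * S i)%nat)%C.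

Lemma blk_diff (k : nat) (h : nat -> C) (i : nat) :
  blk k h i = csn (fun r => h (k * i + S r)%nat - h (k * S i)%nat)%C k.
Proof.
unfold blk; rewrite <- csn_const.
assert (E : forall n (a : nat -> C) c, (csn a n - csn (fun _ => c) n)%C = csn (fun r => a r - c)%C n).
  induction n as [|n IH]; intros a c; simpl; [|rewrite <- IH]; ring.
apply E.
Qed.

Lemma csn_blk (k : nat) (h : nat -> C) (n : nat) :
  csn (blk k h) n = (csn (fun m => h (S m)) (k * n) - INR k * csn (fun i => h (k * S i)%nat) n)%C.
Proof.
induction n as [|n IH]; [rewrite Nat.mul_0_r; simpl; ring|].
replace (k * S n)%nat with (k * n + k)%nat by lia.
rewrite csn_add; change (csn (blk k h) (S n)) with (csn (blk k h) n + blk k h n)%C.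
rewrite IH; unfold blk.
rewrite (csn_ext (fun i => h (S (k * n + i))) (fun r => h (k * n + S r)%nat)).
  simpl csn; ring.
intros r _; f_equal; lia.
Qed.

Lemma cabs_mul (k : nat) (h : nat -> C) : (1 <= k)%nat ->
  cabs (fun m => h (S m)) -> cabs (fun i => h (k * S i)%nat).
Proof.
intros Hk Hh.
destruct (ex_finite_lim_seq_incr (sum_n (fun i => Cmod (h (k * S i)%nat)))
  (Series (fun m => Cmod (h (S m))))) as [l Hl].
- intros n; rewrite sum_Sn; unfold plus; simpl.
  generalize (Cmod_ge_0 (h (k * S (S n))%nat)); simpl; lra.
- intros n; rewrite <- rsn_sum_n.
  apply Rle_trans with (rsn (fun m => Cmod (h (S m))) (k * S n)).
    generalize (S n); clear n; induction n as [|n IH]; [rewrite Nat.mul_0_r; simpl; lra|].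
    assert (M : forall a (f : nat -> R) b, (forall m, 0 <= f m) -> rsn f a <= rsn f (a + b)).
      intros a f b Hf; induction b as [|b IHb]; [rewrite Nat.add_0_r; lra|].
      rewrite Nat.add_succ_r; simpl; generalize (Hf (a + b)%nat); lra.
    assert (E0 : (k * S n = S (k * n + (k - 1)))%nat) by lia.
    apply Rle_trans with (rsn (fun m => Cmod (h (S m))) (k * n + (k - 1)) + Cmod (h (k * S n)%nat)).
      apply Rplus_le_compat_r, Rle_trans with (1 := IH), M; intros m; apply Cmod_ge_0.
    rewrite E0; apply Rle_refl.
  apply rsn_le_Series; [intros m; apply Cmod_ge_0 | assumption].
- exists l; exact Hl.
Qed.

Lemma csum_blk (k : nat) (h : nat -> C) : (1 <= k)%nat -> cabs (fun m => h (S m)) ->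
  cabs (blk k h) ->
  csum (blk k h) = (csum (fun m => h (S m)) - INR k * csum (fun i => h (k * S i)%nat))%C.
Proof.
intros Hk Hh Hb; assert (Hm := cabs_mul k h Hk Hh).
apply csum_unique; [assumption|]; intros eps Heps.
assert (Pk : 1 <= INR k) by (apply (le_INR 1); lia).
destruct (csn_csum_lim _ Hh (eps / 2)) as [A HA]; [lra|].
destruct (csn_csum_lim _ Hm (eps / (2 * INR k))) as [B HB]; [apply Rdiv_lt_0_compat; lra|].
exists (max A B); intros n Hn.
specialize (HA (k * n)%nat ltac:(nia)); specialize (HB n ltac:(lia)).
rewrite csn_blk.
match goal with |- Cmod (?x - ?k * ?y - (?z - ?k * ?t)) <= _ =>
  replace (x - k * y - (z - k * t))%C with ((x - z) + - (k * (y - t)))%C by ring end.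
eapply Rle_trans; [apply Cmod_triangle|]; rewrite Cmod_opp, Cmod_mult, Cmod_R_pos by lra.
apply Rle_trans with (eps / 2 + INR k * (eps / (2 * INR k))).
  apply Rplus_le_compat; [lra|]; apply Rmult_le_compat_l; lra.
apply Req_le; field; lra.
Qed.

Lemma blk_plus (k : nat) (h1 h2 : nat -> C) (i : nat) :
  blk k (fun m => h1 m + h2 m)%C i = (blk k h1 i + blk k h2 i)%C.
Proof. unfold blk; rewrite csn_plus; ring. Qed.

Lemma blk_ext (k : nat) (h1 h2 : nat -> C) (i : nat) : (1 <= k)%nat ->
  (forall m, (1 <= m)%nat -> h1 m = h2 m) -> blk k h1 i = blk k h2 i.
Proof.
intros Hk H; unfold blk; rewrite (H (k * S i)%nat) by lia.
rewrite (csn_ext _ (fun r => h2 (k * i + S r)%nat)); [reflexivity|].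
intros r _; apply H; lia.
Qed.

Lemma cabs_blk (k : nat) (h : nat -> C) (b : nat -> R) :
  (forall i r, (r < k)%nat -> Cmod (h (k * i + S r)%nat - h (k * S i)%nat) <= b i) ->
  forall i, Cmod (blk k h i) <= INR k * b i.
Proof.
intros H i; rewrite blk_diff; eapply Rle_trans; [apply Cmod_csn|].
apply Rle_trans with (rsn (fun _ => b i) k); [apply rsn_le; intros r Hr; now apply H|].
generalize k; clear; induction k as [|k IH]; [simpl; lra|].
rewrite S_INR; simpl rsn; lra.
Qed.

Lemma ex_series_scal_R (c : R) (a : nat -> R) : ex_series a -> ex_series (fun n => c * a n).
Proof. apply (ex_series_scal (V := R_NormedModule) c). Qed.

(** A term of the partial fractions of [bose (m z) / m]. The shape is nearly symmetric in [m] and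
    [n + 1]: as a function of [m] it is a term of the partial fractions of [hcoth] at [dual z n].
    This symmetry is the source of the modular transformation. *)
Definition mode (z : C) (n m : nat) : C :=
  (2 * z * / (RtoC (INR m ^ 2) * (z * z) + RtoC ((2 * PI * INR (S n)) ^ 2)))%C.

(** The linear factor [m z + 2 pi i s (n + 1)] of the denominator is bounded below by its real part
    [m Re z], or by [2 pi (n + 1) - m |z|] when [n + 1] dominates. *)
Lemma mode_factor (z : C) (m n : nat) (s : R) : 0 < Re z -> s = 1 \/ s = -1 ->
  Re z / (1 + Cmod z) * Rmax (INR m) (INR (S n)) <=
    Cmod (INR m * z + RtoC (s * INR (S n)) * (2 * pii)).
Proof.
intros Hz Hs.
assert (Pz := Cmod_ge_0 z).
assert (Rz := re_le_Cmod z); rewrite (Rabs_pos_eq (Re z)) in Rz by lra.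
set (tau := Re z / (1 + Cmod z)).
assert (Et : tau * (1 + Cmod z) = Re z) by (unfold tau; field; lra).
assert (Ht : 0 < tau) by (apply Rdiv_lt_0_compat; lra).
set (N := INR (S n)); assert (HN : 1 <= N) by (apply (le_INR 1); lia).
assert (Hm := pos_INR m); set (x := INR m) in *.
set (v := (x * z + RtoC (s * N) * (2 * pii))%C).
assert (Rv : Re v = x * Re z) by (unfold v, pii, Re; simpl; ring).
assert (B := re_le_Cmod v); rewrite Rv, Rabs_pos_eq in B by nra.
assert (HP : 3 < PI) by (generalize PI2_3_2; lra).
assert (B2 : 2 * PI * N - x * Cmod z <= Cmod v).
  generalize (Cmod_triangle_inv (RtoC (s * N) * (2 * pii)) (x * z)).
  rewrite (Cplus_comm (RtoC (s * N) * (2 * pii))); fold v.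
  rewrite !Cmod_mult, (Cmod_R_pos x), (Cmod_R_pos 2), Cmod_R, Rabs_mult, (Rabs_pos_eq N) by lra.
  replace (Rabs s) with 1 by (destruct Hs; subst s; [rewrite Rabs_R1 | rewrite Rabs_left by lra]; lra).
  replace (Cmod pii) with PI.
    lra.
  unfold pii, Cmod; simpl; replace (0 * (0 * 1) + PI * (PI * 1)) with (Rsqr PI) by (unfold Rsqr; ring).
  rewrite sqrt_Rsqr; lra.
apply Rmax_case_strong; intros Hmx.
  assert (tau <= Re z) by nra; assert (tau * x <= Re z * x) by (apply Rmult_le_compat_r; lra); lra.
assert (Ht1 : tau <= 1) by nra.
destruct (Rle_dec N (x * (1 + Cmod z))) as [H|H].
  apply Rle_trans with (tau * (x * (1 + Cmod z))); [apply Rmult_le_compat_l; lra|].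
  replace (tau * (x * (1 + Cmod z))) with (x * Re z) by (rewrite <- Et; ring); exact B.
assert (x * Cmod z <= N) by nra.
assert (tau * N <= 1 * N) by (apply Rmult_le_compat_r; lra).
assert (3 * N <= PI * N) by (apply Rmult_le_compat_r; lra).
lra.
Qed.

Lemma mode_den_neq_0 (z : C) (m n : nat) : 0 < Re z -> (1 <= m)%nat ->
  (RtoC (INR m ^ 2) * (z * z) + RtoC ((2 * PI * INR (S n)) ^ 2))%C <> 0 /\
  (Re z / (1 + Cmod z)) ^ 2 * Rmax (INR m) (INR (S n)) ^ 2 <=
    Cmod (RtoC (INR m ^ 2) * (z * z) + RtoC ((2 * PI * INR (S n)) ^ 2)).
Proof.
intros Hz Hm.
assert (F1 := mode_factor z m n 1 Hz (or_introl eq_refl)).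
assert (F2 := mode_factor z m n (-1) Hz (or_intror eq_refl)).
assert (Ht : 0 < Re z / (1 + Cmod z)) by (apply Rdiv_lt_0_compat; generalize (Cmod_ge_0 z); lra).
assert (Hx : 0 < Rmax (INR m) (INR (S n))).
  apply Rlt_le_trans with (INR (S n)); [apply lt_0_INR; lia | apply Rmax_r].
assert (E : (RtoC (INR m ^ 2) * (z * z) + RtoC ((2 * PI * INR (S n)) ^ 2))%C =
  ((INR m * z + RtoC (1 * INR (S n)) * (2 * pii)) * (INR m * z + RtoC (-1 * INR (S n)) * (2 * pii)))%C).
  unfold pii; cx; ring.
set (P := Re z / (1 + Cmod z) * Rmax (INR m) (INR (S n))) in *.
assert (HP : 0 < P) by (unfold P; nra).
assert (L : P ^ 2 <= Cmod (RtoC (INR m ^ 2) * (z * z) + RtoC ((2 * PI * INR (S n)) ^ 2))).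
  rewrite E, Cmod_mult; replace (P ^ 2) with (P * P) by ring; apply Rmult_le_compat; lra.
split.
  apply Cmod_gt_0; apply Rlt_le_trans with (2 := L); apply pow_lt, HP.
unfold P in L; rewrite Rpow_mult_distr in L; exact L.
Qed.

Definition r32 (n : nat) : R := / (INR (S n) * sqrt (INR (S n))).

Lemma r32_pos (n : nat) : 0 < r32 n.
Proof.
unfold r32; apply Rinv_0_lt_compat, Rmult_lt_0_compat; [|apply sqrt_lt_R0]; apply lt_0_INR; lia.
Qed.

Lemma ex_series_r32 : ex_series r32.
Proof.
apply (ex_series_telescope _ (fun n => 4 / sqrt (INR (S n)))).
  intros n; split; [apply Rlt_le, r32_pos|]; unfold r32.
  rewrite (S_INR (S n)).
  assert (H1 : 1 <= INR (S n)) by (apply (le_INR 1); lia); set (x := INR (S n)) in *.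
  assert (A : 0 < sqrt x) by (apply sqrt_lt_R0; lra).
  assert (B : 0 < sqrt (x + 1)) by (apply sqrt_lt_R0; lra).
  assert (A2 : sqrt x * sqrt x = x) by (apply sqrt_sqrt; lra).
  assert (B2 : sqrt (x + 1) * sqrt (x + 1) = x + 1) by (apply sqrt_sqrt; lra).
  set (a := sqrt x) in *; set (b := sqrt (x + 1)) in *.
  assert (Hab : a < b) by (unfold a, b; apply sqrt_lt_1; lra).
  apply Rmult_le_reg_r with (x * a * b * (a + b)); [repeat apply Rmult_lt_0_compat; lra|].
  replace (/ (x * a) * (x * a * b * (a + b))) with (b * (a + b)) by (field; lra).
  replace ((4 / a - 4 / b) * (x * a * b * (a + b))) with (4 * x * (b * b - a * a)) by (field; lra).
  rewrite A2, B2; nra.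
intros n; apply Rlt_le, Rdiv_lt_0_compat; [lra | apply sqrt_lt_R0, lt_0_INR; lia].
Qed.

(** A single mode is of order [max (m, n) ^ (-2)], not summable over both indices; differences
    within a block gain one more power. The exponent 3 is split evenly between [i] and [n], which
    gives the product of two summable weights that the interchange of summations requires. *)
Lemma mode_diff (z : C) (k n i r : nat) : 0 < Re z -> (r < k)%nat ->
  Cmod (mode z n (k * i + S r) - mode z n (k * S i)) <=
    4 * INR k * Cmod z ^ 3 / (Re z / (1 + Cmod z)) ^ 4 * (r32 i * r32 n).
Proof.
intros Hz Hr.
set (m := (k * i + S r)%nat); set (m' := (k * S i)%nat).
assert (Hm1 : (S i <= m)%nat) by (unfold m; nia).
assert (Hmm : (m <= m')%nat) by (unfold m, m'; nia).
assert (Hmk : (m' <= m + k)%nat) by (unfold m, m'; nia).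
destruct (mode_den_neq_0 z m n Hz ltac:(lia)) as [N1 L1].
destruct (mode_den_neq_0 z m' n Hz ltac:(lia)) as [N2 L2].
set (tau := Re z / (1 + Cmod z)) in *.
assert (Ht : 0 < tau) by (apply Rdiv_lt_0_compat; generalize (Cmod_ge_0 z); lra).
assert (Hi : 1 <= INR (S i)) by (apply (le_INR 1); lia).
assert (Hm1R : INR (S i) <= INR m) by now apply le_INR.
assert (HmmR : INR m <= INR m') by now apply le_INR.
assert (HmkR : INR m' <= INR m + INR k) by (rewrite <- plus_INR; now apply le_INR).
assert (Hn : 1 <= INR (S n)) by (apply (le_INR 1); lia).
unfold mode.
set (D1 := (RtoC (INR m ^ 2) * (z * z) + RtoC ((2 * PI * INR (S n)) ^ 2))%C) in *.
set (D2 := (RtoC (INR m' ^ 2) * (z * z) + RtoC ((2 * PI * INR (S n)) ^ 2))%C) in *.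
replace (2 * z * / D1 - 2 * z * / D2)%C with (2 * (z * z * z) * RtoC (INR m' ^ 2 - INR m ^ 2) * / (D1 * D2))%C.
2: { replace (2 * z * / D1 - 2 * z * / D2)%C with (2 * z * (D2 - D1) * / (D1 * D2))%C by (field; auto).
  replace (D2 - D1)%C with (RtoC (INR m' ^ 2 - INR m ^ 2) * (z * z))%C.
    ring.
  unfold D1, D2; rewrite RtoC_minus; ring. }
set (x := INR m) in *; set (x' := INR m') in *; set (y := INR (S n)) in *; set (I := INR (S i)) in *.
rewrite !Cmod_mult, Cmod_inv, Cmod_mult by (apply Cmult_neq_0; assumption).
rewrite (Cmod_R_pos 2), Cmod_R_pos by nra.
assert (PI0 : 0 < sqrt I) by (apply sqrt_lt_R0; lra).
assert (Py0 : 0 < sqrt y) by (apply sqrt_lt_R0; lra).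
assert (Q1 : tau ^ 2 * (I * y) <= Cmod D1).
  eapply Rle_trans; [|exact L1].
  apply Rmult_le_compat_l; [apply pow2_ge_0|].
  generalize (Rmax_l x y) (Rmax_r x y); intros; nra.
assert (Q2 : tau ^ 2 * (x' * (sqrt I * sqrt y)) <= Cmod D2).
  eapply Rle_trans; [|exact L2].
  apply Rmult_le_compat_l; [apply pow2_ge_0|].
  generalize (Rmax_l x' y) (Rmax_r x' y); intros.
  assert (S : sqrt I * sqrt y <= Rmax x' y).
    rewrite <- sqrt_mult by lra; rewrite <- (sqrt_Rsqr (Rmax x' y)) by lra.
    apply sqrt_le_1; unfold Rsqr; nra.
  assert (0 < sqrt I * sqrt y) by nra; nra.
assert (T2 : 0 < tau ^ 2) by (apply pow_lt, Ht).
assert (P1 : 0 < tau ^ 2 * (I * y)) by (apply Rmult_lt_0_compat; nra).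
assert (P2 : 0 < tau ^ 2 * (x' * (sqrt I * sqrt y))).
  apply Rmult_lt_0_compat; [assumption|]; apply Rmult_lt_0_compat; nra.
apply Rle_trans with (2 * (Cmod z * Cmod z * Cmod z) * (INR k * (2 * x')) *
  / ((tau ^ 2 * (I * y)) * (tau ^ 2 * (x' * (sqrt I * sqrt y))))).
  apply Rmult_le_compat.
  - generalize (Cmod_ge_0 z); intros; apply Rmult_le_pos; [|nra].
    apply Rmult_le_pos; [lra|]; repeat apply Rmult_le_pos; assumption.
  - apply Rlt_le, Rinv_0_lt_compat; nra.
  - apply Rmult_le_compat_l.
      generalize (Cmod_ge_0 z); intros; apply Rmult_le_pos; [lra|]; repeat apply Rmult_le_pos; assumption.
    generalize (pos_INR k); nra.
  - apply Rinv_le_contravar; [nra|]; apply Rmult_le_compat; lra.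
apply Req_le; unfold r32; fold I y; field; repeat split; lra.
Qed.

(** The number [zeta (2)], left as a series; numerical bounds take the place of its value
    [pi ^ 2 / 6]. *)
Definition Z2 : R := Series (fun n => / INR (S n) ^ 2).

Lemma csum_RtoC (a : nat -> R) : csum (fun n => RtoC (a n)) = RtoC (Series a).
Proof.
cx; [apply Series_ext; reflexivity|].
rewrite (Series_ext _ (fun n => 0 * 0)) by (intros; ring).
rewrite (Series_scal_l 0 (fun _ => 0)); ring.
Qed.

Lemma csum_scal_RtoC (c : C) (a : nat -> R) : ex_series (fun n => Rabs (a n)) ->
  csum (fun n => c * RtoC (a n))%C = (c * RtoC (Series a))%C.
Proof.
intros H; rewrite csum_scal, csum_RtoC; [reflexivity|].
apply cabs_le with (2 := H); intros n; rewrite Cmod_R; lra.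
Qed.

Lemma mode_pf (z : C) (n m : nat) : 0 < Re z -> (1 <= m)%nat ->
  mode z n m = (/ INR m * pf (INR m * z) n)%C.
Proof.
intros Hz Hm; unfold mode, pf.
assert (N : RtoC (INR m) <> 0) by (apply RtoC_neq_0, not_0_INR; lia).
destruct (mode_den_neq_0 z m n Hz Hm) as [N1 _].
rewrite RtoC_pow in *; field; split; [|assumption].
intros E; apply N1; rewrite <- E; ring.
Qed.

Lemma Re_inv_pos (z : C) : 0 < Re z -> 0 < Re (/ z).
Proof.
intros Hz; unfold Re in *; simpl; apply Rdiv_lt_0_compat; [assumption|]; nra.
Qed.

(** The multiples of [4 pi ^ 2 / z], the image of [z] under the modular inversion. *)
Definition dual (z : C) (n : nat) : C := (RtoC (4 * PI ^ 2 * INR (S n)) * / z)%C.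

Lemma Re_dual (z : C) (n : nat) : Re (dual z n) = 4 * PI ^ 2 * INR (S n) * Re (/ z).
Proof. apply re_scal_l. Qed.

Lemma Re_dual_pos (z : C) (n : nat) : 0 < Re z -> 0 < Re (dual z n).
Proof.
intros Hz; rewrite Re_dual; assert (H := Re_inv_pos z Hz).
apply Rmult_lt_0_compat; [apply Rmult_lt_0_compat; [|apply lt_0_INR; lia] | assumption].
generalize PI_RGT_0; nra.
Qed.

Lemma mode_dual (z : C) (n m : nat) : 0 < Re z ->
  mode z n (S m) = (/ INR (S n) * pf (dual z n) m)%C.
Proof.
intros Hz; unfold mode, pf, dual.
assert (Nz := Re_pos_neq_0 z Hz).
assert (Nn : RtoC (INR (S n)) <> 0) by (apply RtoC_neq_0, not_0_INR; lia).
assert (NP : RtoC PI <> 0) by (apply RtoC_neq_0; generalize PI_RGT_0; lra).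
destruct (mode_den_neq_0 z (S m) n Hz ltac:(lia)) as [N1 _].
rewrite !RtoC_pow, !RtoC_mult in *.
rewrite !RtoC_pow in *.
set (x := RtoC (INR (S m))) in *; set (y := RtoC (INR (S n))) in *; set (p := RtoC PI) in *.
field; repeat split; auto.
replace (4 * p ^ 2 * y * (4 * p ^ 2 * y) + (2 * p * x) ^ 2 * (z * z))%C
  with (4 * (p * p) * (x ^ 2 * (z * z) + (2 * p * y) ^ 2))%C by (simpl; ring).
repeat apply Cmult_neq_0; auto; apply RtoC_neq_0; lra.
Qed.

Lemma ex_series_bounded (a : nat -> R) (B : R) :
  (forall n, 0 <= a n) -> (forall n, rsn a n <= B) -> ex_series a.
Proof.
intros Ha HB; destruct (ex_finite_lim_seq_incr (sum_n a) B) as [l Hl].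
- intros n; rewrite sum_Sn; unfold plus; simpl; generalize (Ha (S n)); lra.
- intros n; rewrite <- rsn_sum_n; apply HB.
- exists l; exact Hl.
Qed.

Lemma rsn_add (a : nat -> R) (m n : nat) : rsn a (m + n) = rsn a m + rsn (fun i => a (m + i)%nat) n.
Proof.
induction n as [|n IH]; [rewrite Nat.add_0_r; simpl; ring|].
rewrite Nat.add_succ_r; simpl; rewrite IH; ring.
Qed.

Lemma cabs_blk_cabs (k : nat) (h : nat -> C) : (1 <= k)%nat ->
  cabs (fun m => h (S m)) -> cabs (blk k h).
Proof.
intros Hk Hh; assert (Hm := cabs_mul k h Hk Hh).
apply (ex_series_bounded _ (Series (fun m => Cmod (h (S m))) +
  INR k * Series (fun i => Cmod (h (k * S i)%nat)))).
  intros n; apply Cmod_ge_0.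
intros n; apply Rle_trans with
  (rsn (fun m => Cmod (h (S m))) (k * n) + INR k * rsn (fun i => Cmod (h (k * S i)%nat)) n).
  induction n as [|n IH]; [rewrite Nat.mul_0_r; simpl; lra|].
  replace (k * S n)%nat with (k * n + k)%nat at 1 by lia; rewrite rsn_add.
  change (rsn (fun n => Cmod (blk k h n)) (S n)) with
    (rsn (fun n => Cmod (blk k h n)) n + Cmod (blk k h n)).
  change (rsn (fun i => Cmod (h (k * S i)%nat)) (S n)) with
    (rsn (fun i => Cmod (h (k * S i)%nat)) n + Cmod (h (k * S n)%nat)).
  assert (H : Cmod (blk k h n) <= rsn (fun i => Cmod (h (S (k * n + i)))) k + INR k * Cmod (h (k * S n)%nat)).
    unfold blk; eapply Rle_trans; [apply Cmod_triangle|].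
    rewrite Cmod_opp, Cmod_mult, (Cmod_R_pos (INR k)) by apply pos_INR.
    apply Rplus_le_compat_r; eapply Rle_trans; [apply Cmod_csn|].
    apply Req_le, rsn_ext; intros r _; do 2 f_equal; lia.
  lra.
apply Rplus_le_compat.
  apply rsn_le_Series; [intros m; apply Cmod_ge_0 | assumption].
apply Rmult_le_compat_l; [apply pos_INR|].
apply rsn_le_Series; [intros m; apply Cmod_ge_0 | assumption].
Qed.

Lemma csn_csum (a : nat -> nat -> C) (k : nat) : (forall r, (r < k)%nat -> cabs (a r)) ->
  cabs (fun n => csn (fun r => a r n) k) /\
  csn (fun r => csum (a r)) k = csum (fun n => csn (fun r => a r n) k).
Proof.
induction k as [|k IH]; intros H; simpl.
  split; [apply cabs_0 | now rewrite csum_0].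
destruct IH as [IH1 IH2]; [intros r Hr; apply H; lia|].
split; [apply cabs_plus | rewrite csum_plus, IH2]; auto.
Qed.

Lemma Cmod_bose (w : C) : 0 < Re w -> Cmod (bose w) <= / (exp (Re w) - 1).
Proof.
intros Hw; unfold bose; rewrite Cmod_inv by now apply cexp_sub_neq_0.
apply Rinv_le_contravar.
  generalize (exp_ineq1 (Re w)); lra.
generalize (Cmod_triangle_inv (cexp w) (- (1))%C); rewrite Cmod_opp, Cmod_1, Cmod_cexp.
replace (cexp w + - (1))%C with (cexp w - 1)%C by ring; lra.
Qed.

Lemma Cmod_bose_inv (w : C) : 0 < Re w -> Cmod (bose w) <= / Re w.
Proof.
intros Hw; eapply Rle_trans; [now apply Cmod_bose|].
apply Rinv_le_contravar; [assumption|]; generalize (exp_ineq1_le (Re w)); lra.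
Qed.

Definition bterm (z : C) (m : nat) : C := (/ INR m * bose (INR m * z))%C.

(** The factor [INR k] turns [1 / (k j)] into [1 / j]; in this form the series is the sum of the
    blocks of [bterm z]. *)
Definition Lam (k : nat) (z : C) : C :=
  (csum (fun j => bterm z (S j)) - INR k * csum (fun j => bterm z (k * S j)))%C.

Lemma INR_S_pos (n : nat) : 0 < INR (S n).
Proof. apply lt_0_INR; lia. Qed.

Lemma cabs_bterm (z : C) : 0 < Re z -> cabs (fun m => bterm z (S m)).
Proof.
intros Hz; apply cabs_le with (fun m => / Re z * / INR (S m) ^ 2);
  [|apply ex_series_scal_R, ex_series_inv_sqr].
intros m; unfold bterm; assert (P := INR_S_pos m).
rewrite Cmod_mult, Cmod_inv, Cmod_R_pos by (try lra; apply RtoC_neq_0; lra).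
assert (Hr : Re (INR (S m) * z) = INR (S m) * Re z) by apply re_scal_l.
apply Rle_trans with (/ INR (S m) * / (INR (S m) * Re z)).
  apply Rmult_le_compat_l; [apply Rlt_le, Rinv_0_lt_compat, P|].
  rewrite <- Hr; apply Cmod_bose_inv; rewrite Hr; now apply Rmult_lt_0_compat.
apply Req_le; field; lra.
Qed.

Lemma Cmod_mode (z : C) (n m : nat) : 0 < Re z -> (1 <= m)%nat ->
  Cmod (mode z n m) <= 2 * Cmod z / (Re z / (1 + Cmod z)) ^ 2 * / Rmax (INR m) (INR (S n)) ^ 2.
Proof.
intros Hz Hm; destruct (mode_den_neq_0 z m n Hz Hm) as [N L]; unfold mode.
assert (Ht : 0 < Re z / (1 + Cmod z)) by (apply Rdiv_lt_0_compat; generalize (Cmod_ge_0 z); lra).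
assert (Hx : 0 < Rmax (INR m) (INR (S n))).
  apply Rlt_le_trans with (INR (S n)); [apply INR_S_pos | apply Rmax_r].
rewrite !Cmod_mult, Cmod_inv, (Cmod_R_pos 2) by (try assumption; lra).
set (tau := Re z / (1 + Cmod z)) in *; set (M := Rmax (INR m) (INR (S n))) in *.
apply Rle_trans with (2 * Cmod z * / (tau ^ 2 * M ^ 2)).
  apply Rmult_le_compat_l; [generalize (Cmod_ge_0 z); lra|].
  apply Rinv_le_contravar; [apply Rmult_lt_0_compat; now apply pow_lt | assumption].
apply Req_le; field; lra.
Qed.

Lemma cabs_mode_n (z : C) (m : nat) : 0 < Re z -> (1 <= m)%nat -> cabs (fun n => mode z n m).
Proof.
intros Hz Hm; eapply cabs_le; [intros n; apply Rle_trans with (1 := Cmod_mode z n m Hz Hm)|].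
  apply Rmult_le_compat_l.
    assert (Ht : 0 < Re z / (1 + Cmod z)) by (apply Rdiv_lt_0_compat; generalize (Cmod_ge_0 z); lra).
    apply Rmult_le_pos; [generalize (Cmod_ge_0 z); lra | apply Rlt_le, Rinv_0_lt_compat; nra].
  apply Rinv_le_contravar; [apply pow_lt, INR_S_pos|].
  apply pow_incr; split; [apply pos_INR | apply Rmax_r].
apply ex_series_scal_R, ex_series_inv_sqr.
Qed.

Lemma cabs_mode_m (z : C) (n : nat) : 0 < Re z -> cabs (fun m => mode z n (S m)).
Proof.
intros Hz; eapply cabs_le.
  intros m; apply Rle_trans with (1 := Cmod_mode z n (S m) Hz ltac:(lia)).
  apply Rmult_le_compat_l.
    assert (Ht : 0 < Re z / (1 + Cmod z)) by (apply Rdiv_lt_0_compat; generalize (Cmod_ge_0 z); lra).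
    apply Rmult_le_pos; [generalize (Cmod_ge_0 z); lra | apply Rlt_le, Rinv_0_lt_compat; nra].
  apply Rinv_le_contravar; [apply pow_lt, INR_S_pos|].
  apply pow_incr; split; [apply pos_INR | apply Rmax_l].
apply ex_series_scal_R, ex_series_inv_sqr.
Qed.

Lemma csum_mode_m (z : C) (n : nat) : 0 < Re z ->
  csum (fun m => mode z n (S m)) = (/ INR (S n) * (hcoth (dual z n) - / dual z n))%C.
Proof.
intros Hz; assert (Hd := Re_dual_pos z n Hz).
assert (Nn : RtoC (INR (S n)) <> 0) by (apply RtoC_neq_0; generalize (INR_S_pos n); lra).
rewrite (csum_ext _ (fun m => / INR (S n) * pf (dual z n) m)%C) by (intros m; now apply mode_dual).
assert (Hc : cabs (pf (dual z n))).
  apply cabs_ext with (fun m => INR (S n) * mode z n (S m))%C; [|now apply cabs_scal, cabs_mode_m].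
  intros m; rewrite mode_dual by assumption; field; assumption.
rewrite csum_scal, (hcoth_pf _ Hd) by assumption.
f_equal; ring.
Qed.

Lemma csum_mode_n (z : C) (m : nat) : 0 < Re z -> (1 <= m)%nat ->
  csum (fun n => mode z n m) = (/ INR m * (hcoth (INR m * z) - / (INR m * z)))%C.
Proof.
intros Hz Hm.
assert (Pm : 0 < INR m) by (apply lt_0_INR; lia).
assert (Hd : 0 < Re (INR m * z)) by (rewrite re_scal_l; now apply Rmult_lt_0_compat).
assert (Nn : RtoC (INR m) <> 0) by (apply RtoC_neq_0; lra).
rewrite (csum_ext _ (fun n => / INR m * pf (INR m * z) n)%C) by (intros n; now apply mode_pf).
assert (Hc : cabs (pf (INR m * z))).
  apply cabs_ext with (fun n => INR m * mode z n m)%C; [|now apply cabs_scal, cabs_mode_n].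
  intros n; rewrite mode_pf by assumption; field; assumption.
rewrite csum_scal, (hcoth_pf _ Hd) by assumption.
f_equal; ring.
Qed.

(** The constant term [- 1 / 2] of [bose] at 0, divided by [m]. Its series diverges, but the series
    of its blocks converges. *)
Definition harm (m : nat) : C := RtoC (- / (2 * INR m)).
(** The value is [- (log k) / 2], because the blocks of [1 / m] sum to [log k]. *)
Definition kappa (k : nat) : R := Re (csum (blk k harm)).
Definition Acoef (k : nat) : R := (1 - / INR k) * Z2.
(** With [zeta (2) = pi ^ 2 / 6] this is [(k - 1) / 24]. *)
Definition bcoef (k : nat) : R := (INR k - 1) * Z2 / (4 * PI ^ 2).
Definition rterm (k : nat) (z : C) (n : nat) : C :=
  (/ INR (S n) * (bose (dual z n) - bose (dual z n * / INR k)))%C.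
Definition Rem (k : nat) (z : C) : C := csum (rterm k z).

Lemma csum_blk_harm (k : nat) : csum (blk k harm) = RtoC (kappa k).
Proof.
apply C_ext; [reflexivity|].
change (Series (fun i => Im (blk k harm i)) = 0).
rewrite (Series_ext _ (fun n => 0 * 0)).
  rewrite (Series_scal_l 0 (fun _ => 0)); ring.
intros i; unfold blk.
change (Im (csn (fun r => harm (k * i + S r)) k) - Im (INR k * harm (k * S i)%nat) = 0 * 0).
rewrite Im_csn, (rsn_ext _ (fun _ => 0 * 0)) by (intros; unfold harm, Im; simpl; ring).
rewrite (rsn_scal 0 (fun _ => 0)); unfold harm, Im; simpl; ring.
Qed.

Lemma cabs_blk_harm (k : nat) : (1 <= k)%nat -> cabs (blk k harm).
Proof.
intros Hk; apply cabs_le with (fun i => INR k * (INR k * / INR (S i) ^ 2)).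
2: apply ex_series_scal_R, ex_series_scal_R, ex_series_inv_sqr.
apply cabs_blk; intros i r Hr; unfold harm.
set (m := (k * i + S r)%nat); set (m' := (k * S i)%nat).
assert (H1 : INR (S i) <= INR m) by (apply le_INR; unfold m; nia).
assert (H2 : INR m <= INR m') by (apply le_INR; unfold m, m'; nia).
assert (H3 : INR m' <= INR m + INR k) by (rewrite <- plus_INR; apply le_INR; unfold m, m'; nia).
assert (H0 := INR_S_pos i).
rewrite <- RtoC_minus, Cmod_R, Rabs_left1.
  replace (- (- / (2 * INR m) - - / (2 * INR m'))) with ((INR m' - INR m) * / 2 * / (INR m * INR m'))
    by (field; lra).
  apply Rmult_le_compat.
  - lra.
  - apply Rlt_le, Rinv_0_lt_compat; nra.
  - generalize (pos_INR k); lra.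
  - apply Rinv_le_contravar; [apply pow_lt; lra |].
    replace (INR (S i) ^ 2) with (INR (S i) * INR (S i)) by ring; apply Rmult_le_compat; lra.
assert (/ (2 * INR m') <= / (2 * INR m)) by (apply Rinv_le_contravar; lra); lra.
Qed.

Lemma cabs_rterm (k : nat) (z : C) : (1 <= k)%nat -> 0 < Re z -> cabs (rterm k z).
Proof.
intros Hk Hz.
assert (Pk : 1 <= INR k) by (apply (le_INR 1); lia).
assert (HI := Re_inv_pos z Hz).
assert (HP := PI_RGT_0).
set (c := 4 * PI ^ 2 * Re (/ z)).
assert (Hc : 0 < c) by (unfold c; apply Rmult_lt_0_compat; [nra | assumption]).
apply cabs_le with (fun n => (/ c * (1 + INR k)) * / INR (S n) ^ 2).
2: apply ex_series_scal_R, ex_series_inv_sqr.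
intros n; unfold rterm; assert (Pn := INR_S_pos n).
assert (Rd : Re (dual z n) = c * INR (S n)) by (rewrite Re_dual; unfold c; ring).
assert (Rk : Re (dual z n * / INR k) = c * INR (S n) / INR k).
  rewrite <- RtoC_inv, re_scal_r, Rd by lra; reflexivity.
rewrite Cmod_mult, Cmod_inv, Cmod_R_pos by (try lra; apply RtoC_neq_0; lra).
apply Rle_trans with (/ INR (S n) * (/ (c * INR (S n)) + / (c * INR (S n) / INR k))).
  apply Rmult_le_compat_l; [apply Rlt_le, Rinv_0_lt_compat; lra|].
  eapply Rle_trans; [apply Cmod_triangle|]; rewrite Cmod_opp.
  rewrite <- Rd at 1; rewrite <- Rk; apply Rplus_le_compat; apply Cmod_bose_inv.
    now apply Re_dual_pos.
  rewrite Rk; apply Rdiv_lt_0_compat; nra.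
apply Req_le; field; lra.
Qed.

Lemma dual_scale (k : nat) (z : C) (n : nat) : (1 <= k)%nat -> 0 < Re z ->
  dual (INR k * z) n = (dual z n * / INR k)%C.
Proof.
intros Hk Hz; unfold dual; field; split; [apply RtoC_neq_0, not_0_INR; lia | now apply Re_pos_neq_0].
Qed.

Lemma mode_scale (k : nat) (z : C) (n m : nat) : (1 <= k)%nat -> (1 <= m)%nat -> 0 < Re z ->
  (INR k * mode z n (k * m))%C = mode (INR k * z) n m.
Proof.
intros Hk Hm Hz; unfold mode.
replace (RtoC (INR (k * m) ^ 2) * (z * z))%C with (RtoC (INR m ^ 2) * (INR k * z * (INR k * z)))%C.
  ring.
rewrite mult_INR, !RtoC_pow, RtoC_mult; simpl; ring.
Qed.

(** For fixed [n] the sum over [m] converges absolutely, so the blocks separate into a sum for [z]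
    and one for [k z]. With [d = dual z n], the polar parts [- 1 / d] and [k / d] leave the term
    that is linear in [z]. *)
Lemma csum_blk_mode (k : nat) (z : C) (n : nat) : (1 <= k)%nat -> 0 < Re z ->
  csum (blk k (mode z n)) =
    (rterm k z n + (INR k - 1) * (z * / RtoC (4 * PI ^ 2)) * RtoC (/ INR (S n) ^ 2))%C.
Proof.
intros Hk Hz.
assert (Pk : 0 < INR k) by (apply lt_0_INR; lia).
assert (Hkz : 0 < Re (INR k * z)) by (rewrite re_scal_l; now apply Rmult_lt_0_compat).
assert (Hc := cabs_mode_m z n Hz).
rewrite csum_blk by (try assumption; now apply cabs_blk_cabs).
rewrite <- csum_scal by now apply (cabs_mul k (mode z n)).
rewrite (csum_ext (fun i => INR k * mode z n (k * S i))%C (fun i => mode (INR k * z) n (S i))).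
2: intros i; apply mode_scale; auto; lia.
rewrite !csum_mode_m, dual_scale by assumption.
unfold rterm, hcoth.
assert (Nd : dual z n <> 0) by now apply Re_pos_neq_0, Re_dual_pos.
assert (Nn : RtoC (INR (S n)) <> 0) by (apply RtoC_neq_0; generalize (INR_S_pos n); lra).
assert (Nk : RtoC (INR k) <> 0) by (apply RtoC_neq_0; lra).
assert (E : (/ INR (S n) * / dual z n)%C = (z * / RtoC (4 * PI ^ 2) * RtoC (/ INR (S n) ^ 2))%C).
  assert (HP := PI_RGT_0).
  assert (NP : RtoC (4 * PI ^ 2) <> 0) by (apply RtoC_neq_0; nra).
  assert (Nz := Re_pos_neq_0 z Hz).
  rewrite RtoC_inv, RtoC_pow by (apply pow_nonzero, not_0_INR; lia).
  unfold dual; rewrite RtoC_mult; field; repeat split; assumption.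
replace (INR k - 1)%C with (INR k - 1)%C by ring.
replace ((INR k - 1) * (z * / RtoC (4 * PI ^ 2)) * RtoC (/ INR (S n) ^ 2))%C with
  ((INR k - 1) * (/ INR (S n) * / dual z n))%C by (rewrite E; ring).
field; repeat split; try assumption; apply RtoC_neq_0; lra.
Qed.

Lemma ex_series_Rabs_inv_sqr : ex_series (fun n => Rabs (/ INR (S n) ^ 2)).
Proof.
apply ex_series_ext with (2 := ex_series_inv_sqr); intros n; symmetry; apply Rabs_pos_eq.
apply Rlt_le, Rinv_0_lt_compat, pow_lt, INR_S_pos.
Qed.

Theorem Lam_modular (k : nat) (z : C) : (1 <= k)%nat -> 0 < Re z ->
  Lam k z = (Acoef k * / z + kappa k + bcoef k * z + Rem k z)%C.
Proof.
intros Hk Hz.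
assert (Pk : 0 < INR k) by (apply lt_0_INR; lia).
assert (Nk : RtoC (INR k) <> 0) by (apply RtoC_neq_0; lra).
assert (Nz := Re_pos_neq_0 z Hz).
assert (HP := PI_RGT_0).
assert (Hb := cabs_bterm z Hz).
assert (HL : Lam k z = csum (blk k (bterm z))).
  rewrite csum_blk by (try assumption; now apply cabs_blk_cabs); reflexivity.
pose (isq (m : nat) := (/ z * RtoC (/ INR m ^ 2))%C).
assert (Hisq : cabs (fun m => isq (S m))).
  apply cabs_scal, cabs_le with (2 := ex_series_Rabs_inv_sqr); intros n; rewrite Cmod_R; lra.
(* The pole of [bose] at 0, its constant term, and the remaining partial fractions: their blocks
   yield [A / z], [kappa] and, after the interchange, [b z + Rem]. *)
assert (Hsplit : forall m, (1 <= m)%nat ->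
   bterm z m = (isq m + harm m + csum (fun n => mode z n m))%C).
  intros m Hm; rewrite csum_mode_n by assumption.
  assert (Nm : INR m <> 0) by (apply not_0_INR; lia).
  assert (Nm' : RtoC (INR m) <> 0) by now apply RtoC_neq_0.
  unfold bterm, isq, harm, hcoth.
  rewrite RtoC_opp, !RtoC_inv, RtoC_pow, RtoC_mult by (try (apply pow_nonzero; assumption); lra).
  field; repeat split; try assumption; apply RtoC_neq_0; lra.
pose (c := 4 * INR k * Cmod z ^ 3 / (Re z / (1 + Cmod z)) ^ 4).
assert (Hc0 : 0 <= c).
  assert (0 < Re z / (1 + Cmod z)) by (apply Rdiv_lt_0_compat; generalize (Cmod_ge_0 z); lra).
  unfold c; apply Rmult_le_pos; [|apply Rlt_le, Rinv_0_lt_compat, pow_lt; assumption].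
  apply Rmult_le_pos; [lra | apply pow_le, Cmod_ge_0].
assert (Hbd : forall i n, Cmod (blk k (mode z n) i) <= (INR k * c * r32 i) * r32 n).
  intros i n; replace (INR k * c * r32 i * r32 n) with (INR k * (c * (r32 i * r32 n))) by ring.
  apply (cabs_blk k (mode z n) (fun i => c * (r32 i * r32 n))).
  intros j r Hr; now apply mode_diff.
assert (Hu : ex_series (fun i => INR k * c * r32 i)) by apply ex_series_scal_R, ex_series_r32.
assert (Pu : forall i, 0 <= INR k * c * r32 i).
  intros i; apply Rmult_le_pos; [|apply Rlt_le, r32_pos]; apply Rmult_le_pos; lra.
assert (Hblk : forall i, cabs (fun n => blk k (mode z n) i) /\
   blk k (fun m => csum (fun n => mode z n m)) i = csum (fun n => blk k (mode z n) i)).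
  intros i.
  destruct (csn_csum (fun r n => mode z n (k * i + S r)) k) as [C1 C2].
    intros r _; apply cabs_mode_n; auto; lia.
  assert (C3 : cabs (fun n => mode z n (k * S i))) by (apply cabs_mode_n; auto; lia).
  assert (E : forall n, blk k (mode z n) i = (csn (fun r => mode z n (k * i + S r)) k +
     (- INR k) * mode z n (k * S i))%C) by (intros n; unfold blk; ring).
  split.
    eapply cabs_ext; [intros n; symmetry; apply E|]; apply cabs_plus; [exact C1 | now apply cabs_scal].
  rewrite (csum_ext _ _ E), csum_plus, csum_scal, <- C2 by (try assumption; now apply cabs_scal).
  unfold blk; ring.
assert (Hm3 : cabs (fun i => csum (fun n => blk k (mode z n) i))).
  apply cabs_le with (fun i => Series r32 * (INR k * c * r32 i)); [|now apply ex_series_scal_R].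
  intros i; eapply Rle_trans; [apply Cmod_csum, Hblk|].
  rewrite Rmult_comm, <- Series_scal_l; apply Series_le.
    intros n; split; [apply Cmod_ge_0 | apply Hbd].
  apply ex_series_scal_R, ex_series_r32.
assert (Hm1 : cabs (blk k isq)) by now apply cabs_blk_cabs.
assert (Hm2 := cabs_blk_harm k Hk).
rewrite HL, (csum_ext _ (fun i => (blk k isq i + blk k harm i) + csum (fun n => blk k (mode z n) i))%C).
2: intros i; rewrite (blk_ext k (bterm z) _ i Hk Hsplit), !blk_plus; f_equal; apply Hblk.
rewrite csum_plus, csum_plus, csum_blk_harm by (try assumption; now apply cabs_plus).
rewrite (csum_swap (fun i n => blk k (mode z n) i) _ r32 Hbd Hu ex_series_r32 Pu)
  by (intros n; apply Rlt_le, r32_pos).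
rewrite (csum_ext (fun n => csum (fun i => blk k (mode z n) i)) _ (fun n => csum_blk_mode k z n Hk Hz)).
rewrite csum_plus.
2: now apply cabs_rterm.
2: apply cabs_scal, cabs_le with (2 := ex_series_Rabs_inv_sqr); intros n; rewrite Cmod_R; lra.
rewrite csum_scal_RtoC by apply ex_series_Rabs_inv_sqr.
rewrite csum_blk by assumption.
unfold isq; rewrite (csum_scal_RtoC (/ z)) by apply ex_series_Rabs_inv_sqr.
rewrite (csum_ext (fun i => / z * RtoC (/ INR (k * S i) ^ 2))%C
   (fun i => / z * RtoC (/ INR k ^ 2) * RtoC (/ INR (S i) ^ 2))%C).
2: intros i; rewrite mult_INR, Rpow_mult_distr, Rinv_mult, RtoC_mult; ring.
rewrite csum_scal_RtoC by apply ex_series_Rabs_inv_sqr.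
fold Z2; unfold Acoef, bcoef, Rem.
assert (NP : RtoC (4 * PI ^ 2) <> 0) by (apply RtoC_neq_0; nra).
assert (Nk2 : INR k ^ 2 <> 0) by (apply pow_nonzero; lra).
rewrite RtoC_div, !RtoC_mult, !RtoC_minus, !RtoC_inv, !RtoC_pow by (try assumption; try lra; nra).
rewrite RtoC_mult, RtoC_pow in NP.
field; repeat split; try assumption; try (apply RtoC_neq_0; lra).
Qed.

Lemma exp_natmul (n : nat) (x : R) : exp (INR n * x) = exp x ^ n.
Proof.
induction n as [|n IH]; [simpl; rewrite Rmult_0_l; apply exp_0|].
rewrite S_INR, Rmult_plus_distr_r, Rmult_1_l, exp_plus, IH; simpl; ring.
Qed.

(** Of the two arguments in [rterm], the smaller one, [dual z n / k], has real part [a (n + 1)];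
    both Bose terms are at most [5 / 4 e ^ (- a (n + 1))]. A geometric series of ratio
    [e ^ (- a) <= 1 / 5] remains. *)
Lemma Cmod_Rem (k : nat) (z : C) : (1 <= k)%nat -> 0 < Re z ->
  4 <= 4 * PI ^ 2 * Re (/ z) / INR k ->
  Cmod (Rem k z) <= 4 * exp (- (4 * PI ^ 2 * Re (/ z) / INR k)).
Proof.
intros Hk Hz Ha; set (a := 4 * PI ^ 2 * Re (/ z) / INR k) in *.
assert (Pk : 1 <= INR k) by (apply (le_INR 1); lia).
set (x := exp (- a)).
assert (Hx0 : 0 < x) by apply exp_pos.
assert (Hx : x <= / 5).
  unfold x; rewrite exp_Ropp; apply Rinv_le_contravar; [lra|].
  generalize (exp_ineq1_le a); lra.
assert (Hxn : forall n, exp (- (a * INR (S n))) = x ^ S n).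
  intros n; unfold x; rewrite <- exp_natmul; f_equal; ring.
assert (Hb : forall n, Cmod (rterm k z n) <= 5 / 2 * x * x ^ n).
  intros n; unfold rterm; assert (Pn : 1 <= INR (S n)) by (apply (le_INR 1); lia).
  assert (Rd : Re (dual z n) = INR k * (a * INR (S n))) by (rewrite Re_dual; unfold a; field; lra).
  assert (Rk : Re (dual z n * / INR k) = a * INR (S n)).
    rewrite <- RtoC_inv, re_scal_r, Rd by lra; field; lra.
  assert (E1 : 5 <= exp (a * INR (S n))).
    apply Rle_trans with (1 + a * INR (S n)); [nra | apply exp_ineq1_le].
  assert (E2 : exp (a * INR (S n)) <= exp (INR k * (a * INR (S n)))) by (apply exp_mono; assert (0 <= a * INR (S n)) by nra; nra).
  assert (E3 : / (exp (a * INR (S n)) - 1) <= 5 / 4 * x ^ S n).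
    rewrite <- Hxn, exp_Ropp.
    apply Rmult_le_reg_r with ((exp (a * INR (S n)) - 1) * exp (a * INR (S n))); [nra|].
    set (e := exp (a * INR (S n))) in *.
    replace (/ (e - 1) * ((e - 1) * e)) with e by (field; lra).
    replace (5 / 4 * / e * ((e - 1) * e)) with (5 / 4 * (e - 1)) by (field; lra).
    lra.
  rewrite Cmod_mult, Cmod_inv, Cmod_R_pos by (try lra; apply RtoC_neq_0; lra).
  apply Rle_trans with (1 * (5 / 4 * x ^ S n + 5 / 4 * x ^ S n)); [|simpl; lra].
  apply Rmult_le_compat.
  - apply Rlt_le, Rinv_0_lt_compat; lra.
  - apply Cmod_ge_0.
  - apply Rle_trans with (/ 1); [apply Rinv_le_contravar; lra | lra].
  - eapply Rle_trans; [apply Cmod_triangle|]; rewrite Cmod_opp; apply Rplus_le_compat.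
      eapply Rle_trans; [apply Cmod_bose; now apply Re_dual_pos|]; rewrite Rd.
      apply Rle_trans with (2 := E3); apply Rinv_le_contravar; lra.
    eapply Rle_trans; [apply Cmod_bose; rewrite Rk; apply Rmult_lt_0_compat; lra|]; rewrite Rk; exact E3.
assert (Hg : ex_series (fun n => x ^ n)) by (apply ex_series_geom; rewrite Rabs_pos_eq; lra).
eapply Rle_trans; [apply Cmod_csum, cabs_rterm; assumption|].
apply Rle_trans with (Series (fun n => 5 / 2 * x * x ^ n)).
  apply Series_le; [intros n; split; [apply Cmod_ge_0 | apply Hb] | now apply ex_series_scal_R].
rewrite Series_scal_l, Series_geom by (rewrite Rabs_pos_eq; lra).
assert (/ (1 - x) <= 5 / 4).
  replace (5 / 4) with (/ (4 / 5)) by field; apply Rinv_le_contravar; lra.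
fold x; assert (0 < / (1 - x)) by (apply Rinv_0_lt_compat; lra); nra.
Qed.

(** * The generating product *)

Definition lterm (q : C) (j : nat) : C := (/ INR (S j) * q ^ S j)%C.
(** The power series of [- log (1 - q)], which avoids the branches of a complex logarithm. *)
Definition mlog (q : C) : C := csum (lterm q).

Lemma Cmod_lterm (q : C) (j : nat) : Cmod (lterm q j) <= Cmod q ^ S j.
Proof.
unfold lterm; assert (P : 1 <= INR (S j)) by (apply (le_INR 1); lia).
rewrite Cmod_mult, Cmod_inv, Cmod_R_pos, Cmod_pow by (try lra; apply RtoC_neq_0; lra).
rewrite <- (Rmult_1_l (Cmod q ^ S j)) at 2.
apply Rmult_le_compat_r; [apply pow_le, Cmod_ge_0|].
apply Rle_trans with (/ 1); [apply Rinv_le_contravar; lra | lra].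
Qed.

Lemma ex_series_geom_S (x : R) : 0 <= x < 1 -> ex_series (fun j => x ^ S j).
Proof.
intros Hx; apply (ex_series_scal_R x (fun j => x ^ j)), ex_series_geom.
rewrite Rabs_pos_eq; lra.
Qed.

Lemma cabs_lterm (q : C) : Cmod q < 1 -> cabs (lterm q).
Proof.
intros Hq; apply cabs_le with (1 := Cmod_lterm q), ex_series_geom_S.
generalize (Cmod_ge_0 q); lra.
Qed.

Lemma cder_pow (q : C) (n : nat) (s : R) :
  cder (fun x : R => (RtoC (x ^ S n) * q ^ S n)%C) s (INR (S n) * (RtoC (s ^ n) * q ^ S n))%C.
Proof.
eapply cder_eq.
  apply cder_mult; [|apply cder_const].
  apply cder_RtoC, (is_derive_pow (fun x => x) (S n) s 1), (is_derive_id (K := R_AbsRing)).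
simpl pred; rewrite Rmult_1_l || idtac; rewrite !RtoC_mult; cbv beta; ring.
Qed.

Lemma cder_lterm_sum (q : C) (n : nat) (s : R) :
  cder (fun x : R => csn (lterm (x * q)) n) s (q * csn (fun j => RtoC (s ^ j) * q ^ j)%C n)%C.
Proof.
induction n as [|n IH].
  simpl; eapply cder_eq; [apply cder_const | ring].
apply cder_ext with (fun x : R => csn (lterm (x * q)) n + / INR (S n) * (RtoC (x ^ S n) * q ^ S n))%C.
  intros x; simpl csn; unfold lterm; rewrite Cpow_mult_l, RtoC_pow; reflexivity.
eapply cder_eq.
  apply cder_plus; [exact IH | apply cder_scal, cder_pow].
assert (N : RtoC (INR (S n)) <> 0) by (apply RtoC_neq_0; generalize (INR_S_pos n); lra).
simpl csn; rewrite Cpow_S; field; assumption.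
Qed.

Lemma csn_geom (x : C) (n : nat) : ((1 - x) * csn (fun j => x ^ j) n)%C = (1 - x ^ n)%C.
Proof.
induction n as [|n IH]; [simpl; ring|].
change (csn (fun j => x ^ j)%C (S n)) with (csn (fun j => x ^ j) n + x ^ n)%C.
rewrite Cmult_plus_distr_l, IH, Cpow_S; ring.
Qed.

Lemma Cmod_le_of_cder (f : R -> C) (df : R -> C) (K : R) :
  (forall s, 0 <= s <= 1 -> cder f s (df s)) ->
  (forall s, 0 <= s <= 1 -> Cmod (df s) <= K) -> Cmod (f 1 - f 0) <= 2 * K.
Proof.
intros Hd HK.
assert (HL : forall x : R, is_derive (fun y => K * y) x K).
  intros x; eapply is_derive_eq.
    apply (is_derive_scal (fun y => y)), (is_derive_id (K := R_AbsRing)).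
  apply Rmult_1_r.
assert (R1 : Rabs (Re (f 1) - Re (f 0)) <= K * 1 - K * 0).
  apply (abs_le_of_derive (fun x => Re (f x)) (fun x => Re (df x)) (fun y => K * y) (fun _ => K)).
  - lra.
  - intros x Hx; apply Hd, Hx.
  - intros x _; apply HL.
  - intros x Hx; eapply Rle_trans; [apply re_le_Cmod | now apply HK].
assert (R2 : Rabs (Im (f 1) - Im (f 0)) <= K * 1 - K * 0).
  apply (abs_le_of_derive (fun x => Im (f x)) (fun x => Im (df x)) (fun y => K * y) (fun _ => K)).
  - lra.
  - intros x Hx; apply Hd, Hx.
  - intros x _; apply HL.
  - intros x Hx; eapply Rle_trans; [apply im_le_Cmod | now apply HK].
eapply Rle_trans; [apply Cmod_le_abs|].
change (Rabs (Re (f 1) - Re (f 0)) + Rabs (Im (f 1) - Im (f 0)) <= 2 * K); lra.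
Qed.

(** With a partial sum of length [n] in the exponent, [s -> (1 - s q) e ^ (...)] has derivative
    [- q (s q) ^ n e ^ (...)], because the geometric sum collapses. Hence its values at 0 and 1
    agree in the limit. *)
Lemma cexp_mlog (q : C) : Cmod q < 1 -> ((1 - q) * cexp (mlog q))%C = 1.
Proof.
intros Hq; assert (Hq0 := Cmod_ge_0 q).
assert (Ha := cabs_lterm q Hq).
set (x := Cmod q) in *.
assert (Hg := ex_series_geom_S x (conj Hq0 Hq)).
set (G := Series (fun j => x ^ S j)).
assert (HK : forall n, Cmod ((1 - q) * cexp (csn (lterm q) n) - 1) <= 2 * (x ^ S n * exp G)).
  intros n.
  pose (f (s : R) := ((1 - s * q) * cexp (csn (lterm (s * q)) n))%C).
  replace ((1 - q) * cexp (csn (lterm q) n) - 1)%C with (f 1 - f 0)%C.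
  2: { unfold f; rewrite Cmult_1_l, Cmult_0_l.
    rewrite (csn_ext (lterm 0) (fun _ => 0)).
      rewrite csn_const, Cmult_0_r, cexp_0; ring.
    intros i _; unfold lterm; rewrite Cpow_S; ring. }
  apply Cmod_le_of_cder with (fun s : R => (- (q * (s * q) ^ n) * cexp (csn (lterm (s * q)) n))%C).
    intros s _; eapply cder_eq.
      apply cder_mult; [|apply cder_cexp, cder_lterm_sum].
      apply cder_ext with (fun s : R => 1 + (- q) * s)%C; [intros y; ring|].
      apply cder_plus; [apply cder_const | apply cder_scal, cder_id].
    cbv beta.
    rewrite (csn_ext (fun j => RtoC (s ^ j) * q ^ j)%C (fun j => (s * q) ^ j)%C) by (intros; rewrite Cpow_mult_l, RtoC_pow; reflexivity).
    assert (Gm := csn_geom (s * q) n).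
    replace ((1 - s * q) * (q * csn (fun j => (s * q) ^ j) n * cexp (csn (lterm (s * q)) n)))%C with
      (q * ((1 - s * q) * csn (fun j => (s * q) ^ j) n) * cexp (csn (lterm (s * q)) n))%C by ring.
    rewrite Gm; ring.
  intros s Hs.
  rewrite Cmod_mult, Cmod_opp, Cmod_mult, Cmod_pow, Cmod_mult, Cmod_R_pos, Cmod_cexp by lra; fold x.
  apply Rmult_le_compat.
  - apply Rmult_le_pos; [assumption | apply pow_le; nra].
  - apply Rlt_le, exp_pos.
  - simpl; apply Rmult_le_compat_l; [assumption | apply pow_incr; nra].
  - apply exp_mono; eapply Rle_trans; [apply Rle_abs|].
    eapply Rle_trans; [apply re_le_Cmod|]; eapply Rle_trans; [apply Cmod_csn|].
    apply Rle_trans with (rsn (fun j => x ^ S j) n).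
      apply rsn_le; intros i _; eapply Rle_trans; [apply Cmod_lterm|].
      apply pow_incr; split; [apply Cmod_ge_0|].
      rewrite Cmod_mult, Cmod_R_pos by lra; fold x; nra.
    apply rsn_le_Series; [intros i; apply pow_le; assumption | assumption].
apply Ceq_minus, Cmod_eq_0_le; intros eps Heps.
set (W := Cmod ((1 - q) * cexp (mlog q))).
assert (HW : 0 <= W) by apply Cmod_ge_0.
assert (He : 0 < exp 1) by apply exp_pos.
destruct (csn_csum_lim _ Ha (Rmin 1 (eps / (4 * (W + 1) * exp 1)))) as [N1 HN1].
  apply Rmin_pos; [lra|]; apply Rdiv_lt_0_compat; [assumption|]; nra.
destruct (pow_lt_1_zero x) with (y := eps / (4 * exp G)) as [N2 HN2].
  rewrite Rabs_pos_eq; lra.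
  apply Rdiv_lt_0_compat; [lra|]; generalize (exp_pos G); lra.
set (n := max N1 N2).
specialize (HN1 n ltac:(lia)); specialize (HN2 (S n) ltac:(lia)); specialize (HK n).
rewrite Rabs_pos_eq in HN2 by (apply pow_le; assumption).
set (d := (csn (lterm q) n - csum (lterm q))%C) in *.
assert (D1 : Cmod d <= 1) by (apply Rlt_le, Rlt_le_trans with (1 := HN1), Rmin_l).
assert (D2 : Cmod d < eps / (4 * (W + 1) * exp 1)) by (apply Rlt_le_trans with (1 := HN1), Rmin_r).
assert (E : ((1 - q) * cexp (csn (lterm q) n))%C = ((1 - q) * cexp (mlog q) * cexp d)%C).
  unfold mlog; rewrite <- Cmult_assoc, <- cexp_plus; do 2 f_equal; unfold d; ring.
replace ((1 - q) * cexp (mlog q) - 1)%C with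
  ((((1 - q) * cexp (csn (lterm q) n)) - 1) + - ((1 - q) * cexp (mlog q) * (cexp d - 1)))%C
  by (rewrite E; ring).
eapply Rle_trans; [apply Cmod_triangle|]; rewrite Cmod_opp, Cmod_mult; fold W.
assert (B1 : 2 * (x ^ S n * exp G) <= eps / 2).
  assert (H := exp_pos G).
  apply Rle_trans with (2 * (eps / (4 * exp G) * exp G)); [|apply Req_le; field; lra].
  apply Rmult_le_compat_l; [lra|]; apply Rmult_le_compat_r; lra.
assert (B2 : W * Cmod (cexp d - 1) <= eps / 2).
  apply Rle_trans with (W * (2 * (eps / (4 * (W + 1) * exp 1)) * exp 1)).
    apply Rmult_le_compat_l; [assumption|].
    eapply Rle_trans; [apply cexp_sub_1|]; generalize (Cmod_ge_0 d); intros.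
    apply Rmult_le_compat; [lra | apply Rlt_le, exp_pos | lra | now apply exp_mono].
  replace (W * (2 * (eps / (4 * (W + 1) * exp 1)) * exp 1)) with (eps / 2 * (W / (W + 1))) by (field; lra).
  assert (W / (W + 1) <= 1).
    apply Rmult_le_reg_r with (W + 1); [lra|]; unfold Rdiv; rewrite Rmult_assoc, Rinv_l by lra; lra.
  assert (0 <= W / (W + 1)) by (apply Rmult_le_pos; [assumption | apply Rlt_le, Rinv_0_lt_compat; lra]).
  nra.
lra.
Qed.

Section Denominator.

Variable P : nat -> bool.

(** The product is finite, so that its reciprocal is visibly continuous on the path of
    integration. *)
Fixpoint Den (M : nat) (q : C) : C :=
  match M with
  | O => 1
  | S M => if P (S M) then (Den M q * (1 - q ^ S M))%C else Den M q
  end.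

Definition mlogs (M : nat) (q : C) : C := csn (fun m => if P (S m) then mlog (q ^ S m) else 0)%C M.

Lemma Cmod_pow_lt_1 (q : C) (m : nat) : Cmod q < 1 -> Cmod (q ^ S m) < 1.
Proof.
intros Hq; rewrite Cmod_pow; apply pow_lt_1_compat; [|lia].
generalize (Cmod_ge_0 q); lra.
Qed.

Lemma Den_mlogs (M : nat) (q : C) : Cmod q < 1 -> (Den M q * cexp (mlogs M q))%C = 1.
Proof.
intros Hq; unfold mlogs; induction M as [|M IH]; [simpl; rewrite cexp_0; ring|].
simpl Den; simpl csn; destruct (P (S M)); [|rewrite Cplus_0_r; exact IH].
rewrite cexp_plus.
replace (Den M q * (1 - q ^ S M) * _)%C with
  ((Den M q * cexp (csn (fun m => if P (S m) then mlog (q ^ S m) else 0) M)) *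
   ((1 - q ^ S M) * cexp (mlog (q ^ S M))))%C by (simpl; ring).
rewrite IH, cexp_mlog by now apply Cmod_pow_lt_1. ring.
Qed.

Lemma Den_neq_0 (M : nat) (q : C) : Cmod q < 1 -> Den M q <> 0.
Proof.
intros Hq E; generalize (Den_mlogs M q Hq); rewrite E, Cmult_0_l; intros H.
symmetry in H; apply RtoC_inj in H; lra.
Qed.

End Denominator.

(** * Sums over the integers not divisible by k *)

Definition nondiv (k m : nat) : bool := negb (Nat.eqb (Nat.modulo m k) 0).

Definition pows (k : nat) (x : C) (M : nat) : C :=
  csn (fun m => if nondiv k (S m) then (x ^ S m)%C else 0) M.

Lemma nondiv_block (k B r : nat) : (1 <= k)%nat -> (r < k - 1)%nat -> nondiv k (k * B + S r) = true.
Proof.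
intros Hk Hr; unfold nondiv.
replace (k * B + S r)%nat with (S r + B * k)%nat by lia.
rewrite Nat.Div0.mod_add, Nat.mod_small by lia; reflexivity.
Qed.

Lemma nondiv_end (k B : nat) : nondiv k (k * S B) = false.
Proof.
unfold nondiv; replace (k * S B)%nat with (S B * k)%nat by lia.
now rewrite Nat.Div0.mod_mul.
Qed.

Lemma csn_S (a : nat -> C) (n : nat) : csn a (S n) = (csn a n + a n)%C.
Proof. reflexivity. Qed.

Lemma pows_diff (k : nat) (x : C) (B : nat) : (1 <= k)%nat ->
  pows k x (k * B) = (csn (fun m => x ^ S m) (k * B) - csn (fun i => (x ^ k) ^ S i) B)%C.
Proof.
intros Hk; induction B as [|B IH]; [unfold pows; rewrite Nat.mul_0_r; simpl; ring|].
replace (k * S B)%nat with (k * B + ((k - 1) + 1))%nat by lia.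
unfold pows; rewrite csn_add; fold (pows k x (k * B)); rewrite IH.
rewrite (csn_add (fun m => x ^ S m)%C).
rewrite (csn_add (fun i => if nondiv k (S (k * B + i)) then (x ^ S (k * B + i))%C else 0)).
rewrite (csn_add (fun i => x ^ S (k * B + i))%C).
rewrite (csn_ext (fun i => if nondiv k (S (k * B + i)) then (x ^ S (k * B + i))%C else 0)
   (fun i => x ^ S (k * B + i))%C).
2: intros i Hi; replace (S (k * B + i)) with (k * B + S i)%nat by lia; now rewrite nondiv_block.
assert (E1 : forall f, csn f 1 = f O) by (intros; simpl; ring).
rewrite !E1, (csn_S _ B); cbv beta.
replace (S (k * B + (k - 1 + 0))) with (k * S B)%nat by lia.
rewrite nondiv_end, <- (Cpow_mult_r x k (S B)); ring.
Qed.

Lemma csn_geom_S (x : C) (n : nat) : ((1 - x) * csn (fun j => x ^ S j) n)%C = (x * (1 - x ^ n))%C.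
Proof.
rewrite (csn_ext (fun j => x ^ S j)%C (fun j => x * x ^ j)%C) by (intros; apply Cpow_S).
rewrite (csn_scal x (fun j => x ^ j)%C), <- (csn_geom x n); ring.
Qed.

Lemma bose_geom (w : C) : 0 < Re w -> bose w = (cexp (- w) / (1 - cexp (- w)))%C.
Proof.
intros Hw; rewrite cexp_opp; unfold bose.
assert (N := cexp_sub_neq_0 w Hw); assert (N' := cexp_neq_0 w).
field; repeat split; auto.
Qed.

Lemma cexp_neg_pow (w : C) (n : nat) : (cexp (- w) ^ n)%C = cexp (- (INR n * w)).
Proof. rewrite <- cexp_natmul; f_equal; ring. Qed.

(** The closed form of the sum of [e ^ (- m w)] over the positive [m] not divisible by [k]. *)
Definition dbose (k : nat) (w : C) : C := (bose w - bose (INR k * w))%C.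

Lemma pows_dbose (k : nat) (w : C) (B : nat) : (1 <= k)%nat -> 0 < Re w ->
  pows k (cexp (- w)) (k * B) = ((1 - cexp (- w) ^ (k * B)) * dbose k w)%C.
Proof.
intros Hk Hw.
assert (Pk : 0 < INR k) by (apply lt_0_INR; lia).
assert (Hkw : 0 < Re (INR k * w)) by (rewrite re_scal_l; now apply Rmult_lt_0_compat).
rewrite pows_diff by assumption; unfold dbose; rewrite !bose_geom by assumption.
rewrite <- cexp_neg_pow; set (x := cexp (- w)).
assert (NN : forall v, 0 < Re v -> (1 - cexp (- v))%C <> 0).
  intros v Hv; apply Cminus_eq_contra; intros E.
  assert (M := Cmod_cexp (- v)); rewrite <- E, Cmod_1 in M.
  assert (exp (Re (- v)) < exp 0) by (apply exp_increasing; rewrite re_opp; lra).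
  rewrite exp_0 in *; lra.
assert (N1 : (1 - x)%C <> 0) by now apply NN.
assert (N2 : (1 - x ^ k)%C <> 0) by (unfold x; rewrite cexp_neg_pow; now apply NN).
replace (csn (fun m => x ^ S m) (k * B))%C with (x * (1 - x ^ (k * B)) / (1 - x))%C
  by (rewrite <- csn_geom_S; field; assumption).
replace (csn (fun i => (x ^ k) ^ S i) B)%C with (x ^ k * (1 - x ^ (k * B)) / (1 - x ^ k))%C
  by (rewrite Cpow_mult_r, <- csn_geom_S; field; assumption).
field; split; assumption.
Qed.

Definition dterm (k : nat) (z : C) (j : nat) : C := (/ INR (S j) * dbose k (INR (S j) * z))%C.

Lemma Lam_dterm (k : nat) (z : C) : (1 <= k)%nat -> 0 < Re z ->
  cabs (dterm k z) /\ Lam k z = csum (dterm k z).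
Proof.
intros Hk Hz; assert (Hb := cabs_bterm z Hz); assert (Hm := cabs_mul k _ Hk Hb).
assert (Nk : RtoC (INR k) <> 0) by (apply RtoC_neq_0, not_0_INR; lia).
assert (E : forall j, (bterm z (S j) + (- INR k) * bterm z (k * S j))%C = dterm k z j).
  intros j; unfold dterm, dbose, bterm; rewrite mult_INR, RtoC_mult.
  assert (Nj : RtoC (INR (S j)) <> 0) by (apply RtoC_neq_0; generalize (INR_S_pos j); lra).
  replace (INR k * INR (S j) * z)%C with (INR k * (INR (S j) * z))%C by ring.
  field; split; assumption.
split.
  apply (cabs_ext _ _ E), cabs_plus; [assumption | now apply cabs_scal].
rewrite <- (csum_ext _ _ E), csum_plus, csum_scal by (try assumption; now apply cabs_scal).
unfold Lam; ring.
Qed.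

Lemma Cmod_cexp_neg (w : C) : Cmod (cexp (- w)) = exp (- Re w).
Proof. now rewrite Cmod_cexp, re_opp. Qed.

Lemma Cmod_dterm (k : nat) (z : C) (j : nat) : (1 <= k)%nat -> 0 < Re z ->
  Cmod (dterm k z j) <= 2 / Re z * / INR (S j) ^ 2.
Proof.
intros Hk Hz; unfold dterm, dbose; assert (P := INR_S_pos j).
assert (Pk : 1 <= INR k) by (apply (le_INR 1); lia).
assert (R1 : Re (INR (S j) * z) = INR (S j) * Re z) by apply re_scal_l.
assert (R2 : Re (INR k * (INR (S j) * z)) = INR k * (INR (S j) * Re z)) by (rewrite re_scal_l, R1; reflexivity).
rewrite Cmod_mult, Cmod_inv, Cmod_R_pos by (try lra; apply RtoC_neq_0; lra).
assert (Q : 0 < INR (S j) * Re z) by now apply Rmult_lt_0_compat.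
apply Rle_trans with (/ INR (S j) * (/ (INR (S j) * Re z) + / (INR (S j) * Re z))).
  apply Rmult_le_compat_l; [apply Rlt_le, Rinv_0_lt_compat; lra|].
  eapply Rle_trans; [apply Cmod_triangle|]; rewrite Cmod_opp; apply Rplus_le_compat.
    rewrite <- R1; apply Cmod_bose_inv; now rewrite R1.
  eapply Rle_trans; [apply Cmod_bose_inv; rewrite R2; apply Rmult_lt_0_compat; lra|].
  rewrite R2; apply Rinv_le_contravar; [assumption | nra].
apply Req_le; field; lra.
Qed.

(** Cutting after a whole number of blocks multiplies the [j]-th term of [Lam] by [1 - q ^ (j k B)],
    with [j] counted from 1. The bound depends on [Re z] alone and is therefore uniform on a
    vertical line. *)
Lemma mlogs_Lam (k B : nat) (z : C) : (1 <= k)%nat -> 0 < Re z ->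
  Cmod (mlogs (nondiv k) (k * B) (cexp (- z)) - Lam k z) <=
    exp (- Re z) ^ (k * B) * (2 / Re z * Z2).
Proof.
intros Hk Hz; set (q := cexp (- z)).
assert (Mq : Cmod q = exp (- Re z)) by apply Cmod_cexp_neg.
assert (Hq : exp (- Re z) < 1) by (rewrite <- exp_0; apply exp_increasing; lra).
assert (Hq0 := exp_pos (- Re z)).
destruct (Lam_dterm k z Hk Hz) as [Ha EL].
pose (a m := fun j => if nondiv k (S m) then lterm (q ^ S m) j else RtoC 0).
assert (Hm : forall m, cabs (a m) /\ (if nondiv k (S m) then mlog (q ^ S m) else 0) = csum (a m)).
  intros m; unfold a; destruct (nondiv k (S m)); simpl.
    split; [apply cabs_lterm, Cmod_pow_lt_1; lra | reflexivity].
  split; [apply cabs_0 | now rewrite csum_0].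
destruct (csn_csum a (k * B)) as [C1 C2]; [intros r _; apply Hm|].
unfold mlogs; rewrite (csn_ext _ (fun m => csum (a m))) by (intros; apply Hm).
rewrite C2.
assert (E : forall j, csn (fun r => a r j) (k * B) =
  (dterm k z j + - (q ^ S j) ^ (k * B) * dterm k z j)%C).
  intros j.
  assert (Hj : 0 < Re (INR (S j) * z)) by (rewrite re_scal_l; apply Rmult_lt_0_compat; [apply INR_S_pos | assumption]).
  rewrite (csn_ext _ (fun m => / INR (S j) * (if nondiv k (S m) then (q ^ S j) ^ S m else 0))%C).
    rewrite csn_scal; fold (pows k (q ^ S j) (k * B)).
    unfold q at 1; rewrite cexp_neg_pow, pows_dbose by assumption.
    rewrite <- cexp_neg_pow; fold q; unfold dterm; ring.
  intros m _; unfold a, lterm; destruct (nondiv k (S m)); [|ring].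
  rewrite <- !Cpow_mult_r, (Nat.mul_comm (S m)); reflexivity.
assert (Hb : forall j, Cmod (- (q ^ S j) ^ (k * B) * dterm k z j) <=
    exp (- Re z) ^ (k * B) * (2 / Re z * / INR (S j) ^ 2)).
  intros j; rewrite Cmod_mult, Cmod_opp, !Cmod_pow, Mq.
  apply Rmult_le_compat; [apply pow_le, pow_le; lra | apply Cmod_ge_0 | | now apply Cmod_dterm].
  apply pow_incr; split; [apply pow_le; lra|].
  change (exp (- Re z) * exp (- Re z) ^ j <= exp (- Re z)).
  apply Rle_trans with (exp (- Re z) * 1); [|lra].
  apply Rmult_le_compat_l; [lra|]; rewrite <- (pow1 j); apply pow_incr; lra.
assert (Hs : ex_series (fun j => exp (- Re z) ^ (k * B) * (2 / Re z * / INR (S j) ^ 2))).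
  apply ex_series_scal_R, ex_series_scal_R, ex_series_inv_sqr.
assert (Hc : cabs (fun j => - (q ^ S j) ^ (k * B) * dterm k z j)%C) by now apply cabs_le with (2 := Hs).
rewrite (csum_ext _ _ E), csum_plus, EL by assumption.
match goal with |- Cmod (?x + ?y - ?x) <= _ => replace (x + y - x)%C with y by ring end.
eapply Rle_trans; [apply Cmod_csum, Hc|].
eapply Rle_trans; [apply Series_le; [intros n; split; [apply Cmod_ge_0 | apply Hb] | assumption]|].
rewrite !Series_scal_l; apply Rle_refl.
Qed.

(** As a series in [x = e ^ (- w)], [dbose] has nonnegative coefficients. Comparing the first block
    suffices: it is [(1 - x ^ k) dbose], and the modulus of [1 - x ^ k] is least at the real
    point. *)
Lemma Cmod_dbose (k : nat) (w : C) : (1 <= k)%nat -> 0 < Re w ->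
  Cmod (dbose k w) <= Re (dbose k (RtoC (Re w))).
Proof.
intros Hk Hw.
assert (H1 := pows_dbose k w 1 Hk Hw).
assert (H2 := pows_dbose k (RtoC (Re w)) 1 Hk Hw).
assert (Hx : cexp (- RtoC (Re w)) = RtoC (exp (- Re w))) by (rewrite <- RtoC_opp; apply cexp_RtoC).
rewrite Nat.mul_1_r, Hx in *; rewrite <- RtoC_pow, <- RtoC_minus in H2.
set (x := exp (- Re w)) in *.
assert (Hx0 : 0 < x) by apply exp_pos.
assert (Hx1 : x < 1) by (unfold x; rewrite <- exp_0; apply exp_increasing; lra).
assert (Hxk : 0 < 1 - x ^ k).
  assert (x ^ k < 1) by (apply pow_lt_1_compat; [lra | lia]); lra.
assert (Bd : Cmod (pows k (cexp (- w)) k) <= Re (pows k x k)).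
  unfold pows; eapply Rle_trans; [apply Cmod_csn|].
  rewrite Re_csn; apply rsn_le; intros i _; destruct (nondiv k (S i)).
    rewrite Cmod_pow, Cmod_cexp_neg; fold x; rewrite <- RtoC_pow; apply Rle_refl.
  rewrite Cmod_0; apply Rle_refl.
rewrite H1, H2, Cmod_mult, re_scal_l in Bd.
assert (L : 1 - x ^ k <= Cmod (1 - cexp (- w) ^ k)).
  generalize (Cmod_triangle_inv (RtoC 1) (- cexp (- w) ^ k)).
  rewrite Cmod_1, Cmod_opp, Cmod_pow, Cmod_cexp_neg; auto.
apply Rmult_le_reg_l with (1 - x ^ k); [assumption|].
apply Rle_trans with (2 := Bd), Rmult_le_compat_r; [apply Cmod_ge_0 | assumption].
Qed.

(** By [Cmod_dbose] no term of [Lam] has a larger real part at [z] than at [Re z], so all losses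
    except those of [j = 1] and [j = k] may be dropped. *)
Lemma Re_Lam_le (k : nat) (z : C) : (2 <= k)%nat -> 0 < Re z ->
  Re (Lam k z) <= Re (Lam k (RtoC (Re z)))
    - (Re (dbose k (RtoC (Re z))) - Re (dbose k z))
    - / INR k * (Re (dbose k (INR k * RtoC (Re z))%C) - Re (dbose k (INR k * z)%C)).
Proof.
intros Hk Hz; set (t := RtoC (Re z)).
destruct (Lam_dterm k z ltac:(lia) Hz) as [A1 ->].
destruct (Lam_dterm k t ltac:(lia) Hz) as [A2 ->].
pose (a j := Re (dterm k t j) - Re (dterm k z j)).
assert (Rd : forall y j, Re (dterm k y j) = / INR (S j) * Re (dbose k (INR (S j) * y)%C)).
  intros y j; unfold dterm; rewrite <- RtoC_inv, re_scal_l; [reflexivity|].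
  generalize (INR_S_pos j); lra.
assert (Pa : forall j, 0 <= a j).
  intros j; unfold a; rewrite !Rd, <- Rmult_minus_distr_l.
  apply Rmult_le_pos; [apply Rlt_le, Rinv_0_lt_compat, INR_S_pos|].
  assert (Hj : 0 < Re (INR (S j) * z)) by (rewrite re_scal_l; apply Rmult_lt_0_compat; [apply INR_S_pos | assumption]).
  generalize (Cmod_dbose k (INR (S j) * z) ltac:(lia) Hj); intros H.
  generalize (re_le_Cmod (dbose k (INR (S j) * z))) (Rle_abs (Re (dbose k (INR (S j) * z)))); intros.
  replace (INR (S j) * t)%C with (RtoC (Re (INR (S j) * z))) by (rewrite re_scal_l, RtoC_mult; reflexivity).
  lra.
assert (Ea : ex_series a).
  apply (ex_series_minus (V := R_NormedModule)); now apply cabs_Re.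
assert (Hs := rsn_le_Series a k Pa Ea).
unfold a in Hs at 2; rewrite Series_minus in Hs by now apply cabs_Re.
assert (Ht : a O + a (k - 1)%nat <= rsn a k).
  replace k with (S (S (k - 2))) at 2 by lia.
  change (a 0%nat + a (k - 1)%nat <= rsn a (S (k - 2)) + a (S (k - 2))).
  replace (S (k - 2)) with (k - 1)%nat by lia; apply Rplus_le_compat_r.
  replace (k - 1)%nat with (1 + (k - 2))%nat by lia; rewrite rsn_add; simpl.
  assert (0 <= rsn (fun i => a (S i)) (k - 2)).
    generalize (k - 2)%nat; induction n as [|n IH]; simpl; [lra|]; generalize (Pa (S n)); lra.
  lra.
unfold a in Ht at 1 2; rewrite !Rd in Ht.
replace (S (k - 1)) with k in Ht by lia.
change (INR 1) with 1 in Ht; rewrite Rinv_1, !Cmult_1_l in Ht.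
change (Re (csum (dterm k z))) with (Series (fun n => Re (dterm k z n))).
change (Re (csum (dterm k t))) with (Series (fun n => Re (dterm k t n))).
lra.
Qed.

(** * Cauchy's formula for the coefficients *)

Definition ccont (f : R -> C) : Prop :=
  forall x, continuous (fun y => Re (f y)) x /\ continuous (fun y => Im (f y)) x.

Lemma ccont_ext (f g : R -> C) : (forall x, f x = g x) -> ccont f -> ccont g.
Proof.
intros E H x; destruct (H x) as [H1 H2]; split.
  apply continuous_ext with (fun y => Re (f y)); [intros y; now rewrite E | exact H1].
apply continuous_ext with (fun y => Im (f y)); [intros y; now rewrite E | exact H2].
Qed.

Lemma ccont_const (c : C) : ccont (fun _ => c).
Proof. intros x; split; apply continuous_const. Qed.

Lemma continuous_Rplus (f g : R -> R) (x : R) :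
  continuous f x -> continuous g x -> continuous (fun y => f y + g y) x.
Proof. apply (continuous_plus (V := R_NormedModule)). Qed.

Lemma continuous_Ropp (f : R -> R) (x : R) : continuous f x -> continuous (fun y => - f y) x.
Proof. apply (continuous_opp (V := R_NormedModule)). Qed.

Lemma continuous_Rminus (f g : R -> R) (x : R) :
  continuous f x -> continuous g x -> continuous (fun y => f y - g y) x.
Proof. apply (continuous_minus (V := R_NormedModule)). Qed.

Lemma continuous_Rmult (f g : R -> R) (x : R) :
  continuous f x -> continuous g x -> continuous (fun y => f y * g y) x.
Proof. apply (continuous_mult (K := R_AbsRing)). Qed.

Lemma ccont_plus (f g : R -> C) : ccont f -> ccont g -> ccont (fun x => f x + g x)%C.
Proof.
intros Hf Hg x; destruct (Hf x), (Hg x); split; now apply continuous_Rplus.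
Qed.

Lemma ccont_opp (f : R -> C) : ccont f -> ccont (fun x => - f x)%C.
Proof. intros Hf x; destruct (Hf x); split; now apply continuous_Ropp. Qed.

Lemma ccont_mult (f g : R -> C) : ccont f -> ccont g -> ccont (fun x => f x * g x)%C.
Proof.
intros Hf Hg x; destruct (Hf x), (Hg x); split.
  now apply continuous_Rminus; apply continuous_Rmult.
now apply continuous_Rplus; apply continuous_Rmult.
Qed.

Lemma ccont_inv (f : R -> C) : ccont f -> (forall x, f x <> 0) -> ccont (fun x => / f x)%C.
Proof.
intros Hf Hn x; destruct (Hf x) as [H1 H2].
assert (D : continuous (fun y => / (Re (f y) * (Re (f y) * 1) + Im (f y) * (Im (f y) * 1))) x).
  apply continuous_Rinv_comp.
    apply continuous_Rplus; repeat apply continuous_Rmult; try assumption; apply continuous_const.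
  intros E; apply (Hn x), Cmod_eq_0.
  assert (S : Cmod (f x) ^ 2 = 0) by (rewrite Cmod_sqr; simpl; exact E).
  generalize (Cmod_ge_0 (f x)); intros; nra.
split; [now apply (continuous_Rmult (fun y => Re (f y))) |].
apply (continuous_Rmult (fun y => - Im (f y))); [now apply continuous_Ropp | assumption].
Qed.

Lemma ccont_cexp (f : R -> C) : ccont f -> ccont (fun x => cexp (f x)).
Proof.
intros Hf x; destruct (Hf x) as [H1 H2].
assert (E : continuous (fun y => exp (Re (f y))) x) by now apply continuous_exp_comp.
split; apply continuous_Rmult; try assumption.
  now apply continuous_cos_comp.
now apply continuous_sin_comp.
Qed.

Lemma ccont_pow (f : R -> C) (n : nat) : ccont f -> ccont (fun x => f x ^ n)%C.
Proof.
intros Hf; induction n as [|n IH]; [exact (ccont_const 1) | exact (ccont_mult f _ Hf IH)].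
Qed.

Lemma ccont_ex_RInt (f : R -> C) (a b : R) : ccont f -> ex_RInt (fun x => Re (f x)) a b.
Proof.
intros Hf; apply (ex_RInt_continuous (V := R_CompleteNormedModule)); intros x _; apply Hf.
Qed.

Lemma RInt_Re_bound (f : R -> C) (a b K : R) : a <= b -> ccont f ->
  (forall x, a <= x <= b -> Cmod (f x) <= K) -> Rabs (RInt (fun x => Re (f x)) a b) <= (b - a) * K.
Proof.
intros Hab Hf HK; apply abs_RInt_le_const; [assumption | now apply ccont_ex_RInt |].
intros x Hx; eapply Rle_trans; [apply re_le_Cmod | now apply HK].
Qed.

Definition line (t theta : R) : C := (t, theta).

Lemma ccont_line (t : R) : ccont (line t).
Proof. intros x; split; [apply continuous_const | apply continuous_id]. Qed.

Section Cauchy.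

Variables (P : nat -> bool) (t : R).
Hypothesis t_pos : 0 < t.

Let q (theta : R) : C := cexp (- line t theta).

Lemma Cmod_q (theta : R) : Cmod (q theta) = exp (- t).
Proof. apply Cmod_cexp_neg. Qed.

Lemma Cmod_q_lt (theta : R) : Cmod (q theta) < 1.
Proof. rewrite Cmod_q, <- exp_0; apply exp_increasing; lra. Qed.

Definition integrand (M : nat) (x theta : R) : C :=
  (/ Den P M (q theta) * cexp (x * line t theta))%C.

Lemma ccont_Den (M : nat) : ccont (fun theta => Den P M (q theta)).
Proof.
assert (Hq : ccont q) by apply ccont_cexp, ccont_opp, ccont_line.
induction M as [|M IH]; [exact (ccont_const 1)|].
simpl; destruct (P (S M)); [|exact IH].
apply ccont_mult; [exact IH|].
apply ccont_plus; [apply ccont_const|].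
apply ccont_opp, (ccont_pow q (S M)), Hq.
Qed.

Lemma ccont_integrand (M : nat) (x : R) : ccont (integrand M x).
Proof.
apply ccont_mult.
  apply ccont_inv; [apply ccont_Den | intros y; apply Den_neq_0, Cmod_q_lt].
apply ccont_cexp, ccont_mult; [apply ccont_const | apply ccont_line].
Qed.

(** The exponent is a real number because the recurrence also meets negative exponents, where the
    coefficient has to be shown to vanish. *)
Definition coef (M : nat) (x : R) : R :=
  / (2 * PI) * RInt (fun theta => Re (integrand M x theta)) (- PI) PI.

Lemma coef_rec (M : nat) (x : R) : P (S M) = true ->
  coef (S M) x = coef (S M) (x - INR (S M)) + coef M x.
Proof.
intros HP; unfold coef; rewrite <- Rmult_plus_distr_l; f_equal.
rewrite <- (RInt_plus (V := R_CompleteNormedModule)) by (apply ccont_ex_RInt, ccont_integrand).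
apply (RInt_ext (V := R_CompleteNormedModule)); intros theta _.
change (Re (integrand (S M) x theta) =
  Re (integrand (S M) (x - INR (S M)) theta) + Re (integrand M x theta)).
rewrite <- re_plus; f_equal; unfold integrand.
assert (N := Den_neq_0 P (S M) _ (Cmod_q_lt theta)).
simpl Den in *; rewrite HP in *.
assert (N1 : Den P M (q theta) <> 0) by apply Den_neq_0, Cmod_q_lt.
assert (N2 : (1 - q theta ^ S M)%C <> 0) by (intros E; rewrite Cpow_S in E; apply N; try rewrite Cpow_S; rewrite E; ring).
assert (E : cexp ((x - INR (S M)) * line t theta) = (cexp (x * line t theta) * q theta ^ S M)%C).
  unfold q; rewrite cexp_neg_pow, <- cexp_plus; f_equal; ring.
replace (RtoC (x - INR (S M)) * line t theta)%C with ((x - INR (S M)) * line t theta)%C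
  by (rewrite RtoC_minus; ring).
rewrite E; rewrite Cpow_S in *; field; split; assumption.
Qed.

Lemma coef_skip (M : nat) (x : R) : P (S M) = false -> coef (S M) x = coef M x.
Proof.
intros HP; unfold coef, integrand; simpl Den; rewrite HP; reflexivity.
Qed.

Lemma Den_lower (M : nat) (theta : R) : (1 - exp (- t)) ^ M <= Cmod (Den P M (q theta)).
Proof.
assert (Hq := Cmod_q theta); assert (Hr := exp_pos (- t)).
assert (Hr1 : exp (- t) < 1) by (rewrite <- exp_0; apply exp_increasing; lra).
assert (Hp : forall n, 0 < (1 - exp (- t)) ^ n <= 1).
  intros n; split; [apply pow_lt; lra|].
  apply Rle_trans with (1 ^ n); [apply pow_incr | rewrite pow1]; lra.
assert (Hx : forall m, 1 - exp (- t) <= Cmod (1 - q theta ^ S m)).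
  intros m; generalize (Cmod_triangle_inv (RtoC 1) (- q theta ^ S m)).
  rewrite Cmod_1, Cmod_opp, Cmod_pow, Hq.
  assert (exp (- t) ^ S m <= exp (- t)).
    change (exp (- t) * exp (- t) ^ m <= exp (- t)).
    assert (exp (- t) ^ m <= 1) by (rewrite <- (pow1 m); apply pow_incr; lra); nra.
  unfold Cminus; lra.
induction M as [|M IH]; [simpl; rewrite Cmod_1; lra|].
simpl Den; destruct (P (S M)).
  rewrite Cmod_mult; simpl pow; rewrite Rmult_comm.
  specialize (Hp M); apply Rmult_le_compat; [lra | lra | assumption | apply Hx].
specialize (Hp M); simpl pow; nra.
Qed.

Lemma coef_bound (M : nat) (x : R) : Rabs (coef M x) <= / (1 - exp (- t)) ^ M * exp (x * t).
Proof.
assert (HP := PI_RGT_0).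
assert (Hr1 : exp (- t) < 1) by (rewrite <- exp_0; apply exp_increasing; lra).
unfold coef; rewrite Rabs_mult, Rabs_pos_eq by (apply Rlt_le, Rinv_0_lt_compat; lra).
apply Rmult_le_reg_l with (2 * PI); [lra|].
rewrite <- Rmult_assoc, Rinv_r, Rmult_1_l by lra.
replace (2 * PI) with (PI - - PI) by ring.
apply RInt_Re_bound; [lra | apply ccont_integrand |].
intros theta _; unfold integrand.
rewrite Cmod_mult, Cmod_inv, Cmod_cexp, re_scal_l by apply Den_neq_0, Cmod_q_lt.
apply Rmult_le_compat_r; [apply Rlt_le, exp_pos|].
apply Rinv_le_contravar; [apply pow_lt; lra | apply Den_lower].
Qed.

Lemma coef_0_0 : coef 0 0 = 1.
Proof.
assert (HP := PI_RGT_0).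
unfold coef; rewrite (RInt_ext _ (fun _ => 1)).
  rewrite RInt_const; unfold scal; simpl; unfold mult; simpl; field; lra.
intros x _; unfold integrand; simpl Den; rewrite Cmult_0_l, cexp_0.
unfold Re; simpl; field.
Qed.

Lemma coef_0_Z (n : Z) : n <> 0%Z -> coef 0 (IZR n) = 0.
Proof.
intros Hn; assert (Hx : IZR n <> 0) by now apply not_0_IZR.
set (x := IZR n) in *.
unfold coef.
assert (H : is_RInt (fun theta => Re (integrand 0 x theta)) (- PI) PI
   (exp (x * t) * sin (x * PI) / x - exp (x * t) * sin (x * - PI) / x)).
  apply (is_RInt_derive (V := R_CompleteNormedModule) (fun theta => exp (x * t) * sin (x * theta) / x)).
    intros theta _.
    replace (Re (integrand 0 x theta)) with (exp (x * t) * cos (x * theta)).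
      auto_derive; [auto | field; assumption].
    unfold integrand; simpl Den.
    replace (/ 1 * cexp (x * line t theta))%C with (cexp (x * line t theta)) by field.
    unfold cexp, line, Re, Im; simpl.
    replace (x * t - 0 * theta) with (x * t) by ring.
    now replace (x * theta + 0 * t) with (x * theta) by ring.
  intros theta _; exact (proj1 (ccont_integrand 0 x theta)).
rewrite (is_RInt_unique _ _ _ _ H).
rewrite Ropp_mult_distr_r_reverse, sin_neg.
assert (S : sin (x * PI) = 0) by (apply sin_eq_0_1; now exists n).
rewrite S; field; split; [assumption | apply PI_neq0].
Qed.

Lemma exp_neg_limit (K d : R) : 0 <= K -> 0 < d -> forall eps, 0 < eps ->
  exists n, K * exp (- (INR n * d)) <= eps.
Proof.
intros HK Hd eps Heps.
destruct (INR_unbounded (K / (d * eps))) as [n Hn]; exists n.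
assert (Hn0 : 0 <= INR n) by apply pos_INR.
rewrite exp_Ropp.
apply Rmult_le_reg_r with (exp (INR n * d)); [apply exp_pos|].
rewrite Rmult_assoc, Rinv_l, Rmult_1_r by (generalize (exp_pos (INR n * d)); lra).
apply Rle_trans with (eps * (1 + INR n * d)).
  replace K with (K / (d * eps) * (d * eps)) at 1 by (field; lra).
  assert (0 < d * eps) by nra.
  assert (K / (d * eps) * (d * eps) <= INR n * (d * eps)) by (apply Rmult_le_compat_r; lra).
  lra.
apply Rmult_le_compat_l; [lra | apply exp_ineq1_le].
Qed.

(** Since the coefficients for [M] vanish by induction, the recurrence makes those for [M + 1]
    invariant under [n -> n - (M + 1)]; but [coef_bound] tends to 0 as the exponent decreases. This
    replaces an expansion of the integrand in a power series. *)
Lemma coef_neg (M : nat) (n : Z) : (n < 0)%Z -> coef M (IZR n) = 0.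
Proof.
revert n; induction M as [|M IH]; intros n Hn; [apply coef_0_Z; lia|].
destruct (P (S M)) eqn:HP; [|rewrite coef_skip by assumption; now apply IH].
assert (Hj : forall j, coef (S M) (IZR n) = coef (S M) (IZR (n - Z.of_nat j * Z.of_nat (S M)))).
  induction j as [|j IHj]; [f_equal; f_equal; lia|].
  rewrite IHj, coef_rec, IH by (try assumption; lia).
  rewrite Rplus_0_r, INR_IZR_INZ, <- minus_IZR; f_equal; f_equal; lia.
assert (HK : 0 <= / (1 - exp (- t)) ^ S M).
  apply Rlt_le, Rinv_0_lt_compat, pow_lt.
  assert (exp (- t) < 1) by (rewrite <- exp_0; apply exp_increasing; lra); lra.
apply Rabs_eq_0, Rle_antisym; [|apply Rabs_pos].
apply le_epsilon; intros eps Heps; rewrite Rplus_0_l.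
destruct (exp_neg_limit _ t HK t_pos eps Heps) as [j Hjj].
rewrite (Hj j); apply Rle_trans with (2 := Hjj).
eapply Rle_trans; [apply coef_bound|].
apply Rmult_le_compat_l; [assumption|]; apply exp_mono.
rewrite minus_IZR, mult_IZR, <- !INR_IZR_INZ, S_INR.
assert (IZR n <= 0) by (apply IZR_le; lia).
generalize (pos_INR j) (pos_INR M); intros.
assert (0 <= INR j * INR M * t) by (apply Rmult_le_pos; [apply Rmult_le_pos|]; lra).
assert (IZR n * t <= 0) by nra; nra.
Qed.

Variable c : nat -> nat -> R.
Hypothesis c_0 : forall n, c 0 n = if Nat.eqb n 0 then 1 else 0.
Hypothesis c_S : forall M n, c (S M) n =
  c M n + (if andb (P (S M)) (Nat.leb (S M) n) then c (S M) (n - S M)%nat else 0).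

(** Both sides obey the recurrence that admits one more part size; where [n - (M + 1)] would be
    negative, the integral vanishes by [coef_neg]. *)
Lemma cauchy (M n : nat) : c M n = coef M (INR n).
Proof.
revert n; induction M as [|M IH]; intros n.
  rewrite c_0; destruct n as [|n]; [symmetry; apply coef_0_0|].
  change (Nat.eqb (S n) 0) with false; cbv iota.
  rewrite INR_IZR_INZ, coef_0_Z by lia; reflexivity.
induction n as [n IHn] using lt_wf_ind.
rewrite c_S, IH; destruct (P (S M)) eqn:HP.
  rewrite coef_rec, Rplus_comm by assumption; f_equal.
  destruct (Nat.leb (S M) n) eqn:Hle; simpl andb; cbv iota.
    apply Nat.leb_le in Hle; rewrite IHn by lia; rewrite minus_INR by assumption; reflexivity.
  apply Nat.leb_gt in Hle.
  rewrite !INR_IZR_INZ, <- minus_IZR, coef_neg by lia; reflexivity.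
rewrite coef_skip by assumption; simpl; ring.
Qed.

End Cauchy.

Lemma cder_ccont (f df : R -> C) : (forall x, cder f x (df x)) -> ccont f.
Proof.
intros H x; destruct (H x) as [H1 H2]; split.
  apply (ex_derive_continuous (V := R_NormedModule)); exists (Re (df x)); exact H1.
apply (ex_derive_continuous (V := R_NormedModule)); exists (Im (df x)); exact H2.
Qed.

Lemma RInt_Rplus (f g : R -> R) (a b : R) : ex_RInt f a b -> ex_RInt g a b ->
  RInt (fun x => f x + g x) a b = RInt f a b + RInt g a b.
Proof. apply (RInt_plus (V := R_CompleteNormedModule)). Qed.

Lemma RInt_RChasles (f : R -> R) (a b c : R) : ex_RInt f a b -> ex_RInt f b c ->
  RInt f a c = RInt f a b + RInt f b c.
Proof. intros H1 H2; symmetry; now apply (RInt_Chasles (V := R_CompleteNormedModule)). Qed.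

Lemma RInt_Rscal (c : R) (f : R -> R) (a b : R) : ex_RInt f a b ->
  RInt (fun x => c * f x) a b = c * RInt f a b.
Proof. apply (RInt_scal (V := R_CompleteNormedModule)). Qed.

Lemma cder_pow_comp (f : R -> C) (x : R) (d : C) (n : nat) : cder f x d ->
  cder (fun y => f y ^ S n)%C x (INR (S n) * f x ^ n * d)%C.
Proof.
intros H; induction n as [|n IH].
  apply cder_ext with f; [intros y; simpl; ring|].
  apply cder_eq with (1 := H); simpl; ring.
apply cder_ext with (fun y => f y * f y ^ S n)%C; [intros y; reflexivity|].
eapply cder_eq; [apply cder_mult; [exact H | exact IH]|].
rewrite (S_INR (S n)), RtoC_plus, (Cpow_S (f x) n); cbv beta; ring.
Qed.

(** * The residue of [exp (A / z + N z)] *)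

Section Path.

(* [z] runs through a contour with velocity [i v]. *)
Variables (z v : R -> C).
Hypothesis Hz : forall x, cder z x (Ci * v x)%C.
Hypothesis Hw : forall x, cder (fun y => / z y)%C x (- Ci * v x * (/ z x) ^ 2)%C.
Hypothesis Hv : ccont v.

(** As [z' = i v], the real part of [v z ^ p] is the derivative of [Im (z ^ (p + 1)) / (p + 1)]. *)
Lemma RInt_pow (p : nat) (a b : R) :
  RInt (fun x => Re (v x * z x ^ p)%C) a b =
    / INR (S p) * (Im (z b ^ S p)%C - Im (z a ^ S p)%C).
Proof.
assert (Pp := INR_S_pos p).
apply is_RInt_unique.
replace (/ INR (S p) * (Im (z b ^ S p)%C - Im (z a ^ S p)%C)) with
  (minus (/ INR (S p) * Im (z b ^ S p)%C) (/ INR (S p) * Im (z a ^ S p)%C))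
  by (unfold minus, plus, opp; simpl; ring).
apply (is_RInt_derive (V := R_CompleteNormedModule) (fun x => / INR (S p) * Im (z x ^ S p)%C)).
  intros x _; eapply is_derive_eq.
    apply (is_derive_scal (fun x => Im (z x ^ S p)%C)), (cder_pow_comp z x _ p (Hz x)).
  replace (INR (S p) * z x ^ p * (Ci * v x))%C with (INR (S p) * (Ci * (v x * z x ^ p)))%C by ring.
  rewrite im_scal_l.
  replace (Im (Ci * (v x * z x ^ p))) with (Re (v x * z x ^ p)) by (rewrite im_mult; unfold Re, Im; simpl; ring).
  field; lra.
assert (G : ccont (fun x => v x * z x ^ p)%C).
  apply (ccont_mult v (fun y => z y ^ p)%C Hv), ccont_pow, (cder_ccont z _ Hz).
intros x _; exact (proj1 (G x)).
Qed.

Lemma RInt_inv_pow (p : nat) (a b : R) :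
  RInt (fun x => Re (v x * (/ z x) ^ S (S p))%C) a b =
    - / INR (S p) * (Im ((/ z b) ^ S p)%C - Im ((/ z a) ^ S p)%C).
Proof.
assert (Pp := INR_S_pos p).
apply is_RInt_unique.
replace (- / INR (S p) * (Im ((/ z b) ^ S p)%C - Im ((/ z a) ^ S p)%C)) with
  (minus (- / INR (S p) * Im ((/ z b) ^ S p)%C) (- / INR (S p) * Im ((/ z a) ^ S p)%C))
  by (unfold minus, plus, opp; simpl; ring).
apply (is_RInt_derive (V := R_CompleteNormedModule) (fun x => - / INR (S p) * Im ((/ z x) ^ S p)%C)).
  intros x _; eapply is_derive_eq.
    apply (is_derive_scal (fun x => Im ((/ z x) ^ S p)%C)).
    apply (cder_pow_comp (fun y => / z y)%C x _ p (Hw x)).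
  replace (INR (S p) * (/ z x) ^ p * (- Ci * v x * (/ z x) ^ 2))%C with
    (INR (S p) * (- Ci * (v x * (/ z x) ^ S (S p))))%C by (rewrite !Cpow_S; simpl; ring).
  rewrite im_scal_l; set (y := (v x * (/ z x) ^ S (S p))%C).
  replace (Im (- Ci * y)) with (- Re y) by (rewrite im_mult; unfold Re, Im; simpl; ring).
  field; lra.
assert (G : ccont (fun x => v x * (/ z x) ^ S (S p))%C).
  apply (ccont_mult v (fun y => (/ z y) ^ S (S p))%C Hv).
  apply ccont_pow, (cder_ccont (fun y => / z y)%C _ Hw).
intros x _; exact (proj1 (G x)).
Qed.

End Path.

Section Residue.

Variables (t th : R).
Hypothesis t_pos : 0 < t.
Hypothesis th_pos : 0 < th.

Definition rad : R := sqrt (t ^ 2 + th ^ 2).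
Definition phi0 : R := atan (th / t).
Definition arc (phi : R) : C := (RtoC rad * cexp (Ci * RtoC phi))%C.

Lemma rad_sqr : rad ^ 2 = t ^ 2 + th ^ 2.
Proof. unfold rad; rewrite <- Rsqr_pow2, Rsqr_sqrt by nra; reflexivity. Qed.

Lemma rad_pos : 0 < rad.
Proof. apply sqrt_lt_R0; nra. Qed.

Lemma arc_eq (phi : R) : arc phi = (rad * cos phi, rad * sin phi).
Proof.
unfold arc; cx; replace (0 * phi - 1 * 0) with 0 by ring; replace (0 * 0 + 1 * phi) with phi by ring;
  rewrite exp_0; ring.
Qed.

Lemma rad_cos : rad * cos phi0 = t.
Proof.
unfold phi0; rewrite cos_atan.
assert (E : rad = t * sqrt (1 + (th / t)²)).
  unfold rad; rewrite <- (sqrt_Rsqr t) at 2 by lra.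
  rewrite <- sqrt_mult by (unfold Rsqr; nra); f_equal; unfold Rsqr; field; lra.
assert (0 < sqrt (1 + (th / t)²)) by (apply sqrt_lt_R0; generalize (Rle_0_sqr (th / t)); lra).
rewrite E; field; lra.
Qed.

Lemma rad_sin : rad * sin phi0 = th.
Proof.
assert (E : sin phi0 = th / t * cos phi0).
  unfold phi0; rewrite sin_atan, cos_atan; unfold Rdiv; ring.
rewrite E; replace (rad * (th / t * cos phi0)) with (th / t * (rad * cos phi0)) by ring.
rewrite rad_cos; field; lra.
Qed.

Lemma arc_start : arc phi0 = line t th.
Proof. rewrite arc_eq, rad_cos, rad_sin; reflexivity. Qed.

Lemma arc_end : arc (2 * PI - phi0) = line t (- th).
Proof.
rewrite arc_eq; unfold line.
replace (cos (2 * PI - phi0)) with (cos phi0).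
  replace (sin (2 * PI - phi0)) with (- sin phi0).
    rewrite rad_cos, <- rad_sin; f_equal; ring.
  rewrite <- sin_neg; replace (2 * PI - phi0) with (- phi0 + 2 * INR 1 * PI) by (simpl; ring).
  symmetry; apply sin_period.
rewrite <- cos_neg; replace (2 * PI - phi0) with (- phi0 + 2 * INR 1 * PI) by (simpl; ring).
symmetry; apply cos_period.
Qed.

Lemma phi0_bound : 0 < phi0 < PI / 2.
Proof.
split; [|apply atan_bound].
unfold phi0; rewrite <- atan_0; apply atan_increasing, Rdiv_lt_0_compat; assumption.
Qed.

Lemma line_neq_0 (x : R) : line t x <> 0.
Proof. now apply Re_pos_neq_0. Qed.

Lemma arc_neq_0 (x : R) : arc x <> 0.
Proof.
apply Cmult_neq_0; [apply RtoC_neq_0; generalize rad_pos; lra | apply cexp_neq_0].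
Qed.

Lemma cder_line (x : R) : cder (line t) x (Ci * 1)%C.
Proof.
split; simpl.
  eapply is_derive_eq; [apply (is_derive_const (K := R_AbsRing) (V := R_NormedModule) t x)|].
  unfold zero; simpl; ring.
eapply is_derive_eq; [apply (is_derive_id (K := R_AbsRing) x)|]; unfold one; simpl; ring.
Qed.

Lemma cder_line_inv (x : R) : cder (fun y => / line t y)%C x (- Ci * 1 * (/ line t x) ^ 2)%C.
Proof.
assert (H : t ^ 2 + x ^ 2 <> 0) by nra.
split; unfold line, Re, Im; simpl; auto_derive; try (simpl in H; lra);
  simpl in H; field; simpl in H; lra.
Qed.

Lemma cder_arc (x : R) : cder arc x (Ci * arc x)%C.
Proof.
unfold arc; eapply cder_eq.
  apply cder_scal, cder_cexp, cder_scal, cder_id.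
cbv beta; ring.
Qed.

Lemma arc_inv (x : R) : (/ arc x)%C = (RtoC (/ rad) * cexp (- Ci * RtoC x))%C.
Proof.
unfold arc; assert (Hr := rad_pos).
assert (E : cexp (- Ci * RtoC x) = (/ cexp (Ci * RtoC x))%C).
  rewrite <- cexp_opp; f_equal; ring.
rewrite E, RtoC_inv by lra; field; split; [apply cexp_neq_0 | apply RtoC_neq_0; lra].
Qed.

Lemma cder_arc_inv (x : R) : cder (fun y => / arc y)%C x (- Ci * arc x * (/ arc x) ^ 2)%C.
Proof.
apply cder_ext with (fun y => RtoC (/ rad) * cexp (- Ci * RtoC y))%C.
  intros y; symmetry; apply arc_inv.
eapply cder_eq.
  apply cder_scal, cder_cexp, cder_scal, cder_id.
replace (- Ci * arc x * (/ arc x) ^ 2)%C with (- Ci * / arc x)%C by (simpl; field; apply arc_neq_0).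
rewrite arc_inv; cbv beta; ring.
Qed.

(* The vertical segment from [t - i th] to [t + i th], closed by the circular arc around
   [0] through its end points. *)
Definition contour (h : C -> C) : R :=
  / (2 * PI) * (RInt (fun x => Re (h (line t x))) (- th) th +
    RInt (fun x => Re (arc x * h (arc x))%C) phi0 (2 * PI - phi0)).

Definition path_cont (h : C -> C) : Prop :=
  ccont (fun x => h (line t x)) /\ ccont (fun x => h (arc x)).

Lemma contour_ext (h1 h2 : C -> C) : (forall z, h1 z = h2 z) -> contour h1 = contour h2.
Proof.
intros H; unfold contour; do 2 f_equal; apply RInt_ext; intros x _; now rewrite H.
Qed.

Lemma ccont_arc : ccont arc.
Proof. apply (cder_ccont arc _ cder_arc). Qed.

Lemma contour_ex (h : C -> C) : path_cont h ->
  ex_RInt (fun x => Re (h (line t x))) (- th) th /\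
  ex_RInt (fun x => Re (arc x * h (arc x))%C) phi0 (2 * PI - phi0).
Proof.
intros [H1 H2]; split; [now apply (ccont_ex_RInt (fun x => h (line t x)))|].
apply (ccont_ex_RInt (fun x => arc x * h (arc x))%C), ccont_mult; [apply ccont_arc | assumption].
Qed.

Lemma contour_plus (h1 h2 : C -> C) : path_cont h1 -> path_cont h2 ->
  contour (fun z => h1 z + h2 z)%C = contour h1 + contour h2.
Proof.
intros H1 H2; destruct (contour_ex h1 H1), (contour_ex h2 H2); unfold contour.
rewrite (RInt_ext (fun x => Re (h1 (line t x) + h2 (line t x)))
  (fun x => Re (h1 (line t x)) + Re (h2 (line t x)))) by (intros; apply re_plus).
rewrite (RInt_ext (fun x => Re (arc x * (h1 (arc x) + h2 (arc x))))
  (fun x => Re (arc x * h1 (arc x))%C + Re (arc x * h2 (arc x))%C))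
  by (intros; rewrite <- re_plus; f_equal; ring).
rewrite !RInt_Rplus by assumption; ring.
Qed.

Lemma contour_scal (c : R) (h : C -> C) : path_cont h ->
  contour (fun z => RtoC c * h z)%C = c * contour h.
Proof.
intros H; destruct (contour_ex h H); unfold contour.
rewrite (RInt_ext (fun x => Re (c * h (line t x))) (fun x => c * Re (h (line t x))))
  by (intros; apply re_scal_l).
rewrite (RInt_ext (fun x => Re (arc x * (c * h (arc x)))) (fun x => c * Re (arc x * h (arc x))%C))
  by (intros; replace (arc x * (c * h (arc x)))%C with (c * (arc x * h (arc x)))%C by ring; apply re_scal_l).
rewrite !RInt_Rscal by assumption; ring.
Qed.

Lemma path_cont_scal (c : C) (h : C -> C) : path_cont h -> path_cont (fun z => c * h z)%C.
Proof. intros [H1 H2]; split; (apply ccont_mult; [apply ccont_const | assumption]). Qed.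

Lemma path_cont_csn (h : nat -> C -> C) (n : nat) : (forall i, path_cont (h i)) ->
  path_cont (fun z => csn (fun i => h i z) n).
Proof.
intros H; induction n as [|n [IH1 IH2]]; [split; apply (ccont_const 0)|].
destruct (H n); split; now apply ccont_plus.
Qed.

Lemma contour_csn (h : nat -> C -> C) (n : nat) : (forall i, path_cont (h i)) ->
  contour (fun z => csn (fun i => h i z) n) = rsn (fun i => contour (h i)) n.
Proof.
intros H; induction n as [|n IH]; simpl.
  unfold contour; rewrite (RInt_ext _ (fun _ => 0)) by (intros; reflexivity).
  rewrite (RInt_ext (fun x => Re (arc x * 0)) (fun _ => 0)) by (intros; rewrite Cmult_0_r; reflexivity).
  rewrite !RInt_const; unfold scal, plus; simpl; unfold mult; simpl; ring.
rewrite contour_plus, IH; auto; now apply path_cont_csn.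
Qed.

Definition mono (i j : nat) (z : C) : C := (z ^ j * (/ z) ^ i)%C.

Lemma path_cont_mono (i j : nat) : path_cont (mono i j).
Proof.
split; apply ccont_mult; apply ccont_pow.
- apply ccont_line.
- apply ccont_inv; [apply ccont_line | apply line_neq_0].
- apply ccont_arc.
- apply ccont_inv; [apply ccont_arc | apply arc_neq_0].
Qed.

(** For an exponent other than [- 1] there is an antiderivative, and segment and arc share their end
    points. For [1 / z] the segment contributes the angle [2 phi0] and the arc [2 pi - 2 phi0]. *)
Lemma contour_mono (i j : nat) : contour (mono i j) = if Nat.eqb i (S j) then 1 else 0.
Proof.
assert (HP := PI_RGT_0).
assert (Mz : forall z : C, z <> 0 -> forall p m, (z ^ (p + m) * (/ z) ^ m)%C = (z ^ p)%C).
  intros z Nz p m; rewrite Cpow_add_r, Cpow_inv by assumption.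
  field; now apply Cpow_nz.
assert (Mw : forall z : C, z <> 0 -> forall p m, (z ^ m * (/ z) ^ (p + m))%C = ((/ z) ^ p)%C).
  intros z Nz p m; rewrite Cpow_add_r, !Cpow_inv by assumption.
  field; split; now apply Cpow_nz.
destruct (le_lt_dec i j) as [Hij|Hij].
  replace (Nat.eqb i (S j)) with false by (symmetry; apply Nat.eqb_neq; lia).
  unfold contour, mono; replace j with ((j - i) + i)%nat by lia; set (p := (j - i)%nat).
  rewrite (RInt_ext _ (fun x => Re (1 * line t x ^ p)))
    by (intros x _; rewrite Mz by apply line_neq_0; f_equal; ring).
  rewrite (RInt_ext (fun x => Re (arc x * _)) (fun x => Re (arc x * arc x ^ p)))
    by (intros x _; rewrite Mz by apply arc_neq_0; reflexivity).
  rewrite (RInt_pow (line t) (fun _ => 1) cder_line (ccont_const 1)).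
  rewrite (RInt_pow arc arc cder_arc ccont_arc).
  rewrite arc_start, arc_end; ring.
destruct (Nat.eq_dec i (S j)) as [E|E].
  subst i; rewrite Nat.eqb_refl; unfold contour, mono.
  rewrite (RInt_ext _ (fun x => t / (t ^ 2 + x ^ 2))).
  2: { intros x _; change (S j) with (1 + j)%nat; rewrite Mw, Cpow_1_r by apply line_neq_0.
    unfold line, Re; simpl; reflexivity. }
  rewrite (RInt_ext (fun x => Re (arc x * _)) (fun _ => 1)).
  2: { intros x _; change (S j) with (1 + j)%nat; rewrite Mw, Cpow_1_r, Cinv_r by apply arc_neq_0.
    reflexivity. }
  assert (H : is_RInt (fun x => t / (t ^ 2 + x ^ 2)) (- th) th (minus (atan (th / t)) (atan (- th / t)))).
    apply (is_RInt_derive (V := R_CompleteNormedModule) (fun x => atan (x / t))).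
      intros x _; auto_derive; [lra | field; repeat split; try lra; nra].
    intros x _; apply (continuous_Rmult (fun _ => t)); [apply continuous_const|].
    apply continuous_Rinv_comp; [|nra].
    apply continuous_Rplus; [apply continuous_const|].
    simpl; apply continuous_Rmult; [apply continuous_id|].
    apply continuous_Rmult; [apply continuous_id | apply continuous_const].
  rewrite (is_RInt_unique _ _ _ _ H), RInt_const.
  replace (- th / t) with (- (th / t)) by (field; lra); rewrite atan_opp; fold phi0.
  unfold scal, minus, plus, opp; simpl; unfold mult; simpl; field; lra.
replace (Nat.eqb i (S j)) with false by (symmetry; apply Nat.eqb_neq; lia).
unfold contour, mono; replace i with (S (S (i - j - 2)) + j)%nat by lia; set (p := (i - j - 2)%nat).
rewrite (RInt_ext _ (fun x => Re (1 * (/ line t x) ^ S (S p))))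
  by (intros x _; rewrite Mw by apply line_neq_0; f_equal; ring).
rewrite (RInt_ext (fun x => Re (arc x * _)) (fun x => Re (arc x * (/ arc x) ^ S (S p))))
  by (intros x _; rewrite Mw by apply arc_neq_0; reflexivity).
rewrite (RInt_inv_pow (line t) (fun _ => 1) cder_line_inv (ccont_const 1)).
rewrite (RInt_inv_pow arc arc cder_arc_inv ccont_arc).
rewrite arc_start, arc_end; ring.
Qed.

End Residue.

(* [Bes (y ^ 2) = I_1 (2 y) / y] for the modified Bessel function [I_1]. *)
Definition bescoef (j : nat) : R := / (INR (fact j) * INR (fact (S j))).
Definition Bes (x : R) : R := PSeries bescoef x.

Lemma bescoef_pos (j : nat) : 0 < bescoef j.
Proof. apply Rinv_0_lt_compat, Rmult_lt_0_compat; apply INR_fact_lt_0. Qed.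

Lemma bescoef_S (j : nat) : bescoef j = INR (S j) * INR (S (S j)) * bescoef (S j).
Proof.
unfold bescoef; rewrite (INR_fact_S (S j)), (INR_fact_S j).
generalize (INR_fact_lt_0 j) (INR_S_pos j) (INR_S_pos (S j)); intros; field; lra.
Qed.

Lemma bescoef_radius : CV_radius bescoef = p_infty.
Proof.
apply CV_radius_infinite_DAlembert; [intros n; generalize (bescoef_pos n); lra|].
apply is_lim_seq_le_le with (fun _ => 0) (fun n => / INR (S n)).
- intros n; rewrite (bescoef_S n); generalize (bescoef_pos (S n)) (INR_S_pos n); intros Hb H1.
  assert (H2 : 1 <= INR (S (S n))) by (apply (le_INR 1); lia).
  replace (bescoef (S n) / (INR (S n) * INR (S (S n)) * bescoef (S n))) with
    (/ INR (S n) * / INR (S (S n))) by (field; lra).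
  assert (0 < / INR (S n)) by now apply Rinv_0_lt_compat.
  assert (0 < / INR (S (S n)) <= 1).
    split; [apply Rinv_0_lt_compat; lra|]; apply Rle_trans with (/ 1); [apply Rinv_le_contravar; lra | lra].
  rewrite Rabs_pos_eq; nra.
- apply is_lim_seq_const.
- apply (is_lim_seq_incr_1 (fun n => / INR n)).
  replace (Finite 0) with (Rbar_inv p_infty) by reflexivity.
  apply is_lim_seq_inv; [apply is_lim_seq_INR | discriminate].
Qed.

Lemma Bes_series (x : R) : is_series (fun j => bescoef j * x ^ j) (Bes x).
Proof.
apply is_series_ext with (fun k => scal (pow_n x k) (bescoef k)).
  intros n; rewrite pow_n_pow; apply Rmult_comm.
apply PSeries_correct, CV_radius_inside; rewrite bescoef_radius; exact I.
Qed.

Lemma rsn_indicator (f : nat -> R) (i n : nat) : (i <= n)%nat ->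
  rsn (fun j => if Nat.eqb i (S j) then f j else 0) n = match i with O => 0 | S j => f j end.
Proof.
destruct i as [|i]; intros Hi.
  rewrite (rsn_ext _ (fun _ => 0 * 0)) by (intros; simpl; ring).
  rewrite (rsn_scal 0 (fun _ => 0)); ring.
assert (E : forall m, rsn (fun j => if Nat.eqb (S i) (S j) then f j else 0) m =
    if Nat.ltb i m then f i else 0).
  induction m as [|m IH]; [reflexivity|]; simpl rsn; simpl in IH; rewrite IH.
  destruct (Nat.ltb_spec i m), (Nat.eqb_spec i m), (Nat.ltb_spec i (S m)); subst; try lia; ring.
rewrite E; destruct (Nat.ltb_spec i n); [reflexivity | lia].
Qed.

Section ResidueExp.

Variables (t th A N : R).
Hypothesis t_pos : 0 < t.
Hypothesis th_pos : 0 < th.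
Hypothesis A_pos : 0 < A.
Hypothesis N_pos : 0 < N.

Let rad := rad t th.
(** A bound for both [A / z] and [N z] on the contour, where [t <= |z| <= rad]. *)
Let X := A / t + N * rad.

Definition kernel (z : C) : C := cexp (RtoC A * / z + RtoC N * z).

Definition kernel_poly (J : nat) (z : C) : C :=
  (cexp_poly (RtoC A * / z) J * cexp_poly (RtoC N * z) J)%C.

Lemma Cmod_line_bounds (x : R) : - th <= x <= th -> t <= Cmod (line t x) <= rad.
Proof.
intros Hx; assert (E := Cmod_sqr (line t x)); change (Re (line t x)) with t in E; change (Im (line t x)) with x in E.
assert (Er := rad_sqr t th); fold rad in Er.
assert (Hr := rad_pos t th th_pos); fold rad in Hr.
assert (P := Cmod_ge_0 (line t x)).
split; apply Rsqr_incr_0_var; try lra; rewrite !Rsqr_pow2; nra.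
Qed.

Lemma Cmod_arc (x : R) : Cmod (arc t th x) = rad.
Proof.
unfold arc; rewrite Cmod_mult, Cmod_R_pos by (apply Rlt_le, rad_pos, th_pos).
rewrite Cmod_cexp; unfold Re; simpl.
replace (0 * x - 1 * 0) with 0 by ring; rewrite exp_0; unfold rad; ring.
Qed.

Lemma rad_ge : t <= rad.
Proof. generalize (Cmod_line_bounds 0 ltac:(lra)); lra. Qed.

Lemma kernel_approx (J : nat) (z : C) : t <= Cmod z <= rad ->
  (2 * X) ^ J / INR (fact J) * exp X <= 1 ->
  Cmod (kernel z - kernel_poly J z) <=
    (2 * X) ^ J / INR (fact J) * exp X * (2 * exp X + 1).
Proof.
intros Hz HJ; set (d := (2 * X) ^ J / INR (fact J) * exp X) in *.
assert (Nz : z <> 0) by (apply Cmod_gt_0; lra).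
assert (F := INR_fact_lt_0 J).
assert (Ha : Cmod (RtoC A * / z) <= X).
  rewrite Cmod_mult, Cmod_inv, Cmod_R_pos by (try assumption; lra); unfold X.
  assert (A * / Cmod z <= A / t) by (apply Rmult_le_compat_l; [lra | apply Rinv_le_contravar; lra]).
  assert (0 <= N * rad) by (apply Rmult_le_pos; lra); lra.
assert (Hb : Cmod (RtoC N * z) <= X).
  rewrite Cmod_mult, Cmod_R_pos by lra; unfold X.
  assert (N * Cmod z <= N * rad) by (apply Rmult_le_compat_l; lra).
  assert (0 < A / t) by (apply Rdiv_lt_0_compat; lra); lra.
set (a := (RtoC A * / z)%C) in *; set (b := (RtoC N * z)%C) in *.
assert (T : forall w, Cmod w <= X -> Cmod (cexp w - cexp_poly w J) <= d /\ Cmod (cexp w) <= exp X).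
  intros w Hw; split.
    eapply Rle_trans; [apply cexp_taylor|]; unfold d.
    apply Rmult_le_compat.
    - apply Rmult_le_pos; [apply pow_le; generalize (Cmod_ge_0 w); lra | apply Rlt_le, Rinv_0_lt_compat, F].
    - apply Rlt_le, exp_pos.
    - apply Rmult_le_compat_r; [apply Rlt_le, Rinv_0_lt_compat, F|].
      apply pow_incr; generalize (Cmod_ge_0 w); lra.
    - now apply exp_mono.
  rewrite Cmod_cexp; apply exp_mono; generalize (re_le_Cmod w) (Rle_abs (Re w)); lra.
destruct (T a Ha) as [T1 T2]; destruct (T b Hb) as [T3 T4].
unfold kernel, kernel_poly; fold a b; rewrite cexp_plus.
replace (cexp a * cexp b - cexp_poly a J * cexp_poly b J)%C with
  (cexp a * (cexp b - cexp_poly b J) + (cexp a - cexp_poly a J) * (cexp b + - (cexp b - cexp_poly b J)))%C by ring.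
assert (Hd : 0 <= d) by (apply Rle_trans with (2 := T1), Cmod_ge_0).
eapply Rle_trans; [apply Cmod_triangle|]; rewrite !Cmod_mult.
apply Rle_trans with (exp X * d + d * (exp X + 1)); [|lra].
apply Rplus_le_compat; apply Rmult_le_compat; try apply Cmod_ge_0; try assumption.
eapply Rle_trans; [apply Cmod_triangle|]; rewrite Cmod_opp; lra.
Qed.

Lemma kernel_poly_mono (J : nat) (z : C) : kernel_poly J z =
  csn (fun i => csn (fun j => RtoC (A ^ i / INR (fact i) * (N ^ j / INR (fact j))) * mono i j z) J)%C J.
Proof.
unfold kernel_poly, cexp_poly; rewrite Cmult_comm, <- csn_scal.
apply csn_ext; intros i _; rewrite Cmult_comm, <- csn_scal; apply csn_ext; intros j _.
unfold mono; rewrite !Cpow_mult_l, RtoC_mult, !RtoC_div, !RtoC_pow by apply INR_fact_neq_0.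
field; split; apply RtoC_neq_0, INR_fact_neq_0.
Qed.

(** Only the products of [A ^ (j + 1) z ^ (- j - 1) / (j + 1)!] with [N ^ j z ^ j / j!] have a
    residue. *)
Lemma contour_kernel_poly (J : nat) :
  contour t th (kernel_poly (S J)) = A * rsn (fun j => bescoef j * (A * N) ^ j) J.
Proof.
rewrite (contour_ext t th _ _ (kernel_poly_mono (S J))).
assert (Hm := path_cont_mono t th t_pos th_pos).
rewrite (contour_csn t th (fun i z => csn (fun j => RtoC (A ^ i / INR (fact i) * (N ^ j / INR (fact j))) * mono i j z) (S J))%C).
2: intros i; apply (path_cont_csn t th (fun j z => RtoC _ * mono i j z)%C); intros j; apply path_cont_scal, Hm.
rewrite (rsn_ext _ (fun i => match i with O => 0 | S j => A ^ S j / INR (fact (S j)) * (N ^ j / INR (fact j)) end)).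
  change (S J) with (1 + J)%nat; rewrite rsn_add, <- rsn_scal; simpl rsn at 1.
  rewrite Rplus_0_l, Rplus_0_l; apply rsn_ext; intros j _; change (1 + j)%nat with (S j); cbv iota beta.
  unfold bescoef; rewrite Rpow_mult_distr; simpl pow; field; split; apply INR_fact_neq_0.
intros i Hi.
rewrite (contour_csn t th (fun j z => RtoC (A ^ i / INR (fact i) * (N ^ j / INR (fact j))) * mono i j z)%C)
  by (intros j; apply path_cont_scal, Hm).
rewrite (rsn_ext _ (fun j => if Nat.eqb i (S j) then A ^ i / INR (fact i) * (N ^ j / INR (fact j)) else 0)).
  rewrite rsn_indicator by lia; destruct i; reflexivity.
intros j _; rewrite contour_scal by (try assumption; apply Hm).
rewrite contour_mono by assumption; destruct (Nat.eqb i (S j)); ring.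
Qed.

Lemma path_cont_kernel : path_cont t th kernel.
Proof.
assert (G : forall f : R -> C, ccont f -> (forall x, f x <> 0) -> ccont (fun x => kernel (f x))).
  intros f Hf Hn; apply (ccont_cexp (fun x => RtoC A * / f x + RtoC N * f x)%C).
  apply (ccont_plus (fun x => RtoC A * / f x)%C (fun x => RtoC N * f x)%C).
    apply (ccont_mult (fun _ => RtoC A) (fun x => / f x)%C); [apply ccont_const | now apply ccont_inv].
  apply (ccont_mult (fun _ => RtoC N) f); [apply ccont_const | assumption].
split; apply G.
- apply ccont_line.
- apply line_neq_0, t_pos.
- apply ccont_arc.
- apply arc_neq_0, th_pos.
Qed.

Lemma contour_bound (h : C -> C) (eps : R) : path_cont t th h -> 0 <= eps ->
  (forall z, t <= Cmod z <= rad -> Cmod (h z) <= eps) ->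
  Rabs (contour t th h) <= (th + rad) * eps.
Proof.
intros [H1 H2] He Hb; assert (HP := PI_RGT_0).
assert (HP3 : 1 < PI) by (generalize PI2_3_2; lra).
assert (Hphi := phi0_bound t th t_pos th_pos).
assert (Hr := rad_pos t th th_pos); fold rad in Hr.
unfold contour; rewrite Rabs_mult, Rabs_pos_eq by (apply Rlt_le, Rinv_0_lt_compat; lra).
assert (B1 : Rabs (RInt (fun x => Re (h (line t x))) (- th) th) <= (th - - th) * eps).
  apply (RInt_Re_bound (fun x => h (line t x))); [lra | assumption |].
  intros x Hx; apply Hb, Cmod_line_bounds, Hx.
assert (B2 : Rabs (RInt (fun x => Re (arc t th x * h (arc t th x))%C) (phi0 t th) (2 * PI - phi0 t th)) <=
   (2 * PI - phi0 t th - phi0 t th) * (rad * eps)).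
  apply (RInt_Re_bound (fun x => arc t th x * h (arc t th x))%C); [lra | |].
    apply ccont_mult; [apply ccont_arc | assumption].
  intros x _; rewrite Cmod_mult, Cmod_arc; apply Rmult_le_compat_l; [lra|].
  apply Hb; rewrite Cmod_arc; split; [apply rad_ge | lra].
apply Rmult_le_reg_l with (2 * PI); [lra|].
rewrite <- Rmult_assoc, Rinv_r, Rmult_1_l by lra.
eapply Rle_trans; [apply Rabs_triang|].
apply Rle_trans with (2 * th * eps + 2 * PI * (rad * eps)).
  apply Rplus_le_compat; [lra|].
  apply Rle_trans with (1 := B2), Rmult_le_compat_r; [|lra]; apply Rmult_le_pos; lra.
assert (0 <= th * eps) by (apply Rmult_le_pos; lra); nra.
Qed.

Lemma contour_kernel : contour t th kernel = A * Bes (A * N).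
Proof.
assert (Hr := rad_pos t th th_pos); fold rad in Hr.
assert (HE := exp_pos X).
apply Rminus_diag_uniq, Rabs_eq_0, Rle_antisym; [|apply Rabs_pos].
apply le_epsilon; intros eps Heps; rewrite Rplus_0_l.
set (K := (th + rad) * (2 * exp X + 1)).
assert (HK : 0 < K) by (unfold K; apply Rmult_lt_0_compat; lra).
pose (eta := Rmin 1 (eps / (2 * K))).
assert (Heta : 0 < eta) by (apply Rmin_pos; [lra | apply Rdiv_lt_0_compat; lra]).
destruct (cv_speed_pow_fact (2 * X) (eta / exp X)) as [J1 HJ1].
  apply Rdiv_lt_0_compat; assumption.
destruct (is_series_rsn _ _ (Bes_series (A * N)) (eps / (2 * A))) as [J2 HJ2].
  apply Rdiv_lt_0_compat; lra.
set (J := max J1 J2).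
specialize (HJ1 (S J) ltac:(lia)); specialize (HJ2 J ltac:(lia)).
unfold Rdist in HJ1; rewrite Rminus_0_r in HJ1.
assert (Hd : (2 * X) ^ S J / INR (fact (S J)) * exp X <= eta).
  apply Rle_trans with (eta / exp X * exp X); [|apply Req_le; field; lra].
  apply Rmult_le_compat_r; [lra|]; generalize (Rle_abs ((2 * X) ^ S J / INR (fact (S J)))); lra.
assert (Hpoly : path_cont t th (kernel_poly (S J))).
  assert (Hm := path_cont_mono t th t_pos th_pos).
  assert (G : path_cont t th (fun z => csn (fun i => csn (fun j =>
      RtoC (A ^ i / INR (fact i) * (N ^ j / INR (fact j))) * mono i j z)%C (S J)) (S J))).
    apply (path_cont_csn t th (fun i z => csn (fun j =>
      RtoC (A ^ i / INR (fact i) * (N ^ j / INR (fact j))) * mono i j z)%C (S J))); intros i.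
    apply (path_cont_csn t th (fun j z =>
      RtoC (A ^ i / INR (fact i) * (N ^ j / INR (fact j))) * mono i j z)%C); intros j.
    apply path_cont_scal, Hm.
  destruct G as [G1 G2]; split.
    apply ccont_ext with (2 := G1); intros x; symmetry; apply kernel_poly_mono.
  apply ccont_ext with (2 := G2); intros x; symmetry; apply kernel_poly_mono.
assert (Hdiff : path_cont t th (fun z => kernel z + RtoC (-1) * kernel_poly (S J) z)%C).
  destruct path_cont_kernel as [G1 G2], (path_cont_scal t th (RtoC (-1)) _ Hpoly) as [G3 G4].
  split; [exact (ccont_plus _ _ G1 G3) | exact (ccont_plus _ _ G2 G4)].
assert (E : contour t th kernel = contour t th (kernel_poly (S J)) +
   contour t th (fun z => kernel z + RtoC (-1) * kernel_poly (S J) z)%C).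
  rewrite <- (contour_plus t th _ _ Hpoly Hdiff).
  apply contour_ext; intros z; replace (RtoC (-1)) with (Copp (RtoC 1)) by (cx; ring); ring.
rewrite E, contour_kernel_poly.
assert (B : Rabs (contour t th (fun z => kernel z + RtoC (-1) * kernel_poly (S J) z)%C) <= (th + rad) * (eta * (2 * exp X + 1))).
  apply contour_bound.
  - exact Hdiff.
  - apply Rmult_le_pos; lra.
  - intros z Hz; replace (kernel z + RtoC (-1) * kernel_poly (S J) z)%C with (kernel z - kernel_poly (S J) z)%C
      by (replace (RtoC (-1)) with (Copp (RtoC 1)) by (cx; ring); ring).
    assert (eta <= 1) by apply Rmin_l.
    eapply Rle_trans; [apply kernel_approx; [assumption | lra]|].
    apply Rmult_le_compat_r; lra.
assert (B' : (th + rad) * (eta * (2 * exp X + 1)) <= eps / 2).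
  replace ((th + rad) * (eta * (2 * exp X + 1))) with (eta * K) by (unfold K; ring).
  apply Rle_trans with (eps / (2 * K) * K); [|apply Req_le; field; lra].
  apply Rmult_le_compat_r; [lra | apply Rmin_r].
set (S := rsn (fun j => bescoef j * (A * N) ^ j) J) in *.
set (c := contour t th (fun z => kernel z + RtoC (-1) * kernel_poly _ z)%C) in *.
replace (A * S + c - A * Bes (A * N)) with (A * (S - Bes (A * N)) + c) by ring.
eapply Rle_trans; [apply Rabs_triang|]; rewrite Rabs_mult, (Rabs_pos_eq A) by lra.
assert (A * Rabs (S - Bes (A * N)) <= eps / 2).
  replace (eps / 2) with (A * (eps / (2 * A))) by (field; lra); apply Rmult_le_compat_l; lra.
lra.
Qed.

(** The error is the integral over the arc. As the arc lies to the left of the segment, [Re z <= t]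
    there, and [Re (1 / z) = Re z / rad ^ 2]. *)
Lemma line_kernel_error :
  Rabs (/ (2 * PI) * RInt (fun x => Re (kernel (line t x))) (- th) th - A * Bes (A * N)) <=
    rad * exp (A * t / rad ^ 2 + N * t).
Proof.
assert (HP := PI_RGT_0).
assert (Hr := rad_pos t th th_pos); fold rad in Hr.
assert (Hphi := phi0_bound t th t_pos th_pos).
rewrite <- contour_kernel; unfold contour.
match goal with |- Rabs (?a * ?b - ?a * (?b + ?c)) <= _ =>
  replace (a * b - a * (b + c)) with (- (a * c)) by ring end.
rewrite Rabs_Ropp, Rabs_mult, Rabs_pos_eq by (apply Rlt_le, Rinv_0_lt_compat; lra).
apply Rmult_le_reg_l with (2 * PI); [lra|].
rewrite <- Rmult_assoc, Rinv_r, Rmult_1_l by lra.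
set (K := rad * exp (A * t / rad ^ 2 + N * t)).
assert (HK : 0 < K) by (apply Rmult_lt_0_compat; [assumption | apply exp_pos]).
apply Rle_trans with ((2 * PI - phi0 t th - phi0 t th) * K).
2: apply Rmult_le_compat_r; lra.
apply (RInt_Re_bound (fun x => arc t th x * kernel (arc t th x))%C); [lra | |].
  apply ccont_mult; [apply ccont_arc | apply path_cont_kernel].
intros x Hx; rewrite Cmod_mult, Cmod_arc; unfold kernel; rewrite Cmod_cexp.
apply Rmult_le_compat_l; [lra|]; apply exp_mono.
rewrite re_plus, !re_scal_l.
assert (Ex : arc t th x = (rad * cos x, rad * sin x)) by apply arc_eq.
assert (Hc : rad * cos x <= t).
  assert (Er : rad * cos (phi0 t th) = t) by (apply rad_cos; assumption).
  rewrite <- Er; apply Rmult_le_compat_l; [lra|].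
  destruct (Rle_dec x PI).
    apply cos_decr_1; lra.
  replace (cos x) with (cos (2 * PI - x)).
    apply cos_decr_1; lra.
  rewrite <- cos_neg; replace (- (2 * PI - x)) with (x + - (2 * INR 1 * PI)) by (simpl; ring).
  rewrite <- (cos_period _ 1); f_equal; ring.
assert (Hi : Re (/ arc t th x) <= t / rad ^ 2).
  rewrite Ex; unfold Re; simpl.
  replace (rad * cos x * (rad * cos x * 1) + rad * sin x * (rad * sin x * 1)) with (rad * (rad * 1)).
    apply Rmult_le_compat_r; [apply Rlt_le, Rinv_0_lt_compat; nra | assumption].
  generalize (sin2_cos2 x); unfold Rsqr; intros; nra.
assert (Hre : Re (arc t th x) <= t) by (rewrite Ex; exact Hc).
assert (A * Re (/ arc t th x) <= A * (t / rad ^ 2)) by (apply Rmult_le_compat_l; lra).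
assert (N * Re (arc t th x) <= N * t) by (apply Rmult_le_compat_l; lra).
unfold Rdiv in *; lra.
Qed.

End ResidueExp.

(** * The Bessel series and its Riccati equation *)

Definition Bes1 (x : R) : R := PSeries (PS_derive bescoef) x.
Definition Bes2 (x : R) : R := PSeries (PS_derive (PS_derive bescoef)) x.

Lemma bescoef1_radius : CV_radius (PS_derive bescoef) = p_infty.
Proof. rewrite CV_radius_derive; apply bescoef_radius. Qed.

Lemma is_derive_Bes (x : R) : is_derive Bes x (Bes1 x).
Proof. apply is_derive_PSeries; rewrite bescoef_radius; exact I. Qed.

Lemma is_derive_Bes1 (x : R) : is_derive Bes1 x (Bes2 x).
Proof. apply is_derive_PSeries; rewrite bescoef1_radius; exact I. Qed.

Lemma series_of_radius (a : nat -> R) (x : R) : CV_radius a = p_infty ->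
  is_series (fun j => a j * x ^ j) (PSeries a x).
Proof.
intros H; apply is_series_ext with (fun k => scal (pow_n x k) (a k)).
  intros n; rewrite pow_n_pow; apply Rmult_comm.
apply PSeries_correct, CV_radius_inside; rewrite H; exact I.
Qed.

Lemma Bes_ode (x : R) : x * Bes2 x + 2 * Bes1 x = Bes x.
Proof.
assert (R2 : CV_radius (PS_derive (PS_derive bescoef)) = p_infty)
  by (rewrite CV_radius_derive; apply bescoef1_radius).
assert (S1 := series_of_radius _ x bescoef1_radius).
assert (S2 := series_of_radius _ x R2).
apply is_series_unique in S1 as E1; apply is_series_unique in S2 as E2.
unfold Bes, PSeries.
(* The factor [x] shifts the series of [Bes2] by one place; the indicator masks the index 0, where
   the subtraction [j - 1] is truncated. *)
rewrite (Series_ext _ (fun j => x * (PS_derive (PS_derive bescoef) (j - 1)%nat * x ^ (j - 1)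
   * (if Nat.eqb j 0 then 0 else 1)) + 2 * (PS_derive bescoef j * x ^ j))).
2: { intros [|j]; unfold PS_derive.
    rewrite (bescoef_S 0); simpl; ring.
  replace (S j - 1)%nat with j by lia; simpl Nat.eqb; cbv iota.
  rewrite (bescoef_S (S j)), !S_INR; simpl pow; ring. }
assert (X2 : ex_series (fun j => PS_derive (PS_derive bescoef) (j - 1)%nat * x ^ (j - 1)
   * (if Nat.eqb j 0 then 0 else 1))).
  apply ex_series_incr_1; exists (PSeries (PS_derive (PS_derive bescoef)) x).
  apply is_series_ext with (2 := S2); intros n; replace (S n - 1)%nat with n by lia; simpl; ring.
rewrite Series_plus.
2: now apply ex_series_scal_R.
2: apply ex_series_scal_R; exists (PSeries (PS_derive bescoef) x); exact S1.
rewrite !Series_scal_l, E1; unfold Bes1 at 1.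
apply (f_equal (fun y => x * y + 2 * PSeries (PS_derive bescoef) x)).
rewrite Series_incr_1 by assumption; simpl Nat.eqb; cbv iota.
rewrite Rmult_0_r, Rplus_0_l; symmetry; unfold Bes2; rewrite <- E2; apply Series_ext.
intros n; replace (S n - 1)%nat with n by lia; ring.
Qed.

Lemma Series_ge_first (a : nat -> R) (l : R) : is_series a l -> (forall n, 0 <= a n) -> a O <= l.
Proof.
intros Ha Hp; rewrite <- (is_series_unique _ _ Ha).
generalize (rsn_le_Series a 1 Hp (ex_intro _ l Ha)); simpl; lra.
Qed.

Lemma Bes_ge_1 (x : R) : 0 <= x -> 1 <= Bes x.
Proof.
intros Hx; generalize (Series_ge_first _ _ (Bes_series x)).
unfold bescoef at 2; simpl; rewrite Rmult_1_r, Rmult_1_r, Rinv_1; intros H; apply H.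
intros n; apply Rmult_le_pos; [apply Rlt_le, bescoef_pos | now apply pow_le].
Qed.

(** Coefficientwise, because [(j + 1) c (j + 1) = c j / (j + 2)] for [c = bescoef]. *)
Lemma Bes1_bounds (x : R) : 0 <= x -> 0 < Bes1 x <= Bes x / 2.
Proof.
intros Hx; assert (S1 := series_of_radius _ x bescoef1_radius); fold (Bes1 x) in S1.
assert (Hc : forall n, 0 < PS_derive bescoef n <= bescoef n / 2).
  intros n; unfold PS_derive; rewrite (bescoef_S n); assert (P := bescoef_pos (S n)).
  assert (Q := INR_S_pos n); rewrite (S_INR (S n)).
  assert (1 <= INR (S n)) by (apply (le_INR 1); lia).
  assert (0 < INR (S n) * bescoef (S n)) by now apply Rmult_lt_0_compat.
  split; [assumption | nra].
split.
  apply Rlt_le_trans with (PS_derive bescoef 0 * x ^ 0).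
    simpl; rewrite Rmult_1_r; apply Hc.
  apply (Series_ge_first (fun j => PS_derive bescoef j * x ^ j)); [exact S1|].
  intros n; apply Rmult_le_pos; [apply Rlt_le, Hc | now apply pow_le].
rewrite <- (is_series_unique _ _ S1), <- (is_series_unique _ _ (Bes_series x)).
unfold Rdiv; rewrite <- Series_scal_r; apply Series_le.
  intros n; specialize (Hc n); assert (P := pow_le x n Hx); split; [apply Rmult_le_pos; lra | nra].
apply ex_series_ext with (fun n => / 2 * (bescoef n * x ^ n)); [intros; toR; ring|].
apply ex_series_scal_R; exists (Bes x); apply Bes_series.
Qed.

(** This is the bound [4 ^ m / (2 m)] from below for the central binomial coefficient of [2 m], with
    [m = j + 1]. *)
Lemma fact_central (j : nat) : 2 * 4 ^ j * (INR (fact j) * INR (fact (S j))) <= INR (fact (2 * j + 2)).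
Proof.
induction j as [|j IH]; [simpl; lra|].
replace (2 * S j + 2)%nat with (S (S (2 * j + 2))) by lia.
rewrite (INR_fact_S (S (2 * j + 2))), (INR_fact_S (2 * j + 2)), (INR_fact_S (S j)).
rewrite (INR_fact_S j) at 1.
rewrite !S_INR, plus_INR, mult_INR; change (INR 2) with 2.
set (f := INR (fact j)) in *; set (g := INR (fact (S j))) in *; set (h := INR (fact (2 * j + 2))) in *.
assert (Hj := pos_INR j); set (x := INR j) in *.
assert (Pf : 0 < f) by apply INR_fact_lt_0; assert (Pg : 0 < g) by apply INR_fact_lt_0.
assert (P4 : 0 < 4 ^ j) by (apply pow_lt; lra).
assert (E : 2 * 4 ^ S j * ((x + 1) * f * ((x + 1 + 1) * g)) =
  4 * (x + 1) * (x + 2) * (2 * 4 ^ j * (f * g))) by (simpl; ring).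
rewrite E.
assert (0 < 2 * 4 ^ j * (f * g)) by (repeat apply Rmult_lt_0_compat; lra).
apply Rle_trans with (4 * (x + 1) * (x + 2) * h).
  apply Rmult_le_compat_l; [nra | assumption].
assert (0 < h) by lra; nra.
Qed.

(** For [y = 2 sqrt x], the even series [e ^ y + e ^ (- y) - 2], with terms
    [2 y ^ (2 j + 2) / (2 j + 2)!], is dominated term by term by [4 x Bes x]. *)
Lemma Bes_lower (x : R) : 0 < x -> exp (2 * sqrt x) - 2 <= 4 * x * Bes x.
Proof.
intros Hx; set (y := 2 * sqrt x).
assert (Hy : y ^ 2 = 4 * x) by (unfold y; replace ((2 * sqrt x) ^ 2) with (4 * (sqrt x * sqrt x)) by ring; rewrite sqrt_sqrt; lra).
assert (Se : forall z, is_series (fun n => z ^ n / INR (fact n)) (exp z)).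
  intros z; apply is_series_ext with (fun k => scal (pow_n z k) (/ INR (fact k))).
    intros n; rewrite pow_n_pow; reflexivity.
  apply is_exp_Reals.
pose (s n := (y ^ n + (- y) ^ n) / INR (fact n)).
assert (Ss : is_series s (exp y + exp (- y))).
  apply is_series_ext with (fun n => y ^ n / INR (fact n) + (- y) ^ n / INR (fact n)).
    intros n; toR; unfold s, Rdiv; ring.
  apply (is_series_plus (V := R_NormedModule)); apply Se.
assert (Part : forall J, rsn s (2 * J + 2) <= 2 + 4 * x * rsn (fun j => bescoef j * x ^ j) J).
  induction J as [|J IH].
    simpl; unfold s; simpl; unfold Rdiv; rewrite Rinv_1; lra.
  replace (2 * S J + 2)%nat with (S (S (2 * J + 2))) by lia; simpl rsn.
  assert (E1 : s (S (2 * J + 2)) = 0).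
    unfold s; replace (S (2 * J + 2)) with (S (2 * (J + 1))) by lia.
    rewrite <- !tech_pow_Rmult, !pow_mult; replace ((- y) ^ 2) with (y ^ 2) by ring.
    unfold Rdiv; ring.
  assert (E2 : s (2 * J + 2)%nat <= 4 * x * (bescoef J * x ^ J)).
    unfold s; replace ((- y) ^ (2 * J + 2)) with (y ^ (2 * J + 2))
      by (replace (2 * J + 2)%nat with (2 * (J + 1))%nat by lia; rewrite !pow_mult; f_equal; ring).
    replace (y ^ (2 * J + 2)) with (4 ^ J * (4 * x * x ^ J)).
    2: replace (2 * J + 2)%nat with (2 * (J + 1))%nat by lia; rewrite pow_mult, Hy, pow_add, Rpow_mult_distr; ring.
    assert (F := fact_central J); unfold bescoef.
    assert (Pf := INR_fact_lt_0 J); assert (Pg := INR_fact_lt_0 (S J)); assert (Ph := INR_fact_lt_0 (2 * J + 2)).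
    set (f := INR (fact J)) in *; set (g := INR (fact (S J))) in *; set (h := INR (fact (2 * J + 2))) in *.
    assert (P4 : 0 < 4 * x * x ^ J) by (apply Rmult_lt_0_compat; [lra | now apply pow_lt]).
    apply Rmult_le_reg_r with (h * (f * g)); [apply Rmult_lt_0_compat; nra|].
    replace ((4 ^ J * (4 * x * x ^ J) + 4 ^ J * (4 * x * x ^ J)) / h * (h * (f * g)))
      with ((4 * x * x ^ J) * (2 * 4 ^ J * (f * g))) by (field; lra).
    replace (4 * x * (/ (f * g) * x ^ J) * (h * (f * g))) with ((4 * x * x ^ J) * h) by (field; lra).
    apply Rmult_le_compat_l; lra.
  change (rsn s (2 * J + 2) + s (2 * J + 2)%nat + s (S (2 * J + 2)) <=
    2 + 4 * x * (rsn (fun j => bescoef j * x ^ j) J + bescoef J * x ^ J)).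
  lra.
apply le_epsilon; intros eps Heps.
destruct (is_series_rsn _ _ Ss eps Heps) as [J HJ].
specialize (HJ (2 * J + 2)%nat ltac:(lia)); apply Rabs_def2 in HJ.
assert (Hb : rsn (fun j => bescoef j * x ^ j) J <= Bes x).
  rewrite <- (is_series_unique _ _ (Bes_series x)); apply rsn_le_Series.
    intros n; apply Rmult_le_pos; [apply Rlt_le, bescoef_pos | apply pow_le; lra].
  exists (Bes x); apply Bes_series.
specialize (Part J); generalize (exp_pos (- y)); intros.
assert (4 * x * rsn (fun j => bescoef j * x ^ j) J <= 4 * x * Bes x) by (apply Rmult_le_compat_l; lra).
lra.
Qed.

(** * Barriers and the logarithmic derivative of the Bessel series *)

Lemma positive_barrier (f df : R -> R) (a : R) :
  (forall x, a <= x -> is_derive f x (df x)) -> 0 < f a ->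
  (forall x, a <= x -> f x = 0 -> 0 < df x) -> forall x, a <= x -> 0 < f x.
Proof.
intros Hd Ha H b Hb; apply Rnot_le_lt; intros Hfb.
assert (Hc : forall x, a <= x -> forall eps, 0 < eps -> exists d, 0 < d /\
   forall y, Rabs (y - x) < d -> Rabs (f y - f x) < eps).
  intros x Hx eps Heps.
  assert (C : continuous f x) by (apply (ex_derive_continuous (V := R_NormedModule)); exists (df x); auto).
  apply continuity_pt_filterlim in C.
  destruct (C eps Heps) as [d [Hd0 HdC]]; exists d; split; [exact Hd0|].
  intros y Hy; destruct (Req_dec y x) as [->|Hyx].
    rewrite Rminus_diag, Rabs_R0; assumption.
  apply HdC; split; [split; [exact I | auto] | exact Hy].
(* The supremum [c] of [E] is the first possible loss of positivity. A negative [f c] contradicts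
   continuity, a zero contradicts the positive derivative, and a positive value would allow [E] to
   extend beyond [c]. *)
pose (E x := a <= x <= b /\ forall y, a <= y <= x -> 0 < f y).
destruct (completeness E) as [c [Hub Hlub]].
  exists b; intros x [[_ Hx] _]; exact Hx.
  exists a; split; [lra|]; intros y Hy; replace y with a by lra; assumption.
assert (Hac : a <= c) by (apply Hub; split; [lra|]; intros y Hy; replace y with a by lra; assumption).
assert (Hcb : c <= b) by (apply Hlub; intros x [[_ Hx] _]; exact Hx).
assert (Hleft : forall y, a <= y < c -> 0 < f y).
  intros y Hy; apply Rnot_le_lt; intros Hfy.
  assert (c <= y); [|lra].
  apply Hlub; intros x [Hx HxE]; apply Rnot_lt_le; intros Hyx.
  generalize (HxE y ltac:(lra)); lra.
destruct (Rtotal_order (f c) 0) as [Hn|[Hz|Hp]].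
- destruct (Hc c Hac (- f c) ltac:(lra)) as [d [Hd0 HdC]].
  assert (Hac' : a < c) by (destruct Hac as [?|Hac]; [assumption | rewrite <- Hac in Hn; lra]).
  set (y := Rmax a (c - d / 2)).
  assert (Hy : a <= y < c /\ c - d / 2 <= y).
    unfold y; split; [split; [apply Rmax_l | apply Rmax_lub_lt; lra] | apply Rmax_r].
  specialize (HdC y ltac:(apply Rabs_def1; lra)); apply Rabs_def2 in HdC.
  generalize (Hleft y ltac:(lra)); lra.
- assert (Hac' : a < c) by (destruct Hac as [?|Hac]; [assumption | rewrite <- Hac in Hz; lra]).
  assert (Hdc := H c Hac Hz).
  assert (D := Hd c Hac); apply is_derive_Reals in D.
  destruct (D (df c) Hdc) as [[d Hd0] HdD]; simpl in HdD.
  set (e := Rmin (d / 2) (c - a)).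
  assert (He : 0 < e <= d / 2 /\ e <= c - a).
    unfold e; split; [split; [apply Rmin_pos; lra | apply Rmin_l] | apply Rmin_r].
  specialize (HdD (- e) ltac:(lra) ltac:(rewrite Rabs_Ropp, Rabs_pos_eq; lra)).
  apply Rabs_def2 in HdD.
  generalize (Hleft (c + - e) ltac:(lra)); rewrite Hz in HdD; intros Hf.
  assert (0 < f (c + - e) / e) by (apply Rdiv_lt_0_compat; lra).
  replace ((f (c + - e) - 0) / - e) with (- (f (c + - e) / e)) in HdD by (field; lra); lra.
- destruct (Hc c Hac (f c) Hp) as [d [Hd0 HdC]].
  assert (Hcb' : c < b) by (destruct Hcb as [?|Hcb]; [assumption | rewrite Hcb in Hp; lra]).
  set (x := Rmin b (c + d / 2)).
  assert (Hx : c < x <= b /\ x <= c + d / 2).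
    unfold x; split; [split; [apply Rmin_glb_lt; lra | apply Rmin_l] | apply Rmin_r].
  assert (x <= c); [|lra].
  apply Hub; split; [lra|]; intros y Hy.
  destruct (Rlt_le_dec y c); [apply Hleft; lra|].
  specialize (HdC y ltac:(apply Rabs_def1; lra)); apply Rabs_def2 in HdC; lra.
Qed.

Definition vlog (x : R) : R := Bes1 x / Bes x.
(** The right-hand side of the Riccati equation of [vlog], obtained by eliminating [Bes2]; [vlog2]
    is its derivative, with [vlog1] in place of the derivative of [vlog]. *)
Definition vlog1 (x : R) : R := / x - 2 * vlog x / x - vlog x ^ 2.
Definition vlog2 (x : R) : R :=
  - / x ^ 2 + 2 * vlog x / x ^ 2 - 2 * (/ x + vlog x) * vlog1 x.

Lemma is_derive_vlog (x : R) : 0 < x -> is_derive vlog x (vlog1 x).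
Proof.
intros Hx; assert (Hb := Bes_ge_1 x ltac:(lra)).
unfold vlog at 1; eapply is_derive_eq.
  apply is_derive_div; [apply is_derive_Bes1 | apply is_derive_Bes | lra].
assert (E := Bes_ode x).
replace (Bes2 x) with ((Bes x - 2 * Bes1 x) / x) by (rewrite <- E at 1; field; lra).
unfold vlog1, vlog; field; lra.
Qed.

Lemma is_derive_vlog1 (x : R) : 0 < x -> is_derive vlog1 x (vlog2 x).
Proof.
intros Hx; assert (D := is_derive_vlog x Hx).
eapply is_derive_eq.
  unfold vlog1 at 1.
  apply (is_derive_minus (V := R_NormedModule) (fun x => / x - 2 * vlog x / x) (fun x => vlog x ^ 2)).
    apply (is_derive_minus (V := R_NormedModule) (fun x => / x) (fun x => 2 * vlog x / x)).
      apply (is_derive_inv (fun x => x)); [apply (is_derive_id (K := R_AbsRing)) | lra].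
    apply (is_derive_div (fun x => 2 * vlog x) (fun x => x)).
      apply (is_derive_scal vlog), D.
      apply (is_derive_id (K := R_AbsRing)).
      lra.
  apply (is_derive_pow vlog 2), D.
unfold vlog2, minus, plus, opp, one; simpl; field; lra.
Qed.

(* For [s = 1 / sqrt x] the logarithmic derivative of [Bes] is
   [s - 3/4 s^2 + 3/32 s^3 + O(s^4)]; [d = 2] and [d = - 2] give upper and lower
   barriers for the Riccati equation. *)
Definition bpoly (d s : R) : R := s - 3 / 4 * s ^ 2 + 3 / 32 * s ^ 3 + d * s ^ 4.

Lemma is_derive_inv_sqrt (x : R) : 0 < x ->
  is_derive (fun y => / sqrt y) x (- (/ sqrt x) ^ 3 / 2).
Proof.
intros Hx; assert (Hs := sqrt_lt_R0 x Hx); auto_derive; [split; [assumption | lra]|].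
field; lra.
Qed.

Lemma is_derive_bpoly (d x : R) : 0 < x ->
  is_derive (fun y => bpoly d (/ sqrt y)) x
    ((1 - 3 / 2 * / sqrt x + 9 / 32 * (/ sqrt x) ^ 2 + 4 * d * (/ sqrt x) ^ 3) * (- (/ sqrt x) ^ 3 / 2)).
Proof.
intros Hx; eapply is_derive_eq.
  apply (is_derive_comp (bpoly d) (fun y => / sqrt y)); [|now apply is_derive_inv_sqrt].
  unfold bpoly; auto_derive; [auto | reflexivity].
unfold scal; simpl; unfold mult; simpl; field.
generalize (sqrt_lt_R0 x Hx); lra.
Qed.

(** At [x = 9 / 4], that is [s = 2 / 3], the terms [d s ^ 4] are still so large that the crude
    bounds [0 < vlog <= 1 / 2] place [vlog] between the barriers. Along a barrier, the Riccati
    right-hand side minus the slope of the barrier is [s ^ 5 (3 / 32 - 2 d + ...)], positive for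
    [d = - 2] and negative for [d = 2]. *)
Lemma vlog_bounds (x : R) : 9 / 4 <= x ->
  bpoly (- 2) (/ sqrt x) < vlog x < bpoly 2 (/ sqrt x).
Proof.
assert (Hs94 : sqrt (9 / 4) = 3 / 2).
  replace (9 / 4) with (Rsqr (3 / 2)) by (unfold Rsqr; field); apply sqrt_Rsqr; lra.
assert (Hv : forall y, 0 <= y -> 0 < vlog y <= 1 / 2).
  intros y Hy; generalize (Bes1_bounds y Hy) (Bes_ge_1 y Hy); intros; unfold vlog; split.
    apply Rdiv_lt_0_compat; lra.
  apply Rmult_le_reg_r with (Bes y); [lra|]; unfold Rdiv; rewrite Rmult_assoc, Rinv_l; lra.
assert (Ht : forall y, 9 / 4 <= y -> 0 < / sqrt y <= 2 / 3 /\ / y = (/ sqrt y) ^ 2).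
  intros y Hy; assert (3 / 2 <= sqrt y) by (rewrite <- Hs94; apply sqrt_le_1; lra).
  split; [split; [apply Rinv_0_lt_compat; lra|]|].
    replace (2 / 3) with (/ (3 / 2)) by field; apply Rinv_le_contravar; lra.
  rewrite <- (sqrt_sqrt y) at 1 by lra; field; lra.
intros Hx; split.
- apply Rminus_gt_0_lt.
  apply (positive_barrier (fun y => vlog y - bpoly (-2) (/ sqrt y)) _ (9 / 4)
    (fun y Hy => is_derive_minus (V := R_NormedModule) _ _ y _ _
       (is_derive_vlog y ltac:(lra)) (is_derive_bpoly (-2) y ltac:(lra)))); [| |assumption].
    rewrite Hs94; generalize (Hv (9 / 4) ltac:(lra)); unfold bpoly; lra.
  intros y Hy Hz; destruct (Ht y Hy) as [Hs Ei].
  set (s := / sqrt y) in *.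
  assert (Ev : vlog1 y = s ^ 2 - 2 * bpoly (-2) s * s ^ 2 - bpoly (-2) s ^ 2).
    unfold vlog1, Rdiv; rewrite Ei; replace (vlog y) with (bpoly (-2) s) by lra; ring.
  change (0 < vlog1 y - (1 - 3 / 2 * s + 9 / 32 * s ^ 2 + 4 * (-2) * s ^ 3) * (- s ^ 3 / 2)).
  rewrite Ev; unfold bpoly.
  match goal with |- 0 < ?e => replace e with
    (s ^ 5 * (131 / 32 - (3 + 9 / 1024) * s + 3 / 8 * s ^ 2 - 4 * s ^ 3)) by field end.
  apply Rmult_lt_0_compat; [apply pow_lt; lra|].
  assert (s ^ 3 <= 8 / 27) by (apply Rle_trans with ((2 / 3) ^ 3); [apply pow_incr; lra | simpl; lra]).
  assert (0 <= s ^ 2) by apply pow2_ge_0; lra.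
- apply Rminus_gt_0_lt.
  apply (positive_barrier (fun y => bpoly 2 (/ sqrt y) - vlog y) _ (9 / 4)
    (fun y Hy => is_derive_minus (V := R_NormedModule) _ _ y _ _
       (is_derive_bpoly 2 y ltac:(lra)) (is_derive_vlog y ltac:(lra)))); [| |assumption].
    rewrite Hs94; generalize (Hv (9 / 4) ltac:(lra)); unfold bpoly; lra.
  intros y Hy Hz; destruct (Ht y Hy) as [Hs Ei].
  set (s := / sqrt y) in *.
  assert (Ev : vlog1 y = s ^ 2 - 2 * bpoly 2 s * s ^ 2 - bpoly 2 s ^ 2).
    unfold vlog1, Rdiv; rewrite Ei; replace (vlog y) with (bpoly 2 s) by lra; ring.
  change (0 < (1 - 3 / 2 * s + 9 / 32 * s ^ 2 + 4 * 2 * s ^ 3) * (- s ^ 3 / 2) - vlog1 y).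
  rewrite Ev; unfold bpoly.
  match goal with |- 0 < ?e => replace e with
    (s ^ 5 * (125 / 32 - (3 - 9 / 1024) * s + 3 / 8 * s ^ 2 + 4 * s ^ 3)) by field end.
  apply Rmult_lt_0_compat; [apply pow_lt; lra|].
  assert (0 <= s ^ 3) by (apply pow_le; lra).
  assert (0 <= s ^ 2) by apply pow2_ge_0; lra.
Qed.

Lemma inv_sqrt_small (x : R) : 1600 <= x -> 0 < / sqrt x <= / 40 /\ / x = (/ sqrt x) ^ 2.
Proof.
intros Hx; assert (H : 40 <= sqrt x).
  rewrite <- (sqrt_Rsqr 40) by lra; apply sqrt_le_1; unfold Rsqr; lra.
split; [split; [apply Rinv_0_lt_compat; lra | apply Rinv_le_contravar; lra]|].
rewrite <- (sqrt_sqrt x) at 1 by lra; field; lra.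
Qed.

(** With [vlog = s - 3/4 s ^ 2 + h s ^ 3] all orders below [s ^ 5] cancel, and the leading
    coefficient [3 / 8 + 4 h] is close to [3 / 4] as [h] is near [3 / 32]. For [s <= 1 / 40] the
    value [1 / 2] absorbs the deviation of [h] and the higher orders. *)
Lemma vlog2_lower (x : R) : 1600 <= x -> (/ sqrt x) ^ 5 / 2 <= vlog2 x.
Proof.
intros Hx; destruct (inv_sqrt_small x Hx) as [Hs Ei].
destruct (vlog_bounds x ltac:(lra)) as [Hl Hu].
set (s := / sqrt x) in *.
assert (P3 : 0 < s ^ 3) by (apply pow_lt; lra).
set (h := (vlog x - s + 3 / 4 * s ^ 2) / s ^ 3).
assert (Ev : vlog x = s - 3 / 4 * s ^ 2 + h * s ^ 3) by (unfold h; field; lra).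
assert (Hh : 3 / 32 - 2 * s <= h <= 3 / 32 + 2 * s).
  unfold bpoly in Hl, Hu; rewrite Ev in Hl, Hu.
  split; apply Rmult_le_reg_r with (s ^ 3); try assumption; nra.
assert (E : vlog2 x = s ^ 5 * (3 / 8 + 4 * h + s * (- 63 / 32 + 3 * h) + s ^ 2 * (3 / 8 * h + 6 * h ^ 2)
    + 3 / 2 * h ^ 2 * s ^ 3 + 2 * h ^ 3 * s ^ 4)).
  unfold vlog2, vlog1, Rdiv.
  replace (/ x ^ 2) with (/ x * / x) by (field; lra); rewrite Ei, Ev; field.
rewrite E; unfold Rdiv at 1; apply Rmult_le_compat_l; [apply pow_le; lra|].
assert (0 <= h) by lra.
assert (0 <= s * (3 * h)) by (apply Rmult_le_pos; lra).
assert (0 <= s ^ 2 * (3 / 8 * h + 6 * h ^ 2)).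
  apply Rmult_le_pos; [apply pow2_ge_0|]; generalize (pow2_ge_0 h); lra.
assert (0 <= 3 / 2 * h ^ 2 * s ^ 3) by (generalize (pow2_ge_0 h); intros; apply Rmult_le_pos; lra).
assert (0 <= 2 * h ^ 3 * s ^ 4).
  apply Rmult_le_pos; [|apply pow_le; lra]; generalize (pow_le h 3 ltac:(assumption)); lra.
lra.
Qed.

(** * Convexity of the ratio of Bessel values *)

(** The ratio of consecutive main terms: the argument [A N] grows by [A] when [n] grows by 1. *)
Definition rho (A x : R) : R := Bes (x + A) / Bes x.

Lemma is_derive_shift (f : R -> R) (A x d : R) : is_derive f (x + A) d ->
  is_derive (fun y => f (y + A)) x d.
Proof.
intros H; eapply is_derive_eq.
  apply (is_derive_comp f (fun y => y + A)); [exact H|].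
  apply (is_derive_plus (V := R_NormedModule)); [apply (is_derive_id (K := R_AbsRing))|].
  apply (is_derive_const (K := R_AbsRing) (V := R_NormedModule)).
unfold scal, plus, one, zero; simpl; unfold mult; simpl; ring.
Qed.

Lemma is_derive_rho (A x : R) : 0 < A -> 0 < x ->
  is_derive (rho A) x (rho A x * (vlog (x + A) - vlog x)).
Proof.
intros HA Hx; assert (H1 := Bes_ge_1 x ltac:(lra)); assert (H2 := Bes_ge_1 (x + A) ltac:(lra)).
eapply is_derive_eq.
  unfold rho at 1; apply is_derive_div; [apply is_derive_shift, is_derive_Bes | apply is_derive_Bes | lra].
unfold rho, vlog; field; lra.
Qed.

Lemma is_derive_rho1 (A x : R) : 0 < A -> 0 < x ->
  is_derive (fun y => rho A y * (vlog (y + A) - vlog y)) x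
    (rho A x * (vlog (x + A) - vlog x) ^ 2 + rho A x * (vlog1 (x + A) - vlog1 x)).
Proof.
intros HA Hx; eapply is_derive_eq.
  apply is_derive_Rmult; [now apply is_derive_rho|].
  apply (is_derive_minus (V := R_NormedModule)); [apply is_derive_shift|]; apply is_derive_vlog; lra.
unfold minus, plus, opp; simpl; ring.
Qed.

Lemma derive_growth (f df : R -> R) (m a b : R) : a <= b ->
  (forall x, a <= x <= b -> is_derive f x (df x)) -> (forall x, a <= x <= b -> m <= df x) ->
  m * (b - a) <= f b - f a.
Proof.
intros Hab Hd Hm.
enough (f a - m * a <= f b - m * b) by lra.
apply (nonneg_derive_le (fun x => f x - m * x) (fun x => df x - m)); auto.
  intros x Hx; apply (is_derive_minus (V := R_NormedModule)); [now apply Hd|].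
  eapply is_derive_eq; [apply (is_derive_scal (fun y => y)), (is_derive_id (K := R_AbsRing))|].
  apply Rmult_1_r.
intros x Hx; generalize (Hm x Hx); lra.
Qed.

(** About the midpoint [c = x + A], the function [f (c + h) + f (c - h) - m h ^ 2] of [h] is
    increasing. *)
Lemma second_difference (f f1 f2 : R -> R) (m x A : R) : 0 <= A ->
  (forall y, x <= y <= x + 2 * A -> is_derive f y (f1 y)) ->
  (forall y, x <= y <= x + 2 * A -> is_derive f1 y (f2 y)) ->
  (forall y, x <= y <= x + 2 * A -> m <= f2 y) ->
  m * A ^ 2 <= f x - 2 * f (x + A) + f (x + 2 * A).
Proof.
intros HA H1 H2 Hm.
pose (g h := f ((x + A) + h) + f ((x + A) + - h) - m * h ^ 2).
assert (G : g 0 <= g A).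
  apply (nonneg_derive_le g (fun h => f1 ((x + A) + h) - f1 ((x + A) + - h) - m * (2 * h))); [assumption | |].
    intros h Hh; unfold g; eapply is_derive_eq.
      apply (is_derive_minus (V := R_NormedModule) (fun h => f ((x + A) + h) + f ((x + A) + - h)) (fun h => m * h ^ 2)).
        apply (is_derive_plus (V := R_NormedModule) (fun h => f ((x + A) + h)) (fun h => f ((x + A) + - h))).
          apply (is_derive_comp f (fun h => x + A + h)); [apply H1; lra|].
          apply (is_derive_plus (V := R_NormedModule) (fun _ => x + A) (fun h => h)).
            apply (is_derive_const (K := R_AbsRing) (V := R_NormedModule)).
          apply (is_derive_id (K := R_AbsRing)).
        apply (is_derive_comp f (fun h => x + A + - h)); [apply H1; lra|].
        apply (is_derive_plus (V := R_NormedModule) (fun _ => x + A) (fun h => - h)).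
          apply (is_derive_const (K := R_AbsRing) (V := R_NormedModule)).
        apply (is_derive_opp (V := R_NormedModule) (fun h => h)), (is_derive_id (K := R_AbsRing)).
      apply (is_derive_scal (fun h => h ^ 2)), (is_derive_pow (fun h => h) 2), (is_derive_id (K := R_AbsRing)).
    unfold minus, scal, plus, opp, one, zero; simpl; unfold mult; simpl; ring.
  intros h Hh.
  generalize (derive_growth f1 f2 m (x + A + - h) (x + A + h) ltac:(lra)
    (fun y Hy => H2 y ltac:(lra)) (fun y Hy => Hm y ltac:(lra))); lra.
unfold g in G; rewrite Ropp_0, !Rplus_0_r in G.
replace (x + A + A) with (x + 2 * A) in G by ring.
replace (x + A + - A) with x in G by ring; lra.
Qed.

Lemma Bes_mono (x y : R) : 0 <= x <= y -> Bes x <= Bes y.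
Proof.
intros H; apply (nonneg_derive_le Bes Bes1); [lra | intros; apply is_derive_Bes|].
intros z Hz; generalize (Bes1_bounds z ltac:(lra)); lra.
Qed.

Lemma rho_ge_1 (A x : R) : 0 < A -> 0 <= x -> 1 <= rho A x.
Proof.
intros HA Hx; assert (H1 := Bes_ge_1 x Hx); unfold rho.
apply Rmult_le_reg_r with (Bes x); [lra|].
unfold Rdiv; rewrite Rmult_assoc, Rinv_l, Rmult_1_l, Rmult_1_r by lra; apply Bes_mono; lra.
Qed.

(** Since [vlog <= 1 / 20], the function [Bes y e ^ (- y / 20)] decreases, and
    [e ^ (- A / 20) >= 9 / 10]. *)
Lemma rho_upper (A x : R) : 0 < A <= 2 -> 1600 <= x -> rho A x <= 10 / 9.
Proof.
intros HA Hx; assert (H1 := Bes_ge_1 x ltac:(lra)).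
assert (G : Bes (x + A) * exp (- ((x + A) / 20)) <= Bes x * exp (- (x / 20))).
  enough (- (Bes x * exp (- (x / 20))) <= - (Bes (x + A) * exp (- ((x + A) / 20)))) by lra.
  apply (nonneg_derive_le (fun y => - (Bes y * exp (- (y / 20))))
    (fun y => Bes y * (/ 20 - vlog y) * exp (- (y / 20)))); [lra | |].
    intros y Hy; assert (H2 := Bes_ge_1 y ltac:(lra)); eapply is_derive_eq.
      apply (is_derive_opp (V := R_NormedModule)), is_derive_Rmult; [apply is_derive_Bes|].
      apply (is_derive_comp exp (fun y => - (y / 20))); [apply is_derive_exp|].
      apply (is_derive_opp (V := R_NormedModule)).
      apply (is_derive_ext (fun y => / 20 * y)); [intros; toR; field|].
      apply (is_derive_scal (fun y => y)), (is_derive_id (K := R_AbsRing)).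
    unfold opp, scal, one, vlog; simpl; unfold mult; simpl; field; lra.
  intros y Hy; assert (H2 := Bes_ge_1 y ltac:(lra)).
  destruct (inv_sqrt_small y ltac:(lra)) as [Hs _]; destruct (vlog_bounds y ltac:(lra)) as [_ Hv].
  apply Rmult_le_pos; [|apply Rlt_le, exp_pos]; apply Rmult_le_pos; [lra|].
  unfold bpoly in Hv; set (s := / sqrt y) in *.
  assert (0 <= s ^ 2) by apply pow2_ge_0.
  assert (s ^ 3 <= s) by (assert (s ^ 2 <= 1) by nra; replace (s ^ 3) with (s * s ^ 2) by ring; nra).
  assert (s ^ 4 <= / 40 * s ^ 3).
    replace (s ^ 4) with (s * s ^ 3) by ring; apply Rmult_le_compat_r; [apply pow_le|]; lra.
  lra.
assert (Ep := exp_pos (- (x / 20))).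
replace (- ((x + A) / 20)) with (- (x / 20) + - (A / 20)) in G by field.
rewrite exp_plus in G.
assert (L : 9 / 10 <= exp (- (A / 20))) by (generalize (exp_ineq1_le (- (A / 20))); lra).
assert (G2 : Bes (x + A) * exp (- (A / 20)) <= Bes x).
  apply Rmult_le_reg_l with (exp (- (x / 20))); [assumption | lra].
assert (P := Bes_ge_1 (x + A) ltac:(lra)).
assert (Bes (x + A) * (9 / 10) <= Bes x).
  apply Rle_trans with (2 := G2), Rmult_le_compat_l; lra.
unfold rho; apply Rmult_le_reg_r with (Bes x); [lra|].
unfold Rdiv at 1; rewrite Rmult_assoc, Rinv_l, Rmult_1_r by lra; lra.
Qed.

(** The second derivative of [rho] is [rho] times [D ^ 2 + D1], where [D] and [D1] are the
    increments of [vlog] and [vlog1] over a step [A]. As [rho >= 1], it is at least [D1], hence at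
    least [A] times the least value of [vlog2]; all arguments stay below [x + 3 A]. *)
Lemma rho_convex (A x : R) : 0 < A -> 1600 <= x ->
  A ^ 3 / 2 * (/ sqrt (x + 3 * A)) ^ 5 <= rho A x - 2 * rho A (x + A) + rho A (x + 2 * A).
Proof.
intros HA Hx; set (m := (/ sqrt (x + 3 * A)) ^ 5 / 2).
replace (A ^ 3 / 2 * (/ sqrt (x + 3 * A)) ^ 5) with ((A * m) * A ^ 2) by (unfold m; field; generalize (sqrt_lt_R0 (x + 3 * A) ltac:(lra)); lra).
apply (second_difference (rho A) (fun y => rho A y * (vlog (y + A) - vlog y))
  (fun y => rho A y * (vlog (y + A) - vlog y) ^ 2 + rho A y * (vlog1 (y + A) - vlog1 y))).
- lra.
- intros y Hy; apply is_derive_rho; lra.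
- intros y Hy; apply is_derive_rho1; lra.
- intros y Hy.
  assert (G : m * (y + A - y) <= vlog1 (y + A) - vlog1 y).
    apply (derive_growth vlog1 vlog2); [lra | intros z Hz; apply is_derive_vlog1; lra |].
    intros z Hz; eapply Rle_trans; [|apply vlog2_lower; lra].
    unfold m; apply Rmult_le_compat_r; [lra|].
    apply pow_incr; split; [apply Rlt_le, Rinv_0_lt_compat, sqrt_lt_R0; lra|].
    apply Rinv_le_contravar; [apply sqrt_lt_R0; lra | apply sqrt_le_1; lra].
  assert (R1 := rho_ge_1 A y HA ltac:(lra)).
  assert (0 <= m).
    unfold m; apply Rmult_le_pos; [|lra]; apply pow_le, Rlt_le, Rinv_0_lt_compat, sqrt_lt_R0; lra.
  assert (0 <= rho A y * (vlog (y + A) - vlog y) ^ 2) by (apply Rmult_le_pos; [lra | apply pow2_ge_0]).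
  assert (A * m <= vlog1 (y + A) - vlog1 y) by lra.
  assert (0 <= A * m) by (apply Rmult_le_pos; lra).
  assert (1 * (A * m) <= rho A y * (vlog1 (y + A) - vlog1 y)) by (apply Rmult_le_compat; lra).
  lra.
Qed.

(** * Numerical bounds and the loss on the minor arc *)

Lemma Z2_bounds : 164 / 100 <= Z2 <= 165 / 100.
Proof.
pose (a n := / INR (S n) ^ 2).
assert (Pa : forall n, 0 <= a n) by (intros n; apply Rlt_le, Rinv_0_lt_compat, pow_lt, INR_S_pos).
assert (HS := ex_series_inv_sqr).
assert (H10 : rsn a 10 = 1968329 / 1270080) by (unfold a; simpl; field).
assert (Hx : forall m, INR (S (10 + m)) = INR m + 11).
  intros m; rewrite S_INR, plus_INR; simpl; ring.
(* Beyond ten terms, [1 / (m + 11) ^ 2] lies between the telescoping terms [1 / ((m + 11) (m + 12))]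
   and [1 / ((m + 21/2) (m + 23/2))]. *)
assert (U : forall m, rsn a (10 + m) + / (INR m + 21 / 2) <= rsn a 10 + / (21 / 2)).
  induction m as [|m IH]; [simpl INR; rewrite Nat.add_0_r, Rplus_0_l; lra|].
  rewrite Nat.add_succ_r; simpl rsn; rewrite S_INR; assert (Hm := pos_INR m).
  assert (a (10 + m)%nat <= / (INR m + 21 / 2) - / (INR m + 1 + 21 / 2)); [|simpl in *; lra].
  unfold a; rewrite Hx; set (x := INR m) in *.
  replace (/ (x + 21 / 2) - / (x + 1 + 21 / 2)) with (/ ((x + 21 / 2) * (x + 1 + 21 / 2))) by (field; lra).
  apply Rinv_le_contravar; nra.
assert (L : forall m, rsn a 10 + / 11 <= rsn a (10 + m) + / (INR m + 11)).
  induction m as [|m IH]; [simpl INR; rewrite Nat.add_0_r, Rplus_0_l; lra|].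
  rewrite Nat.add_succ_r; simpl rsn; rewrite S_INR; assert (Hm := pos_INR m).
  assert (/ (INR m + 11) - / (INR m + 1 + 11) <= a (10 + m)%nat); [|simpl in *; lra].
  unfold a; rewrite Hx; set (x := INR m) in *.
  replace (/ (x + 11) - / (x + 1 + 11)) with (/ ((x + 11) * (x + 1 + 11))) by (field; lra).
  apply Rinv_le_contravar; nra.
split.
  apply le_epsilon; intros eps Heps.
  destruct (INR_unbounded (/ eps)) as [m Hm].
  generalize (L m) (rsn_le_Series a (10 + m) Pa HS); fold Z2.
  assert (/ (INR m + 11) <= eps).
    rewrite <- (Rinv_inv eps); apply Rinv_le_contravar; [now apply Rinv_0_lt_compat | lra].
  change (Series a) with Z2; lra.
apply le_epsilon; intros eps Heps.
destruct (is_series_rsn a Z2 (Series_correct _ HS) eps Heps) as [n Hn].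
specialize (Hn (10 + n)%nat ltac:(lia)); apply Rabs_def2 in Hn.
assert (0 < / (INR n + 21 / 2)) by (apply Rinv_0_lt_compat; generalize (pos_INR n); lra).
specialize (U n); lra.
Qed.

Lemma pf_RtoC (w : R) (n : nat) : 0 < w ->
  Re (pf (RtoC w) n) = 2 * w / (w * w + (2 * PI * INR (S n)) ^ 2).
Proof.
intros Hw; unfold pf.
rewrite <- !RtoC_mult, <- RtoC_plus, <- RtoC_inv, <- !RtoC_mult; [reflexivity|].
generalize (pow2_ge_0 (2 * PI * INR (S n))); nra.
Qed.

(** The partial fractions other than [1 / w] are nonnegative, and since [pi > 3] they sum to at most
    [zeta (2) w / 18]. *)
Lemma bose_real_bounds (w : R) : 0 < w ->
  / w - / 2 <= Re (bose (RtoC w)) <= / w - / 2 + w / 10.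
Proof.
intros Hw; assert (H := hcoth_pf (RtoC w) Hw); unfold hcoth in H.
assert (E : Re (bose (RtoC w)) = / w - / 2 + Series (fun n => Re (pf (RtoC w) n))).
  assert (Hb : bose (RtoC w) = (RtoC (/ w) + csum (pf (RtoC w)) - RtoC (/ 2))%C).
    rewrite !RtoC_inv, <- H by lra; ring.
  rewrite Hb; change (/ w + Re (csum (pf (RtoC w))) - / 2 = / w - / 2 + Re (csum (pf (RtoC w)))); ring.
assert (HP : 3 < PI) by (generalize PI2_3_2; lra).
assert (HZ := Z2_bounds).
pose (u n := w / 18 * / INR (S n) ^ 2).
assert (Eu : ex_series u) by apply ex_series_scal_R, ex_series_inv_sqr.
assert (B : forall n, 0 <= Re (pf (RtoC w) n) <= u n).
  intros n; rewrite pf_RtoC by assumption; unfold u.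
  assert (P := INR_S_pos n); set (x := INR (S n)) in *.
  assert (9 <= PI ^ 2) by nra; assert (Px : 0 < x ^ 2) by now apply pow_lt.
  assert (L : 36 * x ^ 2 <= w * w + (2 * PI * x) ^ 2).
    replace ((2 * PI * x) ^ 2) with (4 * PI ^ 2 * x ^ 2) by ring; nra.
  split; [apply Rlt_le, Rdiv_lt_0_compat; lra|].
  apply Rle_trans with (2 * w * / (36 * x ^ 2)).
    apply Rmult_le_compat_l; [lra|]; apply Rinv_le_contravar; lra.
  apply Req_le; field; lra.
assert (B1 : 0 <= Series (fun n => Re (pf (RtoC w) n))).
  apply (rsn_le_Series (fun n => Re (pf (RtoC w) n)) 0); [apply B|].
  now apply (ex_series_Rabs_le _ u); [intros n; rewrite Rabs_pos_eq; apply B|].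
assert (B2 : Series (fun n => Re (pf (RtoC w) n)) <= Series u) by now apply Series_le.
unfold u in B2; rewrite Series_scal_l in B2; fold Z2 in B2.
rewrite E; nra.
Qed.

Lemma Re_bose (w : C) : 0 < Re w -> Re (bose w) + / 2 =
  (exp (Re w) ^ 2 - 1) / (2 * ((exp (Re w) - 1) ^ 2 + 2 * exp (Re w) * (1 - cos (Im w)))).
Proof.
intros Hw; unfold bose.
assert (E1 : 1 < exp (Re w)) by (generalize (exp_ineq1 (Re w)); lra).
assert (Hc : cos (Im w) <= 1) by apply COS_bound.
unfold cexp; set (e := exp (Re w)) in *; set (c := cos (Im w)) in *; set (s := sin (Im w)).
assert (Hsc : s * s + c * c = 1) by (generalize (sin2_cos2 (Im w)); unfold Rsqr; fold s c; lra).
unfold Re; simpl.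
assert (Ed : (e * c - 1) * ((e * c - 1) * 1) + (e * s - 0) * ((e * s - 0) * 1) =
  (e - 1) ^ 2 + 2 * e * (1 - c)).
  replace ((e * c - 1) * ((e * c - 1) * 1) + (e * s - 0) * ((e * s - 0) * 1)) with
    (e * e * (s * s + c * c) - 2 * e * c + 1) by ring.
  rewrite Hsc; ring.
assert (Ed2 : (e * c + - (1)) * ((e * c + - (1)) * 1) + (e * s + - 0) * ((e * s + - 0) * 1) =
  (e - 1) ^ 2 + 2 * e * (1 - c)) by (rewrite <- Ed; ring).
rewrite Ed2.
assert (0 < (e - 1) ^ 2 + 2 * e * (1 - c)).
  assert (0 < (e - 1) ^ 2) by (apply pow_lt; lra); assert (0 <= 2 * e * (1 - c)) by nra; lra.
simpl in *; field; simpl in *; lra.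
Qed.

Lemma Re_bose_lower (w : C) : 0 < Re w -> - / 2 <= Re (bose w).
Proof.
intros Hw; assert (H := Re_bose w Hw).
assert (E1 : 1 < exp (Re w)) by (generalize (exp_ineq1 (Re w)); lra).
assert (Hc : cos (Im w) <= 1) by apply COS_bound.
set (e := exp (Re w)) in *; set (c := cos (Im w)) in *.
assert (0 < (e - 1) ^ 2 + 2 * e * (1 - c)).
  assert (0 < (e - 1) ^ 2) by (apply pow_lt; lra); assert (0 <= 2 * e * (1 - c)) by nra; lra.
assert (0 < (e ^ 2 - 1) / (2 * ((e - 1) ^ 2 + 2 * e * (1 - c)))) by (apply Rdiv_lt_0_compat; nra).
lra.
Qed.

Lemma exp_upper (x : R) : 0 <= x < 1 -> exp x <= / (1 - x).
Proof.
intros Hx; rewrite <- (Ropp_involutive x) at 1; rewrite exp_Ropp.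
apply Rinv_le_contravar; [lra|]; generalize (exp_ineq1_le (- x)); lra.
Qed.

Lemma cos_upper (x : R) : 0 <= x <= 1 -> cos x <= 1 - x ^ 2 / 2 + x ^ 4 / 24.
Proof.
intros Hx; assert (HP : 3 < PI) by (generalize PI2_3_2; lra).
destruct (cos_bound x 0) as [_ U]; [lra | lra|].
eapply Rle_trans; [exact U|]; unfold cos_approx, cos_term; simpl; lra.
Qed.

(* The bound [6 / 5] is what remains of the pole of [bose] at distance [sqrt t] from it. *)
Lemma Re_bose_minor (t theta : R) : 0 < t <= / 25 -> sqrt (t - t ^ 2) <= Rabs theta <= PI ->
  Re (bose (t, theta)) + / 2 <= 6 / 5.
Proof.
intros Ht Hth; rewrite Re_bose by (simpl; lra); unfold Re, Im; simpl fst; simpl snd.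
assert (HP : 3 < PI) by (generalize PI2_3_2; lra).
set (th := sqrt (t - t ^ 2)) in *.
assert (Hsq : th ^ 2 = t - t ^ 2) by (unfold th; rewrite <- Rsqr_pow2, Rsqr_sqrt; nra).
assert (Hth0 : 0 <= th) by apply sqrt_pos.
assert (Hth1 : th <= 1) by nra.
assert (C1 : cos theta <= cos th).
  assert (E : cos theta = cos (Rabs theta)).
    unfold Rabs; destruct (Rcase_abs theta); [now rewrite cos_neg | reflexivity].
  rewrite E; apply cos_decr_1; lra.
assert (C2 := cos_upper th (conj Hth0 Hth1)).
assert (H4 : th ^ 4 = (t - t ^ 2) * (t - t ^ 2)) by (rewrite <- Hsq; ring).
rewrite Hsq, H4 in C2.
assert (E1 := exp_ineq1_le t).
assert (E2 : exp t <= / (1 - t)) by (apply exp_upper; lra).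
assert (E2' : exp t * (1 - t) <= 1).
  apply Rle_trans with (/ (1 - t) * (1 - t)); [apply Rmult_le_compat_r; lra | rewrite Rinv_l; lra].
set (e := exp t) in *; set (c := cos theta) in *.
assert (E3 : e <= 1 + 26 / 25 * t + / 600 * t) by nra.
assert (D1 : t ^ 2 <= (e - 1) ^ 2) by (apply pow_incr; lra).
assert (K : t - t ^ 2 - (t - t ^ 2) * (t - t ^ 2) / 12 <= 2 * (1 - c)) by lra.
assert (K0 : 0 <= 1 - c) by (generalize (COS_bound theta); fold c; lra).
assert (D2 : t - t ^ 2 - (t - t ^ 2) * (t - t ^ 2) / 12 <= 2 * e * (1 - c)) by nra.
assert (D : 299 / 300 * t <= (e - 1) ^ 2 + 2 * e * (1 - c)) by nra.
assert (N : e ^ 2 - 1 <= 2 * (118 / 100) * t) by nra.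
apply Rmult_le_reg_r with (2 * ((e - 1) ^ 2 + 2 * e * (1 - c))); [lra|].
unfold Rdiv at 1; rewrite Rmult_assoc, Rinv_l, Rmult_1_r by lra; lra.
Qed.

(** The term [j = k] alone would require an upper bound for [Re (bose (k z))], which may be close to
    a pole. Together with the term [j = 1], [bose (k z)] carries the coefficient [- (1 - 1 / k)], so
    the lower bound [- 1 / 2] suffices, as it does for [bose (k ^ 2 z)]. Only [bose z] is bounded
    above, by [6 / 5 - 1 / 2]; the term [k t / 5] collects the errors of the Bose values at real
    points. *)
Lemma saving (k : nat) (t theta : R) : (2 <= k <= 9)%nat -> 0 < t <= / 25 ->
  sqrt (t - t ^ 2) <= Rabs theta <= PI ->
  Re (Lam k (t, theta)) <= Re (Lam k (RtoC t))
    - (1 - / INR k) * (1 + / INR k ^ 2) / t + 6 / 5 + INR k * t / 5.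
Proof.
intros Hk Ht Hth; set (z := (t, theta) : C).
assert (Hz : Re z = t) by reflexivity.
assert (H := Re_Lam_le k z ltac:(lia) ltac:(rewrite Hz; lra)); rewrite Hz in H.
assert (K1 : 2 <= INR k) by (apply (le_INR 2); lia).
assert (K2 : INR k <= 9) by (replace 9 with (INR 9) by (simpl; lra); apply le_INR; lia).
assert (M := Re_bose_minor t theta Ht Hth); fold z in M.
set (x := INR k) in *.
unfold dbose in H; rewrite <- !RtoC_mult in H; fold x in H.
assert (Rkz : Re (RtoC x * z)%C = x * t) by apply re_scal_l.
assert (Rkkz : Re (RtoC x * (RtoC x * z))%C = x * (x * t)) by (rewrite re_scal_l, Rkz; reflexivity).
assert (P1 : 0 < x * t) by nra.
assert (P2 : 0 < x * (x * t)) by nra.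
assert (L1 := Re_bose_lower (RtoC x * z) ltac:(rewrite Rkz; assumption)).
assert (L2 := Re_bose_lower (RtoC x * (RtoC x * z)) ltac:(rewrite Rkkz; assumption)).
destruct (bose_real_bounds t ltac:(lra)) as [B1 _].
destruct (bose_real_bounds (x * t) P1) as [B2 B3].
destruct (bose_real_bounds (x * (x * t)) P2) as [_ B4].
assert (S : forall a b : C, Re (a - b)%C = Re a - Re b) by (intros; reflexivity).
rewrite !S in H.
set (b0 := Re (bose z)) in *; set (b1 := Re (bose (RtoC x * z))) in *;
set (b2 := Re (bose (RtoC x * (RtoC x * z)))) in *.
set (c0 := Re (bose (RtoC t))) in *; set (c1 := Re (bose (RtoC (x * t)))) in *;
set (c2 := Re (bose (RtoC (x * (x * t))))) in *.
assert (Hi : 0 < / x <= / 2) by (split; [apply Rinv_0_lt_compat; lra | apply Rinv_le_contravar; lra]).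
assert (Q1 : / x * (c1 - c2) >= / x * (/ (x * t) - / (x * (x * t)) - x * (x * t) / 10)).
  apply Rle_ge, Rmult_le_compat_l; lra.
assert (Q2 : (1 - / x) * (b1 + / 2) + / x * (b2 + / 2) >= 0).
  apply Rle_ge, Rplus_le_le_0_compat; apply Rmult_le_pos; lra.
replace ((1 - / x) * (1 + / x ^ 2) / t) with
  (/ t - / (x * t) + / x * (/ (x * t) - / (x * (x * t)))) by (field; lra).
replace (/ x * (/ (x * t) - / (x * (x * t)) - x * (x * t) / 10)) with
  (/ x * (/ (x * t) - / (x * (x * t))) - x * t / 10) in Q1 by (field; lra).
lra.
Qed.

(** The loss on the minor arc in units of [A / t]; the factor [1 - 1 / k] of [Acoef] cancels. *)
Definition beta (k : nat) : R := (1 + / INR k ^ 2) / Z2.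

Lemma INR_range (k : nat) : (2 <= k <= 9)%nat -> 2 <= INR k <= 9.
Proof.
intros Hk; split; [apply (le_INR 2); lia|].
replace 9 with (INR 9) by (simpl; lra); apply le_INR; lia.
Qed.

Lemma Acoef_range (k : nat) : (2 <= k <= 9)%nat -> 82 / 100 <= Acoef k <= 147 / 100.
Proof.
intros Hk; assert (K := INR_range k Hk); assert (Z := Z2_bounds); unfold Acoef.
assert (/ 9 <= / INR k <= / 2) by (split; apply Rinv_le_contravar; lra).
split; nra.
Qed.

Lemma bcoef_pos (k : nat) : (2 <= k <= 9)%nat -> 0 < bcoef k.
Proof.
intros Hk; assert (K := INR_range k Hk); assert (Z := Z2_bounds); assert (HP := PI_RGT_0).
unfold bcoef; apply Rdiv_lt_0_compat; nra.
Qed.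

Lemma exp_three_halves : exp (3 / 2) <= 51 / 10.
Proof.
replace (3 / 2) with (INR 10 * (3 / 20)) by (simpl; lra); rewrite exp_natmul.
apply Rle_trans with ((20 / 17) ^ 10); [|lra].
apply pow_incr; split; [apply Rlt_le, exp_pos|].
eapply Rle_trans; [apply exp_upper; lra | lra].
Qed.

Lemma exp_neg_four : 4 * exp (- 4) <= 113 / 1000.
Proof.
replace (- 4) with (Ropp (INR 16 * / 4)) by (simpl; lra); rewrite exp_Ropp, exp_natmul.
assert ((5 / 4) ^ 16 <= exp (/ 4) ^ 16).
  apply pow_incr; generalize (exp_ineq1_le (/ 4)); lra.
apply Rle_trans with (4 * / (5 / 4) ^ 16); [|lra].
apply Rmult_le_compat_l; [lra|]; apply Rinv_le_contravar; lra.
Qed.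

(** * Effective asymptotics *)

Section Asymptotics.

Variable k : nat.
Hypothesis k_range : (2 <= k <= 9)%nat.
Variable c : nat -> nat -> R.
Hypothesis c_0 : forall n, c 0 n = if Nat.eqb n 0 then 1 else 0.
Hypothesis c_S : forall M n, c (S M) n =
  c M n + (if andb (nondiv k (S M)) (Nat.leb (S M) n) then c (S M) (n - S M)%nat else 0).

Lemma c_stable (M n : nat) : (n <= M)%nat -> c M n = c n n.
Proof.
intros H; induction H as [|M H IH]; [reflexivity|].
rewrite c_S, IH; replace (Nat.leb (S M) n) with false by (symmetry; apply Nat.leb_gt; lia).
rewrite Bool.andb_false_r; ring.
Qed.

Variable n : nat.

Let A := Acoef k.
Let N := INR n + bcoef k.
Let Y := sqrt (A * N).
(** The saddle point of [A / t + N t], where both terms equal [Y]. *)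
Let t := A / Y.
(** At the end points of the major arc [|z| ^ 2 = t], that is [Re (1 / z) = 1]. *)
Let th := sqrt (t - t ^ 2).

Hypothesis Y_large : 40 <= Y.

Lemma saddle_eqs : 0 < N /\ 0 < t <= 147 / 4000 /\ A / t = Y /\ N * t = Y.
Proof.
assert (HA := Acoef_range k k_range); fold A in HA.
assert (HN : 0 < N) by (unfold N; generalize (bcoef_pos k k_range) (pos_INR n); lra).
assert (HY : Y * Y = A * N) by (unfold Y; apply sqrt_sqrt; nra).
split; [assumption|]; unfold t; split.
  split; [apply Rdiv_lt_0_compat; lra|].
  apply Rmult_le_reg_r with Y; [lra|]; unfold Rdiv at 1; rewrite Rmult_assoc, Rinv_l by lra; lra.
split; [field; lra|].
replace (N * (A / Y)) with (A * N / Y) by (field; lra); rewrite <- HY; field; lra.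
Qed.

Lemma th_eqs : 0 < th < 1 /\ th ^ 2 = t - t ^ 2 /\ rad t th ^ 2 = t /\ 0 < rad t th <= 1.
Proof.
destruct saddle_eqs as (HN & Ht & _ & _).
assert (P : 0 < t - t ^ 2) by nra.
assert (H0 : 0 < th) by (apply sqrt_lt_R0; assumption).
assert (H2 : th ^ 2 = t - t ^ 2) by (unfold th; rewrite <- Rsqr_pow2, Rsqr_sqrt by lra; reflexivity).
assert (Hr : rad t th ^ 2 = t) by (rewrite rad_sqr, H2; ring).
assert (Hr0 := rad_pos t th H0).
repeat split; try assumption; nra.
Qed.

(** For [k <= 9], [4 pi ^ 2 / k >= 36 / 9 = 4] exceeds [A], so the decay of [Rem] compensates the
    growth [e ^ (A Re (1 / z))] of the kernel. *)
Lemma Rem_small (z : C) : 0 < Re z -> 1 <= Re (/ z) ->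
  Cmod (Rem k z) <= 113 / 1000 /\
  Cmod (Rem k z) * exp (A * Re (/ z)) <= 4.
Proof.
intros Hz H1; assert (K := INR_range k k_range).
assert (HA := Acoef_range k k_range); fold A in HA.
assert (HP : 3 < PI) by (generalize PI2_3_2; lra).
assert (Hq : 4 <= 4 * PI ^ 2 / INR k).
  apply Rmult_le_reg_r with (INR k); [lra|]; unfold Rdiv; rewrite Rmult_assoc, Rinv_l by lra; nra.
set (a := 4 * PI ^ 2 * Re (/ z) / INR k).
assert (Ea : a = 4 * PI ^ 2 / INR k * Re (/ z)) by (unfold a; field; lra).
assert (Ha : 4 * Re (/ z) <= a) by (rewrite Ea; apply Rmult_le_compat_r; lra).
assert (B := Cmod_Rem k z ltac:(lia) Hz ltac:(fold a; lra)); fold a in B.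
split.
  apply Rle_trans with (1 := B), Rle_trans with (2 := exp_neg_four).
  apply Rmult_le_compat_l; [lra|]; apply exp_mono; lra.
apply Rle_trans with (4 * exp (- a) * exp (A * Re (/ z))).
  apply Rmult_le_compat_r; [apply Rlt_le, exp_pos | exact B].
rewrite Rmult_assoc, <- exp_plus; apply Rle_trans with (4 * exp 0); [|rewrite exp_0; lra].
apply Rmult_le_compat_l; [lra|]; apply exp_mono; nra.
Qed.

Lemma integrand_cexp (M : nat) (theta : R) :
  integrand (nondiv k) t M (INR n) theta =
    cexp (mlogs (nondiv k) M (cexp (- line t theta)) + INR n * line t theta).
Proof.
destruct saddle_eqs as (_ & Ht & _ & _).
assert (Hq : Cmod (cexp (- line t theta)) < 1) by (apply Cmod_q_lt; lra).
unfold integrand; rewrite cexp_plus; f_equal.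
assert (D := Den_neq_0 (nondiv k) M _ Hq).
assert (E := Den_mlogs (nondiv k) M _ Hq).
set (d := Den (nondiv k) M (cexp (- line t theta))) in *.
replace (/ d)%C with (/ d * (d * cexp (mlogs (nondiv k) M (cexp (- line t theta)))))%C
  by (rewrite E; ring).
field; assumption.
Qed.

Lemma Cmod_kernel (theta : R) :
  Cmod (kernel A N (line t theta)) = exp (A * Re (/ line t theta) + Y).
Proof.
destruct saddle_eqs as (_ & _ & _ & E).
unfold kernel; rewrite Cmod_cexp, re_plus, !re_scal_l; f_equal; f_equal; exact E.
Qed.

Lemma Re_inv_line (theta : R) : Re (/ line t theta) = t / (t ^ 2 + theta ^ 2).
Proof. reflexivity. Qed.

(** The integrand is the main kernel times [e ^ w], where [w] collects [Rem] and the truncation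
    error and [|e ^ w - 1| <= 3 |w|]. By [Rem_small] the kernel times [Rem] is at most [4 e ^ Y],
    whereas the kernel alone reaches [e ^ (2 Y)]. *)
Lemma major_arc (M : nat) (eta theta : R) : 0 < eta <= / 10 -> Rabs theta <= th ->
  Cmod (mlogs (nondiv k) M (cexp (- line t theta)) - Lam k (line t theta)) <= eta ->
  Cmod (integrand (nondiv k) t M (INR n) theta - exp (kappa k) * kernel A N (line t theta)) <=
    exp (kappa k) * (12 * exp Y + 3 * eta * exp (2 * Y)).
Proof.
intros Heta Hth HD.
destruct saddle_eqs as (HN & Ht & EA & EN); destruct th_eqs as (Hth0 & Hth2 & Hr & Hr1).
assert (HA := Acoef_range k k_range); fold A in HA.
assert (Hz : 0 < Re (line t theta)) by (simpl; lra).
assert (Hth' : theta ^ 2 <= th ^ 2).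
  rewrite <- (pow2_abs theta); apply pow_incr; split; [apply Rabs_pos | assumption].
assert (Hd : 0 < t ^ 2 + theta ^ 2) by nra.
assert (R1 : 1 <= Re (/ line t theta)).
  rewrite Re_inv_line; apply Rmult_le_reg_r with (t ^ 2 + theta ^ 2); [assumption|].
  unfold Rdiv; rewrite Rmult_assoc, Rinv_l by lra; lra.
assert (R2 : Re (/ line t theta) <= / t).
  rewrite Re_inv_line; apply Rmult_le_reg_r with (t * (t ^ 2 + theta ^ 2)); [nra|].
  replace (t / (t ^ 2 + theta ^ 2) * (t * (t ^ 2 + theta ^ 2))) with (t ^ 2) by (field; lra).
  replace (/ t * (t * (t ^ 2 + theta ^ 2))) with (t ^ 2 + theta ^ 2) by (field; lra).
  generalize (pow2_ge_0 theta); lra.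
destruct (Rem_small (line t theta) Hz R1) as [S1 S2].
rewrite integrand_cexp.
set (z := line t theta) in *; set (L := mlogs (nondiv k) M (cexp (- z))) in *.
set (w := (Rem k z + (L - Lam k z))%C).
assert (E : cexp (L + INR n * z) = (exp (kappa k) * kernel A N z * cexp w)%C).
  unfold kernel; rewrite <- cexp_RtoC, <- !cexp_plus; f_equal.
  unfold w; rewrite (Lam_modular k z) by (try lia; assumption).
  fold A; unfold N; rewrite RtoC_plus; ring.
rewrite E.
replace (exp (kappa k) * kernel A N z * cexp w - exp (kappa k) * kernel A N z)%C with
  (exp (kappa k) * kernel A N z * (cexp w - 1))%C by ring.
rewrite !Cmod_mult, Cmod_R_pos, Rmult_assoc by (apply Rlt_le, exp_pos).
apply Rmult_le_compat_l; [apply Rlt_le, exp_pos|].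
unfold z at 1; rewrite Cmod_kernel; fold z.
assert (Hw : Cmod w <= Cmod (Rem k z) + eta).
  unfold w; eapply Rle_trans; [apply Cmod_triangle|]; lra.
assert (Hw0 := Cmod_ge_0 w).
assert (Ew : exp (Cmod w) <= 3 / 2).
  eapply Rle_trans; [apply exp_upper; lra|].
  replace (3 / 2) with (/ (2 / 3)) by field; apply Rinv_le_contravar; lra.
assert (Hc : Cmod (cexp w - 1) <= 3 * (Cmod (Rem k z) + eta)).
  eapply Rle_trans; [apply cexp_sub_1|].
  apply Rle_trans with (2 * Cmod w * (3 / 2)); [|lra].
  apply Rmult_le_compat_l; lra.
assert (HE := exp_pos (A * Re (/ z))); assert (HY := exp_pos Y).
assert (Hu : exp (A * Re (/ z)) <= exp Y).
  apply exp_mono; rewrite <- EA; apply Rmult_le_compat_l; lra.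
rewrite exp_plus; replace (2 * Y) with (Y + Y) by ring; rewrite exp_plus.
apply Rle_trans with (exp (A * Re (/ z)) * exp Y * (3 * (Cmod (Rem k z) + eta))).
  apply Rmult_le_compat_l; [nra | assumption].
replace (exp (A * Re (/ z)) * exp Y * (3 * (Cmod (Rem k z) + eta))) with
  (3 * exp Y * (Cmod (Rem k z) * exp (A * Re (/ z))) + 3 * eta * (exp (A * Re (/ z)) * exp Y)) by ring.
apply Rplus_le_compat.
  replace (12 * exp Y) with (3 * exp Y * 4) by ring; apply Rmult_le_compat_l; lra.
apply Rmult_le_compat_l; [lra|]; apply Rmult_le_compat_r; lra.
Qed.

(** The modular formula at the real point gives the exponent [2 Y], from which [saving] takes
    [beta Y]. What is left over, [6 / 5 + 0.113 + 0.067 + 0.1], is below [3 / 2], and [51 / 10]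
    bounds [e ^ (3 / 2)]. *)
Lemma minor_arc (M : nat) (eta theta : R) : 0 < eta <= / 10 -> th <= Rabs theta <= PI ->
  Cmod (mlogs (nondiv k) M (cexp (- line t theta)) - Lam k (line t theta)) <= eta ->
  Cmod (integrand (nondiv k) t M (INR n) theta) <=
    exp (kappa k) * (51 / 10 * exp ((2 - beta k) * Y)).
Proof.
intros Heta Hth HD.
destruct saddle_eqs as (HN & Ht & EA & EN).
assert (HA := Acoef_range k k_range); fold A in HA.
assert (K := INR_range k k_range); assert (Z := Z2_bounds).
assert (Sv := saving k t theta k_range ltac:(lra) Hth).
assert (HY : 0 < Y) by lra.
assert (Rt : Re (/ RtoC t) = / t) by (rewrite <- RtoC_inv by lra; reflexivity).
assert (Rt1 : 1 <= / t).
  rewrite <- Rinv_1; apply Rinv_le_contravar; lra.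
destruct (Rem_small (RtoC t) ltac:(simpl; lra) ltac:(rewrite Rt; exact Rt1)) as [S1 _].
rewrite (Lam_modular k (RtoC t)) in Sv by (try lia; simpl; lra).
rewrite !re_plus, !re_scal_l, Rt in Sv.
change (Re (RtoC (kappa k))) with (kappa k) in Sv; change (Re (RtoC t)) with t in Sv.
fold A in Sv.
assert (S1' := re_le_Cmod (Rem k (RtoC t))); assert (S1'' := Rle_abs (Re (Rem k (RtoC t)))).
rewrite integrand_cexp, Cmod_cexp, re_plus, re_scal_l.
change (t, theta) with (line t theta) in Sv; change (Re (line t theta)) with t.
set (z := line t theta) in *; set (L := mlogs (nondiv k) M (cexp (- z))) in *.
assert (HL : Re L <= Re (Lam k z) + eta).
  generalize (re_le_Cmod (L - Lam k z)) (Rle_abs (Re (L - Lam k z))).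
  change (Re (L - Lam k z)) with (Re L - Re (Lam k z)); lra.
assert (Eb : (1 - / INR k) * (1 + / INR k ^ 2) / t = beta k * Y).
  unfold t, beta, A, Acoef; field.
  assert (INR k - 1 <> 0) by lra; repeat split; lra.
assert (Ek : INR k * t / 5 <= 67 / 1000) by nra.
apply Rle_trans with (exp (kappa k + (3 / 2 + (2 - beta k) * Y))).
  apply exp_mono; unfold N in EN.
  replace (A * / t) with Y in Sv by (rewrite <- EA; reflexivity).
  nra.
rewrite !exp_plus; apply Rmult_le_compat_l; [apply Rlt_le, exp_pos|].
apply Rmult_le_compat_r; [apply Rlt_le, exp_pos | apply exp_three_halves].
Qed.

Lemma mlogs_uniform (eta : R) : 0 < eta -> exists M, (n <= M)%nat /\ forall theta,
  Cmod (mlogs (nondiv k) M (cexp (- line t theta)) - Lam k (line t theta)) <= eta.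
Proof.
intros Heta; destruct saddle_eqs as (HN & Ht & _ & _).
assert (Z := Z2_bounds).
assert (Hr : exp (- t) < 1) by (rewrite <- exp_0; apply exp_increasing; lra).
assert (Hr0 := exp_pos (- t)).
assert (HK : 0 < 2 / t * Z2) by (apply Rmult_lt_0_compat; [apply Rdiv_lt_0_compat; lra | lra]).
destruct (pow_lt_1_zero (exp (- t))) with (y := eta / (2 / t * Z2)) as [B HB].
  rewrite Rabs_pos_eq; lra.
  apply Rdiv_lt_0_compat; assumption.
exists (k * (B + n))%nat; split; [nia|]; intros theta.
eapply Rle_trans; [apply mlogs_Lam; [lia | simpl; lra]|]; simpl Re.
specialize (HB (k * (B + n))%nat ltac:(nia)).
rewrite Rabs_pos_eq in HB by (apply pow_le; lra).
apply Rle_trans with (eta / (2 / t * Z2) * (2 / t * Z2)).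
  apply Rmult_le_compat_r; lra.
apply Req_le; field; lra.
Qed.

(** The coefficient 18 exceeds [12 + 51 / 10], the shares of the major arc and of the arc that
    closes the contour. The truncation error [eta] is arbitrary, as [c M n] does not depend on
    [M >= n], and is absorbed in [eps]. *)
Theorem asymptotic : Rabs (c n n - exp (kappa k) * (A * Bes (A * N))) <=
  exp (kappa k) * (18 * exp Y + 51 / 10 * exp ((2 - beta k) * Y)).
Proof.
destruct saddle_eqs as (HN & Ht & EA & EN); destruct th_eqs as (Hth0 & Hth2 & Hr & Hr1).
assert (HA := Acoef_range k k_range); fold A in HA.
assert (HP : 3 < PI) by (generalize PI2_3_2; lra).
assert (HK := exp_pos (kappa k)); assert (HY := exp_pos Y).
apply le_epsilon; intros eps Heps.
set (eta := Rmin (/ 10) (eps / (3 * exp (kappa k) * exp (2 * Y)))).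
assert (HE2 := exp_pos (2 * Y)).
assert (HD : 0 < 3 * exp (kappa k) * exp (2 * Y)) by (repeat apply Rmult_lt_0_compat; lra).
assert (Heta : 0 < eta <= / 10).
  split; [apply Rmin_pos; [lra | now apply Rdiv_lt_0_compat] | apply Rmin_l].
destruct (mlogs_uniform eta (proj1 Heta)) as [M [HM HD2]].
rewrite <- (c_stable M n HM), (cauchy (nondiv k) t ltac:(lra) c c_0 c_S M n).
unfold coef; set (f := integrand (nondiv k) t M (INR n)).
assert (Cf : ccont f) by (apply ccont_integrand; lra).
assert (If : forall a b, ex_RInt (fun x => Re (f x)) a b) by (intros; now apply ccont_ex_RInt).
rewrite (RInt_RChasles (fun x => Re (f x)) (- PI) (- th) PI) by apply If.
rewrite (RInt_RChasles (fun x => Re (f x)) (- th) th PI) by apply If.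
destruct (path_cont_kernel t th A N ltac:(lra) ltac:(lra)) as [Ck _].
pose (g := fun x => (f x - exp (kappa k) * kernel A N (line t x))%C).
assert (Cg : ccont g).
  apply (ccont_plus f (fun x => - (exp (kappa k) * kernel A N (line t x)))%C Cf).
  apply (ccont_opp (fun x => exp (kappa k) * kernel A N (line t x))%C).
  apply (ccont_mult (fun _ => RtoC (exp (kappa k))) (fun x => kernel A N (line t x)));
    [apply ccont_const | exact Ck].
assert (Eg : RInt (fun x => Re (f x)) (- th) th =
   RInt (fun x => Re (g x)) (- th) th + exp (kappa k) * RInt (fun x => Re (kernel A N (line t x))) (- th) th).
  assert (Ik := ccont_ex_RInt (fun x => kernel A N (line t x)) (- th) th Ck).
  rewrite <- RInt_Rscal by exact Ik.
  rewrite <- RInt_Rplus.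
  2: now apply ccont_ex_RInt.
  2: apply (ex_RInt_scal (V := R_NormedModule) _ _ _ (exp (kappa k))), Ik.
  apply RInt_ext; intros x _; unfold g; toR.
  change (Re (f x - exp (kappa k) * kernel A N (line t x))) with
    (Re (f x) - Re (exp (kappa k) * kernel A N (line t x))).
  rewrite re_scal_l; ring.
assert (Hmin : forall x, th <= Rabs x <= PI -> Cmod (f x) <= exp (kappa k) * (51 / 10 * exp ((2 - beta k) * Y))).
  intros x Hx; now apply minor_arc with eta.
assert (B1 : Rabs (RInt (fun x => Re (f x)) (- PI) (- th)) <=
   (- th - - PI) * (exp (kappa k) * (51 / 10 * exp ((2 - beta k) * Y)))).
  apply RInt_Re_bound; [lra | assumption |]; intros x Hx; apply Hmin.
  rewrite Rabs_left by lra; lra.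
assert (B3 : Rabs (RInt (fun x => Re (f x)) th PI) <=
   (PI - th) * (exp (kappa k) * (51 / 10 * exp ((2 - beta k) * Y)))).
  apply RInt_Re_bound; [lra | assumption |]; intros x Hx; apply Hmin.
  rewrite Rabs_pos_eq by lra; lra.
assert (B2 : Rabs (RInt (fun x => Re (g x)) (- th) th) <=
   (th - - th) * (exp (kappa k) * (12 * exp Y + 3 * eta * exp (2 * Y)))).
  apply RInt_Re_bound; [lra | assumption |]; intros x Hx; unfold g, f.
  apply major_arc; [assumption | apply Rabs_le; lra | apply HD2].
assert (B4 := line_kernel_error t th A N ltac:(lra) ltac:(lra) ltac:(lra) HN).
rewrite Eg.
set (I1 := RInt (fun x => Re (f x)) (- PI) (- th)) in *.
set (I3 := RInt (fun x => Re (f x)) th PI) in *.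
set (I2 := RInt (fun x => Re (g x)) (- th) th) in *.
set (Ik := RInt (fun x => Re (kernel A N (line t x))) (- th) th) in *.
set (m := exp ((2 - beta k) * Y)) in *; set (K := exp (kappa k)) in *.
assert (Hm : 0 < m) by apply exp_pos.
(* As [rad ^ 2 = t], the exponent of the closing arc is [A + Y], and [A < 3 / 2]. *)
assert (B4' : Rabs (/ (2 * PI) * Ik - A * Bes (A * N)) <= 51 / 10 * exp Y).
  apply Rle_trans with (1 := B4).
  rewrite Hr, EN, exp_plus; replace (A * t / t) with A by (field; lra).
  assert (exp A <= 51 / 10) by (apply Rle_trans with (2 := exp_three_halves), exp_mono; lra).
  assert (HeA := exp_pos A).
  rewrite <- Rmult_assoc; apply Rmult_le_compat_r; [lra|].
  apply Rle_trans with (1 * exp A); [apply Rmult_le_compat_r; lra | lra].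
replace (/ (2 * PI) * (I1 + (I2 + K * Ik + I3)) - K * (A * Bes (A * N))) with
  (/ (2 * PI) * (I1 + I3 + I2) + K * (/ (2 * PI) * Ik - A * Bes (A * N))) by ring.
eapply Rle_trans; [apply Rabs_triang|].
assert (T1 : Rabs (K * (/ (2 * PI) * Ik - A * Bes (A * N))) <= K * (51 / 10 * exp Y)).
  rewrite Rabs_mult, (Rabs_pos_eq K) by lra; apply Rmult_le_compat_l; lra.
assert (Heta2 : K * (3 * eta * exp (2 * Y)) <= eps).
  apply Rle_trans with (3 * K * exp (2 * Y) * (eps / (3 * K * exp (2 * Y)))).
    replace (K * (3 * eta * exp (2 * Y))) with (3 * K * exp (2 * Y) * eta) by ring.
    apply Rmult_le_compat_l; [lra | apply Rmin_r].
  apply Req_le; field; lra.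
assert (T2 : Rabs (/ (2 * PI) * (I1 + I3 + I2)) <= K * (51 / 10 * m) + K * (12 * exp Y + 3 * eta * exp (2 * Y))).
  rewrite Rabs_mult, Rabs_pos_eq by (apply Rlt_le, Rinv_0_lt_compat; lra).
  apply Rmult_le_reg_l with (2 * PI); [lra|].
  rewrite <- Rmult_assoc, Rinv_r, Rmult_1_l by lra.
  assert (Rabs (I1 + I3 + I2) <= Rabs I1 + Rabs I3 + Rabs I2).
    eapply Rle_trans; [apply Rabs_triang|]; apply Rplus_le_compat_r, Rabs_triang.
  assert (0 <= K * (51 / 10 * m)) by (apply Rmult_le_pos; lra).
  assert (0 <= K * (12 * exp Y + 3 * eta * exp (2 * Y))).
    apply Rmult_le_pos; [lra|]; assert (0 <= eta * exp (2 * Y)) by (apply Rmult_le_pos; lra); lra.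
  set (u := K * (51 / 10 * m)) in *; set (v := K * (12 * exp Y + 3 * eta * exp (2 * Y))) in *.
  assert (0 <= th * u) by (apply Rmult_le_pos; lra).
  assert (th * v <= PI * v) by (apply Rmult_le_compat_r; lra).
  lra.
assert (0 < K * exp Y) by (apply Rmult_lt_0_compat; lra).
lra.
Qed.

End Asymptotics.

(** * Numerical inequalities behind the bound 2500 *)

Lemma exp_1_lower : 2718 / 1000 <= exp 1.
Proof.
assert (S : is_series (fun n => 1 ^ n / INR (fact n)) (exp 1)).
  apply is_series_ext with (fun k => scal (pow_n 1 k) (/ INR (fact k))).
    intros n; rewrite pow_n_pow; reflexivity.
  apply is_exp_Reals.
rewrite <- (is_series_unique _ _ S).
eapply Rle_trans; [|apply (rsn_le_Series _ 8)].
- simpl; lra.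
- intros i; apply Rlt_le, Rdiv_lt_0_compat; [rewrite pow1; lra | apply INR_fact_lt_0].
- exists (exp 1); exact S.
Qed.

Lemma exp_nat_lower (m : nat) (x : R) : INR m <= x -> (2718 / 1000) ^ m <= exp x.
Proof.
intros H; apply Rle_trans with (exp (INR m * 1)); [|apply exp_mono; lra].
rewrite exp_natmul; apply pow_incr; generalize exp_1_lower; lra.
Qed.

(** The function [y ^ j e ^ (- b y)] decreases for [y >= j / b]. *)
Lemma pow_exp_compare (j : nat) (b y0 y : R) : 0 < y0 <= y -> INR j <= b * y0 ->
  y ^ j * exp (b * y0) <= y0 ^ j * exp (b * y).
Proof.
intros Hy Hb.
replace (b * y) with (b * y0 + b * (y - y0)) by ring; rewrite exp_plus.
assert (H : (y / y0) ^ j <= exp (b * (y - y0))).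
  apply Rle_trans with (exp (INR j * ((y - y0) / y0))).
    rewrite exp_natmul; apply pow_incr; split; [apply Rlt_le, Rdiv_lt_0_compat; lra|].
    replace (y / y0) with (1 + (y - y0) / y0) by (field; lra); apply exp_ineq1_le.
  apply exp_mono; replace (b * (y - y0)) with (b * y0 * ((y - y0) / y0)) by (field; lra).
  apply Rmult_le_compat_r; [|assumption].
  apply Rmult_le_pos; [lra | apply Rlt_le, Rinv_0_lt_compat; lra].
assert (E : y ^ j = y0 ^ j * (y / y0) ^ j) by (rewrite <- Rpow_mult_distr; f_equal; field; lra).
rewrite E.
assert (P : 0 < y0 ^ j) by (apply pow_lt; lra); assert (Q := exp_pos (b * y0)).
replace (y0 ^ j * (y / y0) ^ j * exp (b * y0)) with (y0 ^ j * exp (b * y0) * (y / y0) ^ j) by ring.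
rewrite <- Rmult_assoc; apply Rmult_le_compat_l; nra.
Qed.

(** Rational lower bounds [a] and [b] for [Acoef k] and [beta k], and a [y0] just below
    [sqrt (2500 a)]. From [k = 5] on, one choice serves all values: [a] comes from [k = 5] and [b]
    from [k = 9]. *)
Lemma numeric_base (k : nat) : (2 <= k <= 9)%nat -> exists a b y0 : R,
  0 < a <= Acoef k /\ b <= beta k /\ 40 <= y0 /\ y0 ^ 2 <= 2500 * a /\ 7 <= b * y0 /\
  415 * y0 ^ 7 <= a ^ 4 * exp (b * y0).
Proof.
intros Hk; assert (Z := Z2_bounds).
assert (Hb : forall x, 0 <= x -> (1 + x) / (165 / 100) <= (1 + x) / Z2).
  intros x Hx; apply Rmult_le_compat_l; [lra|]; apply Rinv_le_contravar; lra.
assert (C : (k = 2 \/ k = 3 \/ k = 4 \/ (5 <= k <= 9))%nat) by lia.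
destruct C as [E|[E|[E|Hk5]]].
- subst k; exists (82 / 100), (757 / 1000), (452 / 10).
  assert (H := Hb (/ INR 2 ^ 2) ltac:(simpl; lra)); fold (beta 2) in H; unfold Acoef; simpl INR in *.
  repeat split; try lra.
  assert (E := exp_nat_lower 34 (757 / 1000 * (452 / 10)) ltac:(simpl; lra)).
  eapply Rle_trans; [|apply Rmult_le_compat_l; [lra | exact E]]; lra.
- subst k; exists (1093 / 1000), (673 / 1000), (522 / 10).
  assert (H := Hb (/ INR 3 ^ 2) ltac:(simpl; lra)); fold (beta 3) in H; unfold Acoef; simpl INR in *.
  repeat split; try lra.
  assert (E := exp_nat_lower 35 (673 / 1000 * (522 / 10)) ltac:(simpl; lra)).
  eapply Rle_trans; [|apply Rmult_le_compat_l; [lra | exact E]]; lra.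
- subst k; exists (123 / 100), (643 / 1000), (554 / 10).
  assert (H := Hb (/ INR 4 ^ 2) ltac:(simpl; lra)); fold (beta 4) in H; unfold Acoef; simpl INR in *.
  repeat split; try lra.
  assert (E := exp_nat_lower 35 (643 / 1000 * (554 / 10)) ltac:(simpl; lra)).
  eapply Rle_trans; [|apply Rmult_le_compat_l; [lra | exact E]]; lra.
- exists (1312 / 1000), (613 / 1000), (572 / 10).
  assert (K := INR_range k Hk).
  assert (K5 : 5 <= INR k) by (replace 5 with (INR 5) by (simpl; lra); apply le_INR; lia).
  assert (Hi : / 9 <= / INR k <= / 5) by (split; apply Rinv_le_contravar; lra).
  assert (Hq : / 81 <= / INR k ^ 2) by (apply Rinv_le_contravar; nra).
  assert (H := Hb (/ INR k ^ 2) ltac:(lra)); fold (beta k) in H; unfold Acoef.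
  repeat split; try lra; try nra.
  assert (E := exp_nat_lower 35 (613 / 1000 * (572 / 10)) ltac:(simpl; lra)).
  eapply Rle_trans; [|apply Rmult_le_compat_l; [lra | exact E]]; lra.
Qed.

(** The seventh power joins [y ^ 2] from the relative error with [y ^ 5] from the second difference.
    The constant 415 exceeds [2 * 9 * 22 * 1.02], collected from [rho_convex], [ratio_perturbation],
    [rel_error] and the shift of the argument by [3 A]. *)
Lemma numeric_bound (k : nat) (y : R) : (2 <= k <= 9)%nat -> 2500 * Acoef k <= y ^ 2 -> 0 < y ->
  40 <= y /\ 415 * y ^ 7 <= Acoef k ^ 4 * exp (beta k * y).
Proof.
intros Hk Hy Hy0.
destruct (numeric_base k Hk) as (a & b & y0 & Ha & Hb & H40 & Hs & H7 & H).
assert (Hyy : y0 <= y) by nra.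
split; [lra|].
assert (P := pow_exp_compare 7 b y0 y ltac:(lra) ltac:(simpl; lra)).
assert (Q := exp_pos (b * y0)); assert (P0 : 0 < y0 ^ 7) by (apply pow_lt; lra).
assert (P1 : 0 < y ^ 7) by (apply pow_lt; lra).
assert (A4 : a ^ 4 <= Acoef k ^ 4) by (apply pow_incr; lra).
assert (A0 : 0 < a ^ 4) by (apply pow_lt; lra).
assert (E : exp (b * y) <= exp (beta k * y)) by (apply exp_mono, Rmult_le_compat_r; lra).
assert (Q2 := exp_pos (b * y)).
apply Rle_trans with (a ^ 4 * exp (b * y)); [|apply Rmult_le_compat; lra].
apply Rmult_le_reg_r with (y0 ^ 7); [assumption|].
apply Rle_trans with (y ^ 7 * (a ^ 4 * exp (b * y0))).
  replace (415 * y ^ 7 * y0 ^ 7) with (y ^ 7 * (415 * y0 ^ 7)) by ring.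
  apply Rmult_le_compat_l; lra.
replace (y ^ 7 * (a ^ 4 * exp (b * y0))) with (a ^ 4 * (y ^ 7 * exp (b * y0))) by ring.
replace (a ^ 4 * exp (b * y) * y0 ^ 7) with (a ^ 4 * (y0 ^ 7 * exp (b * y))) by ring.
apply Rmult_le_compat_l; lra.
Qed.

(** Each quotient moves by a relative amount of at most [2.01 d]. With ratios up to [10 / 9], the
    second difference loses at most [10 / 9 * (2 + 4.02 + 2) d < 9 d]. *)
Lemma ratio_perturbation (p0 p1 p2 p3 g0 g1 g2 g3 d : R) :
  0 < g0 -> 0 < g1 -> 0 < g2 -> 0 < g3 -> 0 <= d <= / 1000 ->
  Rabs (p0 - g0) <= d * g0 -> Rabs (p1 - g1) <= d * g1 ->
  Rabs (p2 - g2) <= d * g2 -> Rabs (p3 - g3) <= d * g3 ->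
  g1 / g0 <= 10 / 9 -> g2 / g1 <= 10 / 9 -> g3 / g2 <= 10 / 9 ->
  9 * d < g1 / g0 - 2 * (g2 / g1) + g3 / g2 ->
  0 < p2 * p1 ^ 2 - 2 * p0 * p2 ^ 2 + p0 * p1 * p3.
Proof.
intros G0 G1 G2 G3 Hd H0 H1 H2 H3 R0 R1 R2 H.
assert (I : forall p g, 0 < g -> Rabs (p - g) <= d * g -> (1 - d) * g <= p <= (1 + d) * g).
  intros p g Hg Hp; apply Rabs_le_between in Hp; lra.
apply I in H0; apply I in H1; apply I in H2; apply I in H3; try assumption.
assert (P0 : 0 < p0) by nra; assert (P1 : 0 < p1) by nra.
assert (P2 : 0 < p2) by nra; assert (P3 : 0 < p3) by nra.
assert (L : forall p q g h, 0 < g -> 0 < h -> 0 < p -> (1 - d) * h <= q -> p <= (1 + d) * g ->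
   h / g * (1 - 2 * d) <= q / p).
  intros p q g h Hg Hh Hp Hq Hpg.
  apply Rmult_le_reg_r with p; [assumption|].
  replace (q / p * p) with q by (field; lra).
  apply Rle_trans with (2 := Hq).
  apply Rle_trans with (h / g * (1 - 2 * d) * ((1 + d) * g)).
    apply Rmult_le_compat_l; [|assumption].
    apply Rmult_le_pos; [apply Rlt_le, Rdiv_lt_0_compat; lra | lra].
  replace (h / g * (1 - 2 * d) * ((1 + d) * g)) with (h * ((1 - 2 * d) * (1 + d))) by (field; lra).
  rewrite Rmult_comm; apply Rmult_le_compat_r; nra.
assert (U : p2 / p1 <= g2 / g1 * (1 + 201 / 100 * d)).
  apply Rmult_le_reg_r with p1; [assumption|].
  replace (p2 / p1 * p1) with p2 by (field; lra).
  apply Rle_trans with ((1 + d) * g2); [lra|].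
  apply Rle_trans with (g2 / g1 * (1 + 201 / 100 * d) * ((1 - d) * g1)).
    replace (g2 / g1 * (1 + 201 / 100 * d) * ((1 - d) * g1)) with
      ((1 + 201 / 100 * d) * (1 - d) * g2) by (field; lra).
    apply Rmult_le_compat_r; nra.
  apply Rmult_le_compat_l; [|lra].
  apply Rmult_le_pos; [apply Rlt_le, Rdiv_lt_0_compat; lra | lra].
assert (L1 := L p0 p1 g0 g1 G0 G1 P0 ltac:(lra) ltac:(lra)).
assert (L2 := L p2 p3 g2 g3 G2 G3 P2 ltac:(lra) ltac:(lra)).
set (r0 := g1 / g0) in *; set (r1 := g2 / g1) in *; set (r2 := g3 / g2) in *.
assert (T : 0 < p1 / p0 - 2 * (p2 / p1) + p3 / p2).
  assert (r0 * d <= 10 / 9 * d) by (apply Rmult_le_compat_r; lra).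
  assert (r1 * d <= 10 / 9 * d) by (apply Rmult_le_compat_r; lra).
  assert (r2 * d <= 10 / 9 * d) by (apply Rmult_le_compat_r; lra).
  lra.
replace (p2 * p1 ^ 2 - 2 * p0 * p2 ^ 2 + p0 * p1 * p3) with
  (p0 * p1 * p2 * (p1 / p0 - 2 * (p2 / p1) + p3 / p2)) by (field; lra).
repeat apply Rmult_lt_0_compat; assumption.
Qed.

(** * Large arguments *)

Section Large.

Variable k : nat.
Hypothesis k_range : (2 <= k <= 9)%nat.
Variable c : nat -> nat -> R.
Hypothesis c_0 : forall n, c 0 n = if Nat.eqb n 0 then 1 else 0.
Hypothesis c_S : forall M n, c (S M) n =
  c M n + (if andb (nondiv k (S M)) (Nat.leb (S M) n) then c (S M) (n - S M)%nat else 0).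

Let A := Acoef k.

(** The factor 22 exceeds [4 * 5.4 / 0.99]: an absolute error of [5.4 e ^ ((2 - beta) Y)] is divided
    by [A Bes], with [Bes >= 0.99 e ^ (2 Y) / (4 Y ^ 2)]. *)
Definition rel_error (y : R) : R := 22 * y ^ 2 * exp (- (beta k * y)) / A.

Lemma beta_range : 606 / 1000 <= beta k <= 763 / 1000.
Proof.
assert (Z := Z2_bounds); assert (K := INR_range k k_range); unfold beta.
assert (Hq : 0 < / INR k ^ 2 <= / 4).
  split; [apply Rinv_0_lt_compat; nra | apply Rinv_le_contravar; nra].
split; (apply Rmult_le_reg_r with Z2; [lra|];
  replace ((1 + / INR k ^ 2) / Z2 * Z2) with (1 + / INR k ^ 2) by (field; lra); lra).
Qed.

(** The error is evaluated at any [y] below the square root of the argument, where it is larger; so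
    four consecutive coefficients can share one bound. *)
Lemma rel_error_bound (m : nat) (y : R) : 40 <= y ->
  y ^ 2 <= A * (INR m + bcoef k) ->
  0 < exp (kappa k) * (A * Bes (A * (INR m + bcoef k))) /\
  Rabs (c m m - exp (kappa k) * (A * Bes (A * (INR m + bcoef k)))) <=
    rel_error y * (exp (kappa k) * (A * Bes (A * (INR m + bcoef k)))).
Proof.
intros Hy Hm.
assert (HA := Acoef_range k k_range); fold A in HA; assert (HB := beta_range).
set (X := A * (INR m + bcoef k)) in *.
assert (HX : 1600 <= X) by nra.
set (Y := sqrt X).
assert (HY : y <= Y).
  unfold Y; rewrite <- (sqrt_Rsqr y) by lra; apply sqrt_le_1; rewrite ?Rsqr_pow2; try lra; apply pow2_ge_0.
assert (HYY : Y * Y = X) by (unfold Y; apply sqrt_sqrt; lra).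
assert (As := asymptotic k k_range c c_0 c_S m ltac:(fold A X Y; lra)); fold A X Y in As.
assert (Lo := Bes_lower X ltac:(lra)); fold Y in Lo.
assert (HK := exp_pos (kappa k)); assert (B1 := Bes_ge_1 X ltac:(lra)).
(* Since [beta <= 0.763] and [Y >= 40], the term [18 exp Y] is at most [0.3 exp ((2 - beta) Y)],
   which raises [5.1] to [5.4]. *)
assert (E1 : 60 * exp Y <= exp ((2 - beta k) * Y)).
  replace ((2 - beta k) * Y) with ((1 - beta k) * Y + Y) by ring; rewrite exp_plus.
  apply Rmult_le_compat_r; [apply Rlt_le, exp_pos|].
  assert (237 / 1000 * 40 <= (1 - beta k) * Y) by (apply Rmult_le_compat; lra).
  eapply Rle_trans; [|apply (exp_nat_lower 9)]; [lra | simpl; lra].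
assert (E2 : 99 / 100 * exp (2 * Y) <= exp (2 * Y) - 2).
  assert ((2718 / 1000) ^ 40 <= exp (2 * Y)).
    apply exp_nat_lower; simpl; lra.
  assert (200 <= (2718 / 1000) ^ 40) by lra; lra.
split; [apply Rmult_lt_0_compat; [lra|]; apply Rmult_lt_0_compat; lra|].
apply Rle_trans with (1 := As).
replace (rel_error y * (exp (kappa k) * (A * Bes X))) with
  (exp (kappa k) * (22 * y ^ 2 * exp (- (beta k * y)) * Bes X)) by (unfold rel_error; field; lra).
apply Rmult_le_compat_l; [lra|].
apply Rle_trans with (54 / 10 * exp ((2 - beta k) * Y)); [lra|].
assert (Cmp := pow_exp_compare 2 (beta k) y Y ltac:(lra) ltac:(simpl; assert (606 / 1000 * 40 <= beta k * y) by (apply Rmult_le_compat; lra); lra)).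
assert (Py := exp_pos (beta k * y)); assert (PY := exp_pos (beta k * Y)).
rewrite exp_Ropp.
replace ((2 - beta k) * Y) with (2 * Y + - (beta k * Y)) by ring.
rewrite exp_plus, (exp_Ropp (beta k * Y)).
set (u := exp (beta k * y)) in *; set (w := exp (beta k * Y)) in *; set (e := exp (2 * Y)) in *.
assert (Lo2 : 99 / 100 * e <= 4 * Y ^ 2 * Bes X).
  replace (4 * Y ^ 2) with (4 * X) by (rewrite <- HYY; ring); lra.
apply Rmult_le_reg_r with (u * w * Y ^ 2); [repeat apply Rmult_lt_0_compat; try lra; apply pow_lt; lra|].
replace (54 / 10 * (e * / w) * (u * w * Y ^ 2)) with (54 / 10 * e * (Y ^ 2 * u)) by (field; lra).
replace (22 * y ^ 2 * / u * Bes X * (u * w * Y ^ 2)) with (22 / 4 * (4 * Y ^ 2 * Bes X) * (y ^ 2 * w))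
  by (field; lra).
assert (He : 0 < e) by apply exp_pos.
apply Rmult_le_compat.
- lra.
- apply Rmult_le_pos; [apply pow2_ge_0 | lra].
- lra.
- exact Cmp.
Qed.

(** Here [n] is the least of the four indices, the predecessor of the index in the final
    inequality. *)
Theorem ratio_convex_large (n : nat) : (2500 <= n)%nat ->
  0 < c (n + 2)%nat (n + 2)%nat * c (n + 1)%nat (n + 1)%nat ^ 2
    - 2 * c n n * c (n + 2)%nat (n + 2)%nat ^ 2
    + c n n * c (n + 1)%nat (n + 1)%nat * c (n + 3)%nat (n + 3)%nat.
Proof.
intros Hn.
assert (HA := Acoef_range k k_range); fold A in HA; assert (HB := beta_range).
assert (Hb := bcoef_pos k k_range).
assert (HnR : 2500 <= INR n) by (replace 2500 with (INR 2500) by (rewrite INR_IZR_INZ; f_equal); now apply le_INR).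
set (X := A * (INR n + bcoef k)).
assert (HX : 2500 * A <= X) by (unfold X; nra).
set (Y := sqrt X).
assert (HY0 : 0 < Y) by (apply sqrt_lt_R0; lra).
assert (HYY : Y ^ 2 = X) by (unfold Y; rewrite <- Rsqr_pow2, Rsqr_sqrt; lra).
destruct (numeric_bound k Y k_range ltac:(fold A; lra) HY0) as [HY HN]; fold A in HN.
set (d := rel_error Y).
assert (PY5 : 0 < Y ^ 5) by (apply pow_lt; lra).
assert (PA3 : 0 < A ^ 3) by (apply pow_lt; lra).
assert (Hd0 : 0 <= d).
  unfold d, rel_error; apply Rmult_le_pos; [|apply Rlt_le, Rinv_0_lt_compat; lra].
  apply Rmult_le_pos; [generalize (pow2_ge_0 Y); lra | apply Rlt_le, exp_pos].
assert (Hd : d * Y ^ 5 <= 22 / 415 * A ^ 3).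
  assert (Pe := exp_pos (beta k * Y)).
  unfold d, rel_error; rewrite exp_Ropp.
  apply Rmult_le_reg_r with (A * exp (beta k * Y)); [nra|].
  replace (22 * Y ^ 2 * / exp (beta k * Y) / A * Y ^ 5 * (A * exp (beta k * Y))) with (22 / 415 * (415 * Y ^ 7))
    by (field; lra).
  replace (22 / 415 * A ^ 3 * (A * exp (beta k * Y))) with (22 / 415 * (A ^ 4 * exp (beta k * Y))) by ring.
  lra.
assert (A3 : A ^ 3 <= 4) by (apply Rle_trans with ((147 / 100) ^ 3); [apply pow_incr; lra | lra]).
assert (Y5 : 1000 <= Y ^ 5) by (apply Rle_trans with (40 ^ 5); [lra | apply pow_incr; lra]).
assert (Hd1 : d <= / 1000) by nra.
assert (Hi : forall i : nat, A * (INR (n + i) + bcoef k) = X + INR i * A)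
  by (intros i; rewrite plus_INR; unfold X; ring).
assert (B0 := rel_error_bound n Y HY ltac:(fold X; lra)).
assert (B1 := rel_error_bound (n + 1) Y HY ltac:(rewrite Hi; simpl; lra)).
assert (B2 := rel_error_bound (n + 2) Y HY ltac:(rewrite Hi; simpl; lra)).
assert (B3 := rel_error_bound (n + 3) Y HY ltac:(rewrite Hi; simpl; lra)).
rewrite Hi in B1, B2, B3; fold X in B0; fold d in B0, B1, B2, B3.
change (INR 1) with 1 in B1; change (INR 2) with (1 + 1) in B2; change (INR 3) with (1 + 1 + 1) in B3.
replace (X + 1 * A) with (X + A) in B1 by ring.
replace (X + (1 + 1) * A) with (X + A + A) in B2 by ring.
replace (X + (1 + 1 + 1) * A) with (X + A + A + A) in B3 by ring.
assert (HK := exp_pos (kappa k)).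
assert (Hr : forall x, 1600 <= x -> exp (kappa k) * (A * Bes (x + A)) / (exp (kappa k) * (A * Bes x)) = rho A x).
  intros x Hx; unfold rho; generalize (Bes_ge_1 x ltac:(lra)); intros; field; lra.
assert (HX1 : 1600 <= X) by lra.
apply (ratio_perturbation _ _ _ _ (exp (kappa k) * (A * Bes X)) (exp (kappa k) * (A * Bes (X + A)))
  (exp (kappa k) * (A * Bes (X + A + A))) (exp (kappa k) * (A * Bes (X + A + A + A))) d);
  try apply B0; try apply B1; try apply B2; try apply B3; try lra;
  rewrite ?Hr by lra; try (apply rho_upper; lra).
assert (Cv := rho_convex A X ltac:(lra) HX1).
replace (X + 2 * A) with (X + A + A) in Cv by ring.
apply Rlt_le_trans with (2 := Cv).
set (s := sqrt (X + 3 * A)).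
assert (Hs0 : 0 < s) by (apply sqrt_lt_R0; lra).
(* As [X >= 2500 A], the argument [X + 3 A] is at most [1.0012 X]. *)
assert (Hs : s <= 1002 / 1000 * Y).
  unfold s; rewrite <- (sqrt_Rsqr (1002 / 1000 * Y)) by lra; apply sqrt_le_1; [lra | apply Rle_0_sqr |].
  rewrite Rsqr_pow2, Rpow_mult_distr, HYY; lra.
assert (Hs5 : s ^ 5 <= 102 / 100 * Y ^ 5).
  apply Rle_trans with ((1002 / 1000 * Y) ^ 5); [apply pow_incr; lra|].
  rewrite Rpow_mult_distr; apply Rmult_le_compat_r; lra.
rewrite pow_inv.
apply Rmult_lt_reg_r with (s ^ 5); [apply pow_lt; assumption|].
replace (A ^ 3 / 2 * / s ^ 5 * s ^ 5) with (A ^ 3 / 2) by (field; lra).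
apply Rle_lt_trans with (9 * d * (102 / 100 * Y ^ 5)); [apply Rmult_le_compat_l; lra | lra].
Qed.

End Large.

(** The negative term stands on the left, because subtraction of natural numbers is truncated. *)
Lemma ratio_convex_large_nat (k : nat) (c : nat -> nat -> nat) (n : nat) :
  (2 <= k <= 9)%nat ->
  (forall n, c 0%nat n = if Nat.eqb n 0 then 1%nat else 0%nat) ->
  (forall M n, c (S M) n = (c M n +
     (if andb (nondiv k (S M)) (Nat.leb (S M) n) then c (S M) (n - S M)%nat else 0))%nat) ->
  (2500 <= n)%nat ->
  (2 * (c n n * (c (n + 2) (n + 2) * c (n + 2) (n + 2))) <
   c (n + 1) (n + 1) * (c (n + 2) (n + 2) * c (n + 1) (n + 1) + c n n * c (n + 3) (n + 3)))%nat.
Proof.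
intros hk c_0 c_S hn.
apply INR_lt; rewrite !mult_INR, plus_INR, !mult_INR.
assert (H := ratio_convex_large k hk (fun M n => INR (c M n))).
assert (H0 : forall n, INR (c 0%nat n) = if Nat.eqb n 0 then 1 else 0).
{ intros m; rewrite c_0; now destruct (Nat.eqb m 0). }
assert (HS : forall M n, INR (c (S M) n) = INR (c M n) +
  (if andb (nondiv k (S M)) (Nat.leb (S M) n) then INR (c (S M) (n - S M)%nat) else 0)).
{ intros M m; rewrite c_S, plus_INR; now destruct (andb _ _). }
specialize (H H0 HS n hn); cbv beta in H.
change (INR 2) with 2.
nra.
Qed.

End Analysis.

From Stdlib Require Import ZArith.
From mathcomp Require Import all_boot all_order all_algebra.
From mathcomp Require Import zify ssrZ ring.

Set Implicit Arguments.
Unset Strict Implicit.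
Unset Printing Implicit Defensive.
Import GRing.Theory.

(** * Enumeration of partitions *)

Section Enumeration.

Variable A : pred nat.

(** Either the largest admissible size is given up or one part of that size is removed; the fuel [f]
    bounds [M + n], which drops in both calls. *)
Fixpoint parts_upto (f M n : nat) : seq (seq nat) :=
  if f is f'.+1 then
    if M is m.+1 then
      parts_upto f' m n ++
      (if (m < n) && A m.+1 then [seq m.+1 :: s | s <- parts_upto f' m.+1 (n - m.+1)] else [::])
    else if n == 0 then [:: [::]] else [::]
  else [::].

Definition allowed (M n : nat) (s : seq nat) : bool :=
  [&& is_partition n s, all A s & all (fun m => m <= M) s].

Lemma allowed_cons (M n x : nat) (s : seq nat) :
  allowed M n (x :: s) = [&& 0 < x, x <= M, x <= n, A x & allowed x (n - x) s].
Proof.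
rewrite /allowed /is_partition /=.
have -> : path geq x s = all (fun m => m <= x) s && sorted geq s.
  by rewrite path_sortedE // => a b c; rewrite /geq /=; lia.
have [xM|xM] := leqP x M; last by rewrite /= ?andbF.
have [x0|x0] := posnP x; first by rewrite x0 /= ?andbF.
have [xn|xn] := leqP x n; last first.
  by rewrite (_ : (x + sumn s == n) = false) ?andbF //; apply/negbTE; lia.
rewrite (_ : (x + sumn s == n) = (sumn s == n - x)); last by lia.
have [sx|] := boolP (all (fun m => m <= x) s); last by rewrite /= ?andbF.
have -> : all (fun m => m <= M) s by apply: sub_all sx => m; lia.
by case: (A x); case: (all A s); rewrite ?andbT ?andbF.
Qed.

Lemma parts_uptoP (f M n : nat) : M + n < f ->
  uniq (parts_upto f M n) /\ forall s, (s \in parts_upto f M n) = allowed M n s.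
Proof.
elim: f M n => // f IHf [|m] n lt_f /=.
  split; first by case: eqP.
  move=> [|x s]; first by rewrite /allowed /is_partition /= eq_sym andbT; case: eqP.
  by rewrite allowed_cons; case: x => [|x] /=; case: eqP => _; rewrite ?inE.
have [u1 m1] : uniq (parts_upto f m n) /\ forall s, (s \in parts_upto f m n) = allowed m n s.
  by apply: IHf; lia.
have E s : (s \in parts_upto f m n) ->
    s \in [seq m.+1 :: s0 | s0 <- parts_upto f m.+1 (n - m.+1)] -> False.
  by move=> s1 /mapP[s' _ es]; move: s1; rewrite es m1 allowed_cons ltnn andbF.
case: ifP => [/andP[lt_mn Am]|nAm].
  have [u2 m2] : uniq (parts_upto f m.+1 (n - m.+1)) /\
      forall s, (s \in parts_upto f m.+1 (n - m.+1)) = allowed m.+1 (n - m.+1) s.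
    by apply: IHf; lia.
  split.
    rewrite cat_uniq u1 map_inj_uniq ?u2 ?andbT //=; last by move=> ? ? [].
    by apply/hasPn => s s2; apply/negP => s1; apply: (E s).
  move=> s; rewrite mem_cat m1; case: s => [|x s].
    rewrite (_ : ([::] \in _) = false) ?orbF //.
    by apply/negbTE/negP => /mapP[].
  have [->|neq] := eqVneq x m.+1.
    rewrite mem_map; last by move=> ? ? [].
    by rewrite m2 !allowed_cons ltnn Am leqnn; lia.
  rewrite (_ : (x :: s \in [seq m.+1 :: s0 | s0 <- _]) = false) ?orbF.
    by rewrite !allowed_cons; congr andb; congr andb; lia.
  by apply/negbTE/negP => /mapP[s' _ [xm _]]; rewrite xm eqxx in neq.
rewrite cats0; split=> // s; rewrite m1; case: s => // x s.
rewrite !allowed_cons.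
have [xm|xm] := eqVneq x m.+1; last by congr andb; congr andb; lia.
by subst x; move: nAm; rewrite ltnn /=; case: (A m.+1); rewrite /= ?andbF // andbT => ->; rewrite ?andbF.
Qed.

Definition npart (M n : nat) : nat := size (parts_upto (M + n).+1 M n).

Lemma size_parts_upto (f M n : nat) : M + n < f -> size (parts_upto f M n) = npart M n.
Proof.
move=> lt_f; have [u1 m1] := parts_uptoP lt_f.
have [u2 m2] := parts_uptoP (ltnSn (M + n)).
by apply/perm_size/uniq_perm => // s; rewrite m1 m2.
Qed.

Lemma npart0 (n : nat) : npart 0 n = (n == 0).
Proof. by rewrite /npart /=; case: eqP. Qed.

(** The same recurrence as that of the coefficients of the truncated product, which is how the count
    meets Cauchy's formula. *)
Lemma npartS (M n : nat) : npart M.+1 n =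
  npart M n + (if (M < n) && A M.+1 then npart M.+1 (n - M.+1) else 0).
Proof.
have E f : parts_upto f.+1 M.+1 n = parts_upto f M n ++
  (if (M < n) && A M.+1 then [seq M.+1 :: s | s <- parts_upto f M.+1 (n - M.+1)] else [::]) by [].
rewrite {1}/npart E size_cat size_parts_upto; last by lia.
congr addn; case: ifP => // /andP[lt_Mn _].
by rewrite size_map size_parts_upto //; lia.
Qed.

Lemma npart_stable (M n : nat) : n <= M -> npart M n = npart n n.
Proof.
move=> le_nM; rewrite -(subnKC le_nM); elim: (M - n) => [|d IHd]; first by rewrite addn0.
by rewrite addnS npartS IHd (_ : n + d < n = false) ?addn0 //; lia.
Qed.

End Enumeration.

Definition regpart (k : nat) : nat -> nat := fun n => npart (fun m => ~~ (k %| m)) n n.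
Definition allpart : nat -> nat := fun n => npart predT n n.

Lemma num_regular_partitions_npart (k n : nat) : num_regular_partitions k n = regpart k n.
Proof.
have [u m] := parts_uptoP (fun m => ~~ (k %| m)) (ltnSn (n + n)).
apply: regular_partitionsE u _ => s; rewrite m /allowed /is_regular_partition.
have [ps|] //= := boolP (is_partition n s).
have [_ bs] := is_partition_bound ps; rewrite (_ : all (leq^~ n) s) ?andbT //.
Qed.

(** * The pentagonal number theorem *)

Section Pentagonal.

Local Open Scope ring_scope.

Variable R : comNzRingType.

(** The pentagonal numbers [j (3 j - 1) / 2]; the companions [j (3 j + 1) / 2] are [pent j + j]. *)
Fixpoint pent (j : nat) : nat := (if j is i.+1 then pent i + (3 * i + 1) else 0)%N.

Variable q : R.

Definition euler (n : nat) : R := \prod_(1 <= i < n.+1) (1 - q ^+ i).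

Definition pent_series (n : nat) : R :=
  1 + \sum_(1 <= s < n.+1) (-1) ^+ s * (q ^+ pent s + q ^+ (pent s + s)).

Definition qprod (s n : nat) : R := \prod_(s.+1 <= i < n.+1) (1 - q ^+ i).

(* Shanks' finite form of the theorem, proved by induction on [n]. *)
Definition shanks_sum (n : nat) : R :=
  \sum_(0 <= s < n.+1) (-1) ^+ s * qprod s n * q ^+ (s * n + 'C(s.+1, 2)).

Lemma pent_bin (s : nat) : pent s.+1 = (s.+1 * s.+1 + 'C(s.+1, 2))%N.
Proof.
elim: s => [|s IHs]; first by rewrite bin_small.
by rewrite [LHS]/= -/(pent s.+1) IHs [in RHS]binS bin1; lia.
Qed.

Lemma qprodS (s n : nat) : (s <= n)%N -> qprod s n.+1 = qprod s n * (1 - q ^+ n.+1).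
Proof. by move=> le_sn; rewrite /qprod big_nat_recr. Qed.

Lemma qprod_nil (n : nat) : qprod n n = 1.
Proof. by rewrite /qprod big_geq. Qed.

Lemma qprod_cons (s n : nat) : (s < n)%N -> qprod s n = (1 - q ^+ s.+1) * qprod s.+1 n.
Proof. by move=> lt_sn; rewrite /qprod big_ltn. Qed.

Lemma shanks (n : nat) : shanks_sum n = pent_series n.
Proof.
elim: n => [|n IHn].
  by rewrite /shanks_sum /pent_series big_nat1 big_geq // qprod_nil !mulr1 addr0.
rewrite /pent_series big_nat_recr //= addrA -/(pent_series n) -IHn.
rewrite /shanks_sum big_nat_recr //= qprod_nil mulr1.
(* Passing from [n] to [n + 1] changes the term of index [s] by [U (s + 1) - U s], with 0 in place
   of [U 0]. The changes telescope to [U (n + 1)], which together with the new last term makes the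
   next pair of pentagonal terms. *)
pose U s := (-1) ^+ s * qprod s.-1 n * q ^+ (s * n.+1 + 'C(s, 2)).
have step s : (s < n.+1)%N ->
    (-1) ^+ s * qprod s n.+1 * q ^+ (s * n.+1 + 'C(s.+1, 2)) =
    (-1) ^+ s * qprod s n * q ^+ (s * n + 'C(s.+1, 2)) + (U s.+1 - (if s is 0 then 0 else U s)).
  move=> lt_sn; rewrite qprodS // /U /=.
  case: s lt_sn => [|s] lt_sn /=.
    by rewrite bin_small // !mul0n !addn0 mul1n !expr0 expr1; ring.
  have -> : 'C(s.+2, 2) = ('C(s.+1, 2) + s.+1)%N by rewrite binS bin1.
  rewrite (qprod_cons (lt_sn : (s < n)%N)); set a := 'C(s.+1, 2); set Q := qprod _ _.
  have -> : (s.+1 * n.+1 + (a + s.+1) = (s.+1 * n + a) + s.+1 + s.+1)%N by lia.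
  have -> : (s.+2 * n.+1 + (a + s.+1) = (s.+1 * n + a) + s.+1 + s.+1 + n.+1)%N by lia.
  have -> : (s.+1 * n + (a + s.+1) = (s.+1 * n + a) + s.+1)%N by lia.
  have -> : (s.+1 * n.+1 + a = (s.+1 * n + a) + s.+1)%N by lia.
  rewrite !exprD; set x := q ^+ (s.+1 * n); set x' := q ^+ a; set y := q ^+ s.+1; set z := q ^+ n.+1.
  by rewrite (exprS (-1) s.+1); ring.
rewrite (eq_big_nat _ _ (F2 := fun s => (-1) ^+ s * qprod s n * q ^+ (s * n + 'C(s.+1, 2)) +
  (U s.+1 - (if s is 0 then 0 else U s)))); last by move=> s /step.
rewrite big_split /= -!addrA; congr (_ + _).
have -> : \sum_(0 <= s < n.+1) (U s.+1 - (if s is 0 then 0 else U s)) = U n.+1.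
  have := telescope_sumr (fun s => if s is 0 then 0 else U s) (leq0n n.+1).
  by rewrite subr0.
rewrite /U /= qprod_nil mulr1 -mulrDr; congr (_ * _).
have -> : (pent n + (3 * n + 1) = n.+1 * n.+1 + 'C(n.+1, 2))%N by rewrite -(pent_bin n).
have -> : 'C(n.+2, 2) = ('C(n.+1, 2) + n.+1)%N by rewrite binS bin1.
by rewrite addnA.
Qed.

(** The term [s = 0] is the Euler product; every other exponent [s n + s (s + 1) / 2] is at least
    [n + 1]. *)
Lemma shanks_head (n : nat) : exists r, shanks_sum n = euler n + q ^+ n.+1 * r.
Proof.
exists (\sum_(1 <= s < n.+1) (-1) ^+ s * qprod s n * q ^+ (s * n + 'C(s.+1, 2) - n.+1)).
rewrite /shanks_sum big_ltn // bin_small // mul0n expr0 mulr1 mul1r; congr (_ + _).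
rewrite big_distrr /=; apply: eq_big_nat => s /andP[s_gt0 _].
rewrite mulrCA -exprD subnKC //.
have : (0 < 'C(s.+1, 2))%N by rewrite bin_gt0.
by case: s s_gt0 => // s _; nia.
Qed.

Lemma euler_pentagonal (n : nat) : exists r, pent_series n = euler n + q ^+ n.+1 * r.
Proof. by rewrite -shanks; apply: shanks_head. Qed.

End Pentagonal.

(** * Regular partitions in terms of all partitions *)

Section Series.

Local Open Scope ring_scope.

(** Congruence modulo ['X^L]: truncated polynomials take the place of formal power series. *)
Definition eqlow (L : nat) (p r : {poly Z}) : Prop := forall i, (i < L)%N -> p`_i = r`_i.

Lemma eqlow_trans (L : nat) (p q r : {poly Z}) : eqlow L p q -> eqlow L q r -> eqlow L p r.
Proof. by move=> pq qr i iL; rewrite pq ?qr. Qed.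

Lemma eqlow_sym (L : nat) (p q : {poly Z}) : eqlow L p q -> eqlow L q p.
Proof. by move=> pq i iL; rewrite pq. Qed.

Lemma eqlowMr (L : nat) (p q r : {poly Z}) : eqlow L p q -> eqlow L (p * r) (q * r).
Proof.
move=> pq i iL; rewrite !coefM; apply: eq_bigr => j _; rewrite pq //.
exact: leq_ltn_trans (leq_ord j) iL.
Qed.

Lemma eqlow_XnM (L m : nat) (p r : {poly Z}) : (L <= m)%N -> eqlow L (p + 'X^m * r) p.
Proof. by move=> Lm i iL; rewrite coefD coefXnM (leq_trans iL Lm) addr0. Qed.

Definition partser (A : pred nat) (M L : nat) : {poly Z} := \poly_(n < L) Z.of_nat (npart A M n).

(** The factor [1 - 'X^(M.+1)] undoes the recurrence that admits the part [M.+1]. *)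
Lemma partser_step (A : pred nat) (M L : nat) :
  eqlow L (partser A M.+1 L * (if A M.+1 then 1 - 'X^(M.+1) else 1)) (partser A M L).
Proof.
move=> i iL; have [AM|nAM] := boolP (A M.+1); last first.
  by rewrite mulr1 !coef_poly iL npartS (negbTE nAM) andbF addn0.
rewrite mulrBr mulr1 coefB coefMXn !coef_poly iL npartS AM andbT ltnS.
case: (ltnP M i) => [lt|le]; last by rewrite subr0 addn0.
by rewrite (leq_ltn_trans (leq_subr _ _) iL) Nat2Z.inj_add [LHS]addrK.
Qed.

Lemma partser_prod (A : pred nat) (M L : nat) :
  eqlow L (partser A M L * \prod_(1 <= m < M.+1 | A m) (1 - 'X^m)) 1.
Proof.
elim: M => [|M IHM].
  rewrite big_geq // mulr1 => i iL.
  by rewrite coef_poly iL npart0 coef1; case: eqP.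
rewrite big_mkcond big_nat_recr //= -big_mkcond /= [X in _ * X]mulrC mulrA.
by apply: eqlow_trans IHM; apply/eqlowMr/partser_step.
Qed.

Lemma prod_multiples (k T : nat) : (0 < k)%N ->
  \prod_(1 <= m < (k * T).+1 | (k %| m)%N) (1 - 'X^m) = euler ('X^k : {poly Z}) T.
Proof.
move=> k_gt0; elim: T => [|T IHT]; first by rewrite muln0 /euler !big_geq.
have skip r : (r < k)%N ->
    \prod_(1 <= m < (k * T + r).+1 | (k %| m)%N) (1 - 'X^m) = euler ('X^k : {poly Z}) T.
  elim: r => [|r IHr] lt_rk; first by rewrite addn0.
  rewrite big_mkcond addnS big_nat_recr //= -big_mkcond /= IHr 1?ltnW //.
  by rewrite -addnS dvdn_addr ?dvdn_mulr // gtnNdvd ?mulr1.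
have -> : (k * T.+1 = (k * T + k.-1).+1)%N by lia.
rewrite big_mkcond big_nat_recr //= -big_mkcond /= skip; last by lia.
have -> : ((k * T + k.-1).+1 = k * T.+1)%N by lia.
by rewrite dvdn_mulr // [RHS]big_nat_recr //= exprM.
Qed.

(** The alternating sum in nested form: each subtraction reverses the signs of all later terms, so
    that no power of [- 1] is computed. *)
Fixpoint psum (k : nat) (F : nat -> Z) (j m : nat) : Z :=
  if m is m'.+1 then F (k * pent j)%N + F (k * (pent j + j))%N - psum k F j.+1 m' else 0.

Lemma psumE (k : nat) (F : nat -> Z) (j m : nat) :
  \sum_(j <= s < j + m) (-1) ^+ s * (F (k * pent s)%N + F (k * (pent s + s))%N) =
    (-1) ^+ j * psum k F j m.
Proof.
elim: m j => [|m IHm] j; first by rewrite addn0 big_geq //= mulr0.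
rewrite big_ltn ?addnS ?ltnS ?leq_addr // -addSn IHm /= exprS; ring.
Qed.

Definition shifted (n d : nat) : Z := if (n < d)%N then 0 else Z.of_nat (allpart (n - d)).

(** The generating product of the [k]-regular partitions is that of all partitions times the product
    of [1 - 'X^(k i)], and the latter is a pentagonal series in ['X^k]. *)
Lemma regpart_pent (k n : nat) : (0 < k)%N ->
  Z.of_nat (regpart k n) = Z.of_nat (allpart n) - psum k (shifted n) 1 n.
Proof.
(* Up to [M = k n] the multiples of [k] are exactly [k], ..., [k n], so that [D] is the Euler
   product of length [n] in ['X^k]. *)
move=> k_gt0; pose M := (k * n)%N; pose L := M.+1.
have nM : (n <= M)%N by rewrite leq_pmull.
pose D : {poly Z} := \prod_(1 <= m < M.+1 | (k %| m)%N) (1 - 'X^m).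
pose N : {poly Z} := \prod_(1 <= m < M.+1 | ~~ (k %| m)%N) (1 - 'X^m).
pose rs := partser (fun m => ~~ (k %| m)%N) M L; pose ps := partser predT M L.
have e1 : eqlow L (rs * N) 1 by apply: partser_prod.
have e2 : eqlow L (ps * (D * N)) 1.
  by have := (@partser_prod predT M L); rewrite (bigID (fun m => (k %| m)%N)).
have e3 : eqlow L rs (ps * D).
  have a := eqlowMr rs e2; have b := eqlowMr (ps * D) e1.
  rewrite mul1r in a; rewrite mul1r in b.
  rewrite (_ : ps * (D * N) * rs = rs * N * (ps * D)) in a; last by ring.
  exact: eqlow_trans (eqlow_sym a) b.
have e4 : eqlow L (pent_series 'X^k n) D.
  have [r ->] := euler_pentagonal ('X^k : {poly Z}) n.
  rewrite -exprM /D prod_multiples //; apply: eqlow_XnM; rewrite /L /M; lia.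
have nL : (n < L)%N by [].
have := e3 n nL; have := eqlowMr ps e4 nL.
rewrite [D * ps]mulrC => <-; rewrite coef_poly nL npart_stable // -/(regpart k n) => ->.
rewrite /pent_series mulrDl mul1r coefD coef_poly nL npart_stable // -/(allpart n).
congr (_ + _); rewrite mulr_suml coef_sum -[RHS]mulN1r -[-1 in RHS]expr1 -psumE add1n.
apply: eq_bigr => s _; rewrite -mulrA -[in LHS]signr_odd -[in RHS]signr_odd mulrDl.
have cf d : ('X^k ^+ d * ps)`_n = shifted n (k * d).
  rewrite -exprM coefXnM /shifted; case: ltnP => // le; rewrite coef_poly.
  by rewrite (leq_ltn_trans (leq_subr _ _) nL) npart_stable // (leq_trans (leq_subr _ _)).
by case: (odd s); rewrite ?expr1 ?expr0 ?mulN1r ?mul1r ?coefN coefD !cf.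
Qed.

(** For [k = 1] no part is admissible, so that [regpart_pent] turns into Euler's recurrence for all
    partitions. *)
Lemma regpart1 (n : nat) : regpart 1 n = (n == 0).
Proof.
rewrite /regpart; move: {1}n => M; elim: M => [|M IHM]; first by rewrite npart0.
by rewrite npartS dvd1n andbF addn0.
Qed.

Lemma pent_mono (i j : nat) : (i <= j)%N -> (pent i <= pent j)%N.
Proof.
elim: j => [|j IHj]; first by rewrite leqn0 => /eqP->.
by rewrite leq_eqVlt => /orP[/eqP->//|/IHj] /=; lia.
Qed.

Lemma pent_ge (j : nat) : (j <= pent j)%N.
Proof. by elim: j => // j IHj /=; lia. Qed.

Lemma psum_0 (k : nat) (F : nat -> Z) (j m : nat) :
  (forall d, (k * pent j <= d)%N -> F d = 0) -> psum k F j m = 0.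
Proof.
elim: m j => // m IHm j F0 /=; rewrite !F0 ?IHm ?addr0 ?subr0 //; last by nia.
by move=> d le_d; apply: F0; apply: leq_trans le_d; rewrite leq_mul2l pent_mono ?orbT.
Qed.

Lemma psum_cut (k : nat) (F : nat -> Z) (j m m' : nat) :
  (forall d, (k * pent (j + m) <= d)%N -> F d = 0) -> psum k F j (m + m') = psum k F j m.
Proof.
elim: m j => [|m IHm] j F0; first by rewrite addn0 in F0; rewrite psum_0.
by rewrite /= IHm // addSn -addnS.
Qed.

(** Terms with [k * pent j > n] vanish because [shifted n] does, so all cut-offs beyond that point
    agree. *)
Lemma psum_fuel (k n m : nat) : (0 < k)%N -> (n < pent m.+1)%N ->
  psum k (shifted n) 1 n = psum k (shifted n) 1 m.
Proof.
move=> k_gt0 lt_n.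
have S0 a : (n < pent a.+1)%N -> forall d, (k * pent (1 + a) <= d)%N -> shifted n d = 0.
  move=> lt_a d le_d; rewrite /shifted ifT //.
  by apply: leq_trans lt_a (leq_trans _ le_d); rewrite leq_pmull.
have lt_nn : (n < pent n.+1)%N by apply: pent_ge.
by rewrite -(psum_cut m (S0 n lt_nn)) addnC (psum_cut n (S0 m lt_n)).
Qed.

End Series.

(** * Verified computation for small arguments *)

(* The generalized pentagonal numbers [pent j] and [pent j + j], times [k], are visited
   by walking down a list with these steps. *)
Fixpoint gaps (k j m : nat) : seq (nat * nat) :=
  if m is m'.+1 then (k * j, k * (2 * j + 1)) :: gaps k j.+1 m' else [::].

Fixpoint gather (g : seq (nat * nat)) (L : seq Z) : Z :=
  match g, L with
  | (a, b) :: g', x :: _ =>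
      let L' := drop a L in Z.sub (Z.add x (head Z0 L')) (gather g' (drop b L'))
  | _, _ => Z0
  end.

Lemma gatherE (k j m : nat) (L : seq Z) :
  gather (gaps k j m) (drop (k * pent j) L) = psum k (nth Z0 L) j m.
Proof.
elim: m j => [|m IHm] j; first by [].
have [le|lt] := leqP (size L) (k * pent j).
  by rewrite drop_oversize // psum_0 // => d le_d; rewrite nth_default // (leq_trans le).
have E x g a b L' : gather ((a, b) :: g) (x :: L') =
    Z.sub (Z.add x (head Z0 (drop a (x :: L')))) (gather g (drop b (drop a (x :: L')))) by [].
rewrite [gaps _ _ _]/= (drop_nth Z0 lt) E -(drop_nth Z0 lt) !drop_drop -nth0 nth_drop addn0.
rewrite [psum _ _ _ _]/= -IHm -mulnDr -[in LHS]mulnDr.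
by congr (Z.sub (Z.add _ (nth _ _ _)) (gather _ (drop _ _))) => /=; lia.
Qed.

(* In a lazy evaluator, inspecting every digit makes the sharing effective. *)
Fixpoint force (p : positive) : bool :=
  match p with xH => true | xO p' => force p' | xI p' => force p' end.

Definition forced (z : Z) : bool := if z is Zpos p then force p else true.

(** The partition numbers by decreasing index, so that entry [d] is the number for [n - d] and each
    recurrence only walks down the list. *)
Fixpoint table (g : seq (nat * nat)) (n : nat) : seq Z :=
  if n is n'.+1 then
    let L := table g n' in let v := gather g L in if forced v then v :: L else v :: L
  else [:: Zpos xH].

Fixpoint vals (g : seq (nat * nat)) (k m : nat) (L : seq Z) : seq Z :=
  match m, L with
  | m'.+1, x :: L' => Z.sub x (gather g (drop k L)) :: vals g k m' L'
  | _, _ => [::]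
  end.

(** The inequality for four consecutive values, [b] being the one at [n], with the negative term
    moved to the other side. *)
Definition window (a b c d : Z) : bool :=
  Z.ltb (Z.mul (Zpos 2) (Z.mul a (Z.mul c c))) (Z.mul b (Z.add (Z.mul c b) (Z.mul a d))).

(* [window] on the leading 36 binary digits, with outward rounding. *)
Definition window35 (a b c d : Z) : bool :=
  let s := Z.max Z0 (Z.sub (Z.log2 a) (Zpos 35)) in
  let e := if Z.eqb s Z0 then Z0 else Zpos 1 in
  let a' := Z.shiftr a s in let b' := Z.shiftr b s in
  let c' := Z.shiftr c s in let d' := Z.shiftr d s in
  Z.ltb (Z.mul (Zpos 2) (Z.mul (Z.add a' e) (Z.mul (Z.add c' e) (Z.add c' e))))
    (Z.mul b' (Z.add (Z.mul c' b') (Z.mul a' d'))).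

Fixpoint windows (m : nat) (L : seq Z) : bool :=
  match m, L with
  | 0, _ => true
  | m'.+1, d :: ((c :: b :: a :: _) as L') => if window35 a b c d then windows m' L' else false
  | _, _ => false
  end.

(* [pent 43 > top], so that 42 terms of the recurrence suffice. *)
Definition top : nat := 2502.

Definition verified (T : seq Z) (k : nat) : bool :=
  windows (top - threshold k - 1) (vals (gaps k 1 42) k top T).

Fixpoint desc (n : nat) : seq Z :=
  if n is n'.+1 then Z.of_nat (allpart n) :: desc n' else [:: Zpos xH].

Lemma nth_desc (n d : nat) : nth Z0 (desc n) d = shifted n d.
Proof.
by elim: n d => [|n IHn] [|d] //=; rewrite ?nth_nil ?IHn.
Qed.

Lemma eq_psum (k : nat) (F G : nat -> Z) (j m : nat) : F =1 G -> psum k F j m = psum k G j m.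
Proof. by move=> FG; elim: m j => //= m IHm j; rewrite !FG IHm. Qed.

Lemma gather_desc (k n m : nat) : 0 < k -> n < pent m.+1 ->
  gather (gaps k 1 m) (drop k (desc n)) = psum k (shifted n) 1 n.
Proof.
move=> k_gt0 lt_n; rewrite (psum_fuel k_gt0 lt_n) -(eq_psum _ _ _ (nth_desc n)) -gatherE.
by rewrite muln1.
Qed.

Lemma tableE (n m : nat) : n < pent m.+1 -> table (gaps 1 1 m) n = desc n.
Proof.
elim: n => // n IHn lt_n; rewrite /= if_same IHn; last exact: ltnW.
have := regpart_pent n.+1 (ltn0Sn 0); rewrite regpart1 -(gather_desc _ lt_n) //= drop0.
by move/eqP; rewrite eq_sym subr_eq0 => /eqP->.
Qed.

Fixpoint regdesc (k n m : nat) : seq Z :=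
  if m is m'.+1 then Z.of_nat (regpart k n) :: regdesc k n.-1 m' else [::].

Lemma valsE (k n m f : nat) : 0 < k -> n < pent f.+1 -> m <= n.+1 ->
  vals (gaps k 1 f) k m (desc n) = regdesc k n m.
Proof.
move=> k_gt0; elim: m n => [|m IHm] n lt_n lt_m; first by [].
have E : desc n = Z.of_nat (allpart n) :: behead (desc n) by case: {+}n.
rewrite [regdesc _ _ _]/= regpart_pent // -(gather_desc k_gt0 lt_n) {1}E /= -E; congr cons.
case: n lt_n lt_m {E} => [|n] lt_n lt_m /=; first by case: m lt_m {IHm}.
by rewrite IHm // ltnW.
Qed.

(** Each value lies between [x' w] and [(x' + e) w], where [x'] is its shift and [w = 2 ^ s]. Both
    sides of the inequality are homogeneous of degree 3, so [w ^ 3] is a common factor. *)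
Lemma window35_sound (a b c d : Z) : Z.le Z0 a -> Z.le Z0 b -> Z.le Z0 c -> Z.le Z0 d ->
  window35 a b c d -> window a b c d.
Proof.
move=> a0 b0 c0 d0; rewrite /window35 /window.
set s := Z.max _ _; set e := if _ then _ else _.
have s0 : Z.le Z0 s by apply: Z.le_max_l.
pose w := Z.pow (Zpos 2) s.
have w0 : Z.lt Z0 w by apply: Z.pow_pos_nonneg.
have lo x : Z.le Z0 x -> Z.le Z0 (Z.shiftr x s) /\ Z.le (Z.mul (Z.shiftr x s) w) x.
  move=> x0; rewrite Z.shiftr_div_pow2 // -/w Z.mul_comm; split.
    exact: Z.div_pos.
  exact: Z.mul_div_le.
have hi x : Z.le Z0 x -> Z.le x (Z.mul (Z.add (Z.shiftr x s) e) w).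
  move=> x0; rewrite Z.shiftr_div_pow2 // -/w /e.
  case: Z.eqb_spec => [s00|_].
    by rewrite /w s00 Z.div_1_r Z.add_0_r Z.mul_1_r; apply: Z.le_refl.
  by rewrite Z.mul_comm; apply/Z.lt_le_incl/Z.mul_succ_div_gt.
have e0 : Z.le Z0 e by rewrite /e; case: Z.eqb.
move=> /Z.ltb_spec0 lt; apply/Z.ltb_spec0.
have [a1 a2] := lo a a0; have [b1 b2] := lo b b0; have [c1 c2] := lo c c0.
have [d1 d2] := lo d d0; have a3 := hi a a0; have c3 := hi c c0.
move: lt a1 a2 a3 b1 b2 c1 c2 c3 d1 d2.
generalize (Z.shiftr a s) (Z.shiftr b s) (Z.shiftr c s) (Z.shiftr d s) => a' b' c' d' lt a1 a2 a3 b1 b2 c1 c2 c3 d1 d2.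
have mono x x' y y' : Z.le Z0 x -> Z.le x x' -> Z.le Z0 y -> Z.le y y' -> Z.le (Z.mul x y) (Z.mul x' y').
  by move=> *; apply: Z.mul_le_mono_nonneg.
have nn x y : Z.le Z0 x -> Z.le Z0 y -> Z.le Z0 (Z.mul x y) by apply: Z.mul_nonneg_nonneg.
have W0 := Z.lt_le_incl _ _ w0.
apply: (Z.le_lt_trans _ (Z.mul (Zpos 2) (Z.mul (Z.mul (Z.add a' e) w)
  (Z.mul (Z.mul (Z.add c' e) w) (Z.mul (Z.add c' e) w))))).
  by apply: Z.mul_le_mono_nonneg_l => //; apply: (mono) => //; [apply: nn|apply: mono].
apply: (Z.lt_le_trans _ (Z.mul (Z.mul b' w) (Z.add (Z.mul (Z.mul c' w) (Z.mul b' w))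
  (Z.mul (Z.mul a' w) (Z.mul d' w))))); last first.
  apply: (mono) => //; first exact: nn.
    by apply: Z.add_nonneg_nonneg; do 2! apply: (nn).
  by apply: Z.add_le_mono; apply: (mono) => //; apply: nn.
have w3 : Z.lt Z0 (Z.mul w (Z.mul w w)) by do 2? apply: Z.mul_pos_pos.
have lt_eq x x' y y' : x = x' -> y = y' -> Z.lt x y -> Z.lt x' y' by move=> -> ->.
by apply: lt_eq (Zmult_lt_compat_r _ _ _ w3 lt); lia.
Qed.

Lemma windowsP (k n m M i : nat) : windows m (regdesc k n M) -> i < m ->
  window35 (Z.of_nat (regpart k (n - i).-1.-1.-1)) (Z.of_nat (regpart k (n - i).-1.-1))
   (Z.of_nat (regpart k (n - i).-1)) (Z.of_nat (regpart k (n - i))).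
Proof.
elim: m n M i => // m IHm n [|[|[|[|M]]]] i //.
rewrite [windows _ _]/=; case: ifP => // win rec.
case: i => [|i] lt_i; first by rewrite subn0.
have -> : n - i.+1 = n.-1 - i by lia.
exact: (IHm n.-1 M.+3).
Qed.

Lemma all_verified : all (verified (table (gaps 1 1 42) top)) [:: 2; 3; 4; 5; 6; 7; 8; 9].
Proof. by vm_compute. Qed.

(** * The two ranges of the index *)

Definition convex_at (k n : nat) : Prop :=
  2 * (regpart k n.-1 * (regpart k n.+1 * regpart k n.+1)) <
  regpart k n * (regpart k n.+1 * regpart k n + regpart k n.-1 * regpart k n.+2).

Lemma nondivE (k m : nat) : 0 < k -> Analysis.nondiv k m = ~~ (k %| m).
Proof.
move=> k_gt0; congr (~~ _); apply/idP/idP => [/Nat.eqb_eq e|/dvdnP[q ->]].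
  by apply/dvdnP; exists (Nat.div m k); have := Nat.div_mod_eq m k; lia.
by apply/Nat.eqb_eq; rewrite -multE Nat.Div0.mod_mul.
Qed.

Lemma lebE (m n : nat) : Nat.leb m n = (m <= n).
Proof. exact/Nat.leb_spec0/leP. Qed.

Lemma convex_at_large (k n : nat) : 2 <= k <= 9 -> 2500 < n -> convex_at k n.
Proof.
move=> k_range; have k_gt0 : 0 < k by case/andP: k_range => /ltnW.
case: n => // n; rewrite ltnS => le_n.
pose c M n := npart (fun m => ~~ (k %| m)) M n.
have E m M : c (m + M)%coq_nat (m + M)%coq_nat = regpart k (M + m)%N by rewrite plusE addnC.
apply/ltP; have := @Analysis.ratio_convex_large_nat k c n; rewrite !E -[c n n]/(regpart k n).
rewrite add1n add2n add3n !multE plusE; apply.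
- by move: k_range => /andP[/leP ? /leP ?].
- by move=> m; rewrite /c npart0; case: m.
- by move=> M m; rewrite /c npartS nondivE // lebE [~~ _ && _]andbC.
exact/leP.
Qed.

Lemma convex_at_verified (N k n : nat) : 0 < k -> N < pent 43 ->
  windows (N - threshold k - 1) (vals (gaps k 1 42) k N (table (gaps 1 1 42) N)) ->
  threshold k <= n -> n.+1 < N -> convex_at k n.
Proof.
move=> k_gt0 lt_N; rewrite (tableE lt_N) valsE // => /windowsP win le_n lt_n.
(* The window that begins at entry [N - n.+2] of the descending list starts with the value at
   [n.+2]; the count [N - threshold k - 1] reaches exactly down to [n = threshold k]. *)
have lt_i : N - n.+2 < N - threshold k - 1 by lia.
move: (win _ lt_i); rewrite subKn //= => /window35_sound; rewrite /window /convex_at => H.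
have /Z.ltb_spec0 := H (Nat2Z.is_nonneg _) (Nat2Z.is_nonneg _) (Nat2Z.is_nonneg _) (Nat2Z.is_nonneg _).
by lia.
Qed.

Lemma convex_at_small (k n : nat) :
  2 <= k <= 9 -> threshold k <= n -> n.+1 < top -> convex_at k n.
Proof.
move=> k_range; apply: convex_at_verified; first by case/andP: k_range => /ltnW.
  by vm_compute.
by apply: (allP all_verified k); rewrite !inE; lia.
Qed.

Unset Implicit Arguments.
Import Order.TTheory Num.Theory.
Local Open Scope ring_scope.

Theorem theorem3p1 (k n : nat) (hk : (2 <= k <= 9)%N) (hn : (threshold k <= n)%N) :
  let p (m : nat) : int := (num_regular_partitions k m)%:Z in
  0 < p n.+1 * p n ^+ 2 - 2 * p n.-1 * p n.+1 ^+ 2 + p n.-1 * p n * p n.+2.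
Proof.
rewrite /= !num_regular_partitions_npart.
have : convex_at k n.
  (* The ranges meet without a gap: with [top = 2502] the table covers [n <= 2500]. *)
  by have [le|lt] := leqP n 2500; [apply: convex_at_small|apply: convex_at_large].
rewrite /convex_at !expr2; lia.
Qed.
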